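(* Assume that the environment law $P$ on $\mathbb{Z}^d$, $d\ge2$, is iid, balanced and uniformly elliptic, and let $\ell\in S^{d-1}$ be a fixed direction. Then there is a constant $C<\infty$ (not depending on $\lambda$ and $t$) such that for all sufficiently small $\lambda\in(0,1)$ and any $t\ge1$, $$\left|E_PE_{\omega^\lambda}\frac{X_{t/\lambda^2}}{t/\lambda}-\frac{v_\lambda}{\lambda}\right|\le\frac{C}{t^{1/5}} .$$
   Context: Let $V=\{v\in\mathbb{Z}^d:|v|\le 1\}$, $\mathcal{M}$ the space of probability measures on $V$, $\Omega=\mathcal{M}^{\mathbb{Z}^d}$, $P$ a probability measure on $\Omega$ with expectation $E_P$. For $\omega=\{\omega(x,v)\}\in\Omega$, $(X_n)$ under the quenched law $P_\omega^x$ is the Markov chain with $X_0=x$ and $P_\omega^x(X_{n+1}=y+v\mid X_n=y)=\omega(y,v)$, $v\in V$; $E_\omega$ is expectation under $P_\omega=P_\omega^o$, $o$ the origin. For real $t\ge 0$, $X_t$ is defined by linear interpolation between $X_{\lfloor t\rfloor}$ and $X_{\lfloor t\rfloor+1}$. iid: the vectors $(\omega(x,e))_{|e|=1}$, $x\in\mathbb{Z}^d$, are iid under $P$. Balanced: $P\{\omega(x,e_i)=\omega(x,-e_i)\ \forall i,x\}=1$. Uniformly elliptic: for some $\kappa>0$, $P\{\omega(x,e)>\kappa\ \forall |e|=1,\forall x\}=1$. For $\lambda\in(0,1)$ the perturbed environment is $\omega^\lambda(x,e)=(1+\lambda\,\ell\cdot e)\,\omega(x,e)$. It is known that there is a deterministic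 $v_\lambda\in\mathbb{R}^d$ such that $\lim_{t\to\infty}X_t/t=v_\lambda$, $P\otimes P_{\omega^\lambda}^o$-almost surely. *)

(* Defs.v *)
From HB Require Import structures.
From mathcomp Require Import all_boot all_order all_algebra.
From mathcomp Require Import all_classical all_reals all_analysis.
From mathcomp Require Import zify lra.

Set Implicit Arguments.
Unset Strict Implicit.
Unset Printing Implicit Defensive.

Import Order.TTheory GRing.Theory Num.Theory.
Import numFieldNormedType.Exports.

Local Open Scope classical_set_scope.
Local Open Scope ring_scope.

HB.instance Definition _ := isPointed.Build int 0.

Section euclid.
Context {R : realType} {d : nat}.

Definition dotp (u v : 'rV[R]_d) : R := \sum_(i < d) u 0 i * v 0 i.

(* The library norm on matrices is the sup norm. *)
Definition enorm (u : 'rV[R]_d) : R := Num.sqrt (dotp u u).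

Definition toR (x : 'rV[int]_d) : 'rV[R]_d := map_mx intr x.

End euclid.

Section environments.
Variables (R : realType) (d : nat).

Definition stepset : set 'rV[int]_d := [set v | enorm (toR v : 'rV[R]_d) <= 1].

(* Probabilities on the step set, as functions on the lattice extended by 0. *)
Definition is_site_law (p : 'rV[int]_d -> R) : Prop :=
  [/\ forall v, 0 <= p v,
      forall v, ~ stepset v -> p v = 0
    & \sum_(v \in stepset) p v = 1].

Definition site_law : Type := set_type [set p | is_site_law p].

Lemma enorm_le1 (v : 'rV[int]_d) : stepset v -> forall i, `|v 0 i| <= 1.
Proof.
move=> Vv i; rewrite leNgt; apply/negP => vi.
have : 1 < enorm (toR v : 'rV[R]_d).
  rewrite /enorm -[X in X < _]sqrtr1 ltr_sqrt; last first.
    rewrite /dotp (bigD1 i)//= -expr2 ltr_pwDl//; last first.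
      by apply: sumr_ge0 => j _; rewrite -expr2 sqr_ge0.
    rewrite !mxE exprn_even_gt0//= intr_eq0 -normr_gt0.
    exact: lt_trans vi.
  rewrite /dotp (bigD1 i)//= -expr2 ltr_wpDr//.
    by apply: sumr_ge0 => j _; rewrite -expr2 sqr_ge0.
  rewrite !mxE -real_normK ?num_real// -intr_norm expr_gte1//.
  by rewrite (ltr_int R 1).
by move=> /lt_le_trans /(_ Vv); rewrite ltxx.
Qed.

Lemma stepsetP (v : 'rV[int]_d) : stepset v ->
  v = 0 \/ exists i, v = delta_mx 0 i \/ v = - delta_mx 0 i.
Proof.
move=> Vv; have [v0|vN0] := eqVneq v 0; [by left|right].
have [i vi0] : exists i, v 0 i != 0.
  apply/existsP; apply: contraNT vN0; rewrite negb_exists => /forallP H.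
  by apply/eqP/rowP => i; have := H i; rewrite negbK mxE => /eqP.
exists i.
have nz_ge1 j : v 0 j != 0 -> 1 <= (v 0 j)%:~R ^+ 2 :> R.
  move=> vj; rewrite -real_normK ?num_real// -intr_norm exprn_ege1//.
  by rewrite (ler_int R 1) -gtz0_ge1 normr_gt0.
have := enorm_le1 Vv i; rewrite ler_norml => /andP[vm vM].
have vj0 j : j != i -> v 0 j = 0.
  move=> ji; apply/eqP/negP => /negP vj; move: Vv.
  rewrite /stepset /= /enorm -[X in _ <= X]sqrtr1 ler_sqrt// leNgt => /negP.
  apply; rewrite /dotp (bigD1 i)//= (bigD1 j)//= !mxE -!expr2 addrA.
  apply: (@lt_le_trans _ _ 2%:R); first by rewrite ltr1n.
  rewrite -[leLHS]addr0 lerD//; last first.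
    by apply: sumr_ge0 => k _; rewrite -expr2 sqr_ge0.
  by rewrite (natrD R 1 1) lerD// nz_ge1.
have {vm vM} : (v 0 i == 1) || (v 0 i == -1).
  by move: vm vM vi0; lia.
case/orP => /eqP vi; [left|right]; apply/rowP => j; rewrite !mxE eqxx/=;
  have [->|/vj0->] := eqVneq j i; rewrite ?oppr0//.
Qed.

Lemma finite_stepset : finite_set stepset.
Proof.
pose f (g : {ffun 'I_d -> 'I_3}) : 'rV[int]_d := \row_i ((g i)%:Z - 1).
apply: (@sub_finite_set _ _ (f @` setT)); last exact: finite_image.
move=> v /enorm_le1 Vv; exists [ffun i => inord `|(v ord0 i + 1)%R|%N] => //.
apply/rowP => i; rewrite !mxE ffunE.
have := Vv i; rewrite ler_norml => /andP[v1 v2].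
have vp : 0 <= v ord0 i + 1 by rewrite -lerBlDr sub0r.
have vE : (`|(v ord0 i + 1)%R|%N)%:Z = v ord0 i + 1 by rewrite gez0_abs.
rewrite inordK ?vE ?addrK//.
by rewrite -ltz_nat vE (le_lt_trans (lerD v2 (lexx 1))).
Qed.

Lemma stepset0 : stepset 0.
Proof.
rewrite /stepset /= /enorm /dotp big1 ?sqrtr0// => i _.
by rewrite !mxE mul0r.
Qed.

Lemma is_site_law_dirac : is_site_law (fun v => (v == 0)%:R).
Proof.
split=> [v|v Vv|]; first by rewrite ler0n.
  by case: eqP => // v0; move: Vv; rewrite v0 => /(_ stepset0).
rewrite (fsbigD1 0)//=; first last.
- exact: stepset0.
- by apply: sub_finite_set finite_stepset => v [].
rewrite eqxx fsbig1 ?addr0// => v [_ /eqP].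
by move=> /negPf ->.
Qed.

HB.instance Definition _ := Choice.on site_law.
HB.instance Definition _ := isPointed.Build site_law
  (SigSub (mem_set (is_site_law_dirac : [set p | is_site_law p] _))).

Definition env_cylinders : set (set ('rV[int]_d -> site_law)) :=
  \bigcup_(z in [set: 'rV[int]_d * 'rV[int]_d])
    preimage_set_system setT
      (fun w : 'rV[int]_d -> site_law => \val (w z.1) z.2) measurable.

Definition env : Type := g_sigma_algebraType env_cylinders.
HB.instance Definition _ := Measurable.on env.

End environments.

Section trajectories.
Variable d : nat.

Definition traj_cylinders : set (set (nat -> 'rV[int]_d)) :=
  [set A | exists n x, A = [set X | X n = x]].

Definition traj : Type := g_sigma_algebraType traj_cylinders.
HB.instance Definition _ := Measurable.on traj.

End trajectories.

Section markov_chain.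
Variables (R : realType) (d : nat).

Definition tr (w : env R d) (x v : 'rV[int]_d) : R := \val (w x) v.

(* The conditional probabilities given the past are written as products, so that
   histories of probability 0 need no convention. *)
Definition is_markov_law (w : env R d) (x : 'rV[int]_d)
    (mu : probability (traj d) R) : Prop :=
  mu [set X | X 0%N = x] = 1%E /\
  forall (n : nat) (p : nat -> 'rV[int]_d) (v : 'rV[int]_d), stepset R v ->
    mu [set X | (forall k, (k <= n)%N -> X k = p k) /\ X n.+1 = p n + v] =
    (mu [set X | forall k, (k <= n)%N -> X k = p k] * (tr w (p n) v)%:E)%E.

Lemma is_site_law_tr w x : is_site_law (tr w x).
Proof. exact: (set_mem (valP (w x))). Qed.

Lemma tr_ge0 w x v : 0 <= tr w x v.
Proof. by case: (is_site_law_tr w x) => + _ _; exact. Qed.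

Lemma tr_out w x v : ~ stepset R v -> tr w x v = 0.
Proof. by case: (is_site_law_tr w x) => _ + _; exact. Qed.

Lemma tr_sum w x : \sum_(v \in @stepset R d) tr w x v = 1.
Proof. by case: (is_site_law_tr w x). Qed.

(* Each finite history is coded by a subinterval of [0, 1[ whose length is its
   probability; the law is the image of Lebesgue measure under decoding. *)
Section construction.
Variables (w : env R d) (x0 : 'rV[int]_d).

Let s : seq 'rV[int]_d :=
  finmap.enum_fset (fset_set (@stepset R d)).

Let mem_s v : v \in s -> stepset R v.
Proof. by rewrite in_fset_set ?inE//; exact: finite_stepset. Qed.

Let s_mem v : stepset R v -> v \in s.
Proof. by move=> Vv; rewrite in_fset_set ?inE//; exact: finite_stepset. Qed.

Let cum x k : R := \sum_(v <- take k s) tr w x v.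

Let cum0 x : cum x 0 = 0. Proof. by rewrite /cum take0 big_nil. Qed.

Let cumS x k : (k < size s)%N -> cum x k.+1 = cum x k + tr w x (nth 0 s k).
Proof. by move=> ks; rewrite /cum (take_nth 0)// -cats1 big_cat big_seq1. Qed.

Let cum_le x j k : (j <= k)%N -> cum x j <= cum x k.
Proof.
move=> jk; rewrite /cum -(subnKC jk) takeD big_cat/= lerDl.
by apply: sumr_ge0 => v _; exact: tr_ge0.
Qed.

Let cum1 x : cum x (size s) = 1.
Proof.
rewrite /cum take_size -(tr_sum w x) (fsbig_finite _ _ (@finite_stepset R d))//=.
Qed.

Let idx x (u a l : R) : nat :=
  find (fun k => u < a + l * cum x k.+1) (iota 0 (size s)).

Let s_gt0 : (0 < size s)%N.
Proof. by case: s (s_mem (stepset0 R d)). Qed.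

Let idxP x u a l k : 0 <= l -> a <= u < a + l -> (k < size s)%N ->
  idx x u a l = k <-> a + l * cum x k <= u < a + l * cum x k.+1.
Proof.
move=> l0 /andP[au ul] ks.
pose P k := u < a + l * cum x k.+1.
have Phas : has P (iota 0 (size s)).
  apply/hasP; exists (size s).-1; first by rewrite mem_iota/= add0n prednK.
  by rewrite /P prednK// cum1 mulr1.
have := Phas; rewrite has_find size_iota => fs.
have nthI j : (j < size s)%N -> nth 0%N (iota 0 (size s)) j = j.
  by move=> js; rewrite nth_iota.
have mono i j : (i <= j)%N -> a + l * cum x i <= a + l * cum x j.
  by move=> ij; rewrite lerD2l ler_wpM2l// cum_le.
split=> [<-|/andP[h1 h2]].
  have := nth_find 0%N Phas; rewrite nthI// => Pf.
  rewrite [X in _ && X]Pf andbT /idx -/P.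
  case E : (find P _) => [|m]; first by rewrite cum0 mulr0 addr0.
  have /= := @before_find _ 0%N P (iota 0 (size s)) m.
  rewrite E ltnS leqnn => /(_ isT); rewrite nthI; last first.
    by apply: leq_trans fs; rewrite E.
  by rewrite /P => /negbT; rewrite -leNgt.
apply/eqP; rewrite eqn_leq; apply/andP; split; rewrite leqNgt; apply/negP => H.
  have := @before_find _ 0%N P (iota 0 (size s)) k H.
  by rewrite nthI// /P h2.
have := nth_find 0%N Phas; rewrite nthI// /P ltNge => /negP; apply.
by apply: le_trans h1; exact: mono.
Qed.

Let step u (z : 'rV[int]_d * R * R) : 'rV[int]_d * R * R :=
  let: (x, a, l) := z in let k := idx x u a l in
  (x + nth 0 s k, a + l * cum x k, l * tr w x (nth 0 s k)).

Let state u n := iter n (step u) (x0, 0, 1).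

Let W (u : R) : traj d :=
  fun n => if u \in `[0, 1[%R then (state u n).1.1 else x0.

Fixpoint bnd (p : nat -> 'rV[int]_d) n : R * R :=
  if n is m.+1 then
    let: (a, l) := bnd p m in let v := p m.+1 - p m in
    (a + l * cum (p m) (index v s), l * tr w (p m) v)
  else (0, 1).

Let bnd_ge0 p n : 0 <= (bnd p n).2.
Proof.
elim: n => //= n; case: (bnd p n) => a l /= l0.
by rewrite mulr_ge0// tr_ge0.
Qed.

Let cylP p n u : u \in `[0, 1[%R ->
  (forall k, (k <= n)%N -> W u k = p k) <->
  p 0%N = x0 /\ (bnd p n).1 <= u < (bnd p n).1 + (bnd p n).2.
Proof.
move=> u01.
suff : ((forall k, (k <= n)%N -> W u k = p k) ->
  p 0%N = x0 /\ state u n = (p n, (bnd p n).1, (bnd p n).2) /\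
   (bnd p n).1 <= u < (bnd p n).1 + (bnd p n).2) /\
  (p 0%N = x0 /\ (bnd p n).1 <= u < (bnd p n).1 + (bnd p n).2 ->
   state u n = (p n, (bnd p n).1, (bnd p n).2) /\
   forall k, (k <= n)%N -> W u k = p k).
  by move=> [H1 H2]; split=> [/H1[-> [_ ->]]//|/H2[]].
elim: n => [|n [IH1 IH2]].
  have Wu0 : W u 0%N = x0 by rewrite /W u01.
  split=> [/(_ 0%N isT)|[p0 _]].
    rewrite Wu0 => <-; split=> //; split=> //=.
    by move: u01; rewrite in_itv/= add0r.
  split; first by rewrite p0.
  by case=> [_|//]; rewrite Wu0 p0.
have l0 := bnd_ge0 p n.
split.
- move=> H; have /IH1[p0 [Es Hu]] : forall k, (k <= n)%N -> W u k = p k.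
    by move=> k kn; apply: H; rewrite ltnW.
  have := H n.+1 (leqnn _); rewrite /W u01 /state iterS -/(state u n) Es /=.
  move: Hu l0; case: (bnd p n) => a l /= Hu l0.
  set k := idx _ _ _ _ => E.
  have ks : (k < size s)%N.
    have := Hu; rewrite /k => /andP[au ul].
    rewrite /idx -{2}(size_iota 0 (size s)) -has_find.
    apply/hasP; exists (size s).-1; first by rewrite mem_iota/= add0n prednK.
    by rewrite prednK// cum1 mulr1.
  have Ev : p n.+1 - p n = nth 0 s k by rewrite -E addrC addKr.
  have iE : index (p n.+1 - p n) s = k.
    by rewrite Ev index_uniq//; exact: finmap.fset_uniq.
  rewrite p0; split=> //; split.
    by rewrite iE Ev E.
  have /(idxP (p n) l0 Hu ks) := erefl k; rewrite iE Ev cumS// mulrDr addrA.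
  by [].
- move=> [p0]; move: IH1 IH2 l0 => /=; case: (bnd p n) => a l /= IH1 IH2 l0 Hu.
  set v := p n.+1 - p n in Hu *.
  have vs : v \in s.
    apply: s_mem; apply: contrapT => nV; move: Hu.
    rewrite tr_out// mulr0 addr0 => /andP[h1 h2].
    by have := le_lt_trans h1 h2; rewrite ltxx.
  have is_ : (index v s < size s)%N by rewrite index_mem.
  have Hu' : a <= u < a + l.
    move: Hu => /andP[h1 h2]; apply/andP; split.
      by apply: le_trans h1; rewrite lerDl mulr_ge0// -(cum0 (p n)) cum_le.
    apply: lt_le_trans h2 _; rewrite -addrA lerD2l -mulrDr ler_piMr//.
    by rewrite -{2}(nth_index 0 vs) -cumS// -(cum1 (p n)) cum_le.
  have [Es HW] := IH2 (conj p0 Hu').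
  have Ei : idx (p n) u a l = index v s.
    apply/(idxP _ l0 Hu' is_); rewrite cumS// nth_index// mulrDr addrA.
    exact: Hu.
  have Es' : state u n.+1 = (p n.+1, a + l * cum (p n) (index v s),
      l * tr w (p n) v).
    rewrite /state iterS -/(state u n) Es /= Ei nth_index//.
    by rewrite /v addrC subrK.
  split=> // k; rewrite leq_eqVlt => /predU1P[->|]; last exact: HW.
  by rewrite /W u01 Es'.
Qed.

Let mW : @measurable_fun _ _ (measurableTypeR R) (traj d) setT W.
Proof.
have := @measurability _ _ (measurableTypeR R) (traj d) setT W (@traj_cylinders d) erefl.
apply => // _ [_ [n [x ->]] <-].
rewrite setTI.
pose F (t : seq 'rV[int]_d) : set R :=
  if (nth 0 t 0 == x0) && (nth 0 t n == x) then
    `[0, 1[ `&` `[(bnd (nth 0 t) n).1,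
                  (bnd (nth 0 t) n).1 + (bnd (nth 0 t) n).2[
  else set0.
have -> : W @^-1` [set X | X n = x] =
    \bigcup_t F t `|` ((~` `[0, 1[) `&` [set _ | x0 = x]).
  apply/seteqP; split=> [u /= Wu|u].
    have [u01|u01] := boolP (u \in `[0, 1[%R); last first.
      right; split; first by move/negP : u01.
      by move: Wu; rewrite /W (negbTE u01).
    left; exists (mkseq (W u) n.+1) => //; rewrite /F.
    have H : forall k, (k <= n)%N -> W u k = nth 0 (mkseq (W u) n.+1) k.
      by move=> k kn; rewrite nth_mkseq.
    have /(cylP _ _ u01)[p0 Hu] := H.
    by rewrite p0 -H// Wu !eqxx/=; split=> //=; rewrite in_itv/=.
  case=> [[t _]|[/= u01 <-]]; last first.
    by rewrite /W; case: ifPn => // /u01.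
  rewrite /F; case: ifPn => // /andP[/eqP t0 /eqP tn] [/= u01].
  rewrite in_itv/= => Hu; rewrite -tn.
  by have /(cylP _ _ u01) := conj t0 Hu; apply.
apply: measurableU.
  apply: countable_bigcupT_measurable; first exact: countableP.
  by move=> t; rewrite /F; case: ifP => // _; exact: measurableI.
apply: measurableI; first exact: measurableC.
have [->|/eqP xx0] := eqVneq x0 x.
  by rewrite (_ : [set _ | _] = setT)//; apply/seteqP; split.
by rewrite (_ : [set _ | _] = set0)//; apply/seteqP; split.
Qed.

Let mu01 := mrestr (@lebesgue_measure R) (measurable_itv `[(0:R), 1[).

Let mu01T : mu01 setT = 1%E.
Proof.
by rewrite /mu01 /mrestr setTI lebesgue_measure_itv/= lte_fin ltr01 sube0.
Qed.

HB.instance Definition _ := Measure.on mu01.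
HB.instance Definition _ := Measure_isProbability.Build _ _ _ mu01 mu01T.

Let bnd_le1 p n : 0 <= (bnd p n).1 /\ (bnd p n).1 + (bnd p n).2 <= 1.
Proof.
elim: n => /= [|n [a0 al1]]; first by rewrite add0r.
have := bnd_ge0 p n; move: a0 al1; case: (bnd p n) => a l /= a0 al1 l0.
set v := p n.+1 - p n.
split; first by rewrite addr_ge0// mulr_ge0// -(cum0 (p n)) cum_le.
have [vs|vs] := boolP (v \in s); last first.
  rewrite (_ : tr w (p n) v = 0); last by apply: tr_out => /s_mem; exact/negP.
  rewrite mulr0 addr0; apply: le_trans al1; rewrite lerD2l ler_piMr//.
  by rewrite memNindex// cum1.
apply: le_trans al1; rewrite -addrA lerD2l -mulrDr ler_piMr//.
by rewrite -{2}(nth_index 0 vs) -cumS ?index_mem// -(cum1 (p n)) cum_le// index_mem.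
Qed.

Let mu01_cyl p n : p 0%N = x0 ->
  mu01 (W @^-1` [set X | forall k, (k <= n)%N -> X k = p k]) =
  (bnd p n).2%:E.
Proof.
move=> p0; rewrite /mu01 /mrestr.
rewrite (_ : _ `&` _ = `[(bnd p n).1, (bnd p n).1 + (bnd p n).2[%classic).
  rewrite lebesgue_measure_itv/= lte_fin ltrDl.
  have := bnd_ge0 p n; rewrite le_eqVlt => /predU1P[<-|->].
    by rewrite ltxx.
  by rewrite -EFinB addrC addKr.
have [h0 h1] := bnd_le1 p n.
apply/seteqP; split=> [u [H u01]|u /=].
  by have /(cylP _ _ u01)[_] := H; rewrite /= in_itv.
rewrite in_itv/= => Hu.
have u01 : u \in `[0, 1[%R.
  move: Hu; rewrite in_itv/= => /andP[h2 h3].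
  by rewrite (le_trans h0 h2) (lt_le_trans h3 h1).
by split=> //; apply/(cylP _ _ u01).
Qed.

Let mu01_cyl0 p n : p 0%N <> x0 ->
  mu01 (W @^-1` [set X | forall k, (k <= n)%N -> X k = p k]) = 0%E.
Proof.
move=> p0; rewrite /mu01 /mrestr (_ : _ `&` _ = set0) ?measure0//.
apply/seteqP; split=> // u [H u01].
by have /(cylP _ _ u01)[] := H.
Qed.

Lemma markov_law_exists : exists mu, is_markov_law w x0 mu.
Proof.
pose X : {mfun measurableTypeR R >-> traj d} :=
  @mfun_Sub _ _ (measurableTypeR R) (traj d) W (mem_set mW).
exists (distribution mu01 X); split.
  change (mu01 (W @^-1` [set Y | Y 0%N = x0]) = 1%E).
  have -> : W @^-1` [set Y | Y 0%N = x0] =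
      W @^-1` [set Y | forall k, (k <= 0)%N -> Y k = (fun=> x0) k].
    apply/seteqP; split=> u /=; last exact.
    by move=> H [].
  by rewrite mu01_cyl.
move=> n p v Vv.
change (mu01 (W @^-1` [set Y | (forall k, (k <= n)%N -> Y k = p k) /\
      Y n.+1 = (p n + v)%R]) =
  mu01 (W @^-1` [set Y | forall k, (k <= n)%N -> Y k = p k]) *
  (tr w (p n) v)%:E)%E.
pose q k := if (k <= n)%N then p k else p n + v.
have qp k : (k <= n)%N -> q k = p k by rewrite /q => ->.
have qn : q n.+1 = p n + v by rewrite /q ltnn.
have -> : W @^-1` [set Y | (forall k, (k <= n)%N -> Y k = p k) /\
      Y n.+1 = p n + v] =
    W @^-1` [set Y | forall k, (k <= n.+1)%N -> Y k = q k].
  apply/seteqP; split=> u /= => [[H1 H2] k|H].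
    by rewrite leq_eqVlt => /predU1P[->|kn]; rewrite ?qn// H1// qp.
  split; last by rewrite H.
  by move=> k kn; rewrite -qp// H// ltnW.
have -> : W @^-1` [set Y | forall k, (k <= n)%N -> Y k = p k] =
    W @^-1` [set Y | forall k, (k <= n)%N -> Y k = q k].
  by apply/seteqP; split=> u /= H k kn; rewrite ?qp// H// qp.
have [q0|q0] := pselect (q 0%N = x0); last by rewrite !mu01_cyl0// mul0e.
rewrite !mu01_cyl//= qn qp//; case: (bnd q n) => a l /=.
by rewrite (addrC (p n)) addrK EFinM.
Qed.

End construction.

(* The law of a Markov chain is determined by [is_markov_law]; the choice made
   here is therefore immaterial. *)
Definition quenched_law (w : env R d) (x : 'rV[int]_d) :
  probability (traj d) R := sval (cid (markov_law_exists w x)).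

Lemma quenched_lawP w x : is_markov_law w x (quenched_law w x).
Proof. exact: svalP. Qed.

End markov_chain.

Section random_environment.
Variables (R : realType) (d : nat).

Definition unit_step : Type :=
  set_type [set e : 'rV[int]_d | enorm (toR e : 'rV[R]_d) = 1].

Definition vector_cylinders : set (set (unit_step -> R)) :=
  \bigcup_(e in [set: unit_step])
    preimage_set_system setT (fun f : unit_step -> R => f e) measurable.

Definition step_vector : Type := g_sigma_algebraType vector_cylinders.
HB.instance Definition _ := Measurable.on step_vector.

Definition site_vector (x : 'rV[int]_d) (w : env R d) : step_vector :=
  fun e => tr w x (\val e).

Definition iid_env (P : probability (env R d) R) : Prop :=
  (forall (s : seq 'rV[int]_d) (B : 'rV[int]_d -> set step_vector), uniq s ->
     (forall x, measurable (B x)) ->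
     P [set w | forall x, x \in s -> B x (site_vector x w)] =
     (\prod_(x <- s) P [set w | B x (site_vector x w)])%E) /\
  (forall (x y : 'rV[int]_d) (B : set step_vector), measurable B ->
     P [set w | B (site_vector x w)] = P [set w | B (site_vector y w)]).

Definition balanced_env (P : probability (env R d) R) : Prop :=
  P [set w | forall (i : 'I_d) (x : 'rV[int]_d),
       tr w x (delta_mx 0 i) = tr w x (- delta_mx 0 i)] = 1%E.

Definition uniformly_elliptic_env (P : probability (env R d) R) : Prop :=
  exists2 kappa : R, 0 < kappa &
    P [set w | forall e : 'rV[int]_d, enorm (toR e : 'rV[R]_d) = 1 ->
         forall x : 'rV[int]_d, kappa < tr w x e] = 1%E.

(* When w is balanced these weights form a site law, see [perturbE]; otherwise
   they need not, and the law at the site is then left unperturbed. *)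
Definition perturb (l : 'rV[R]_d) (lam : R) (w : env R d) : env R d :=
  fun x => insubd (w x) (fun e => (1 + lam * dotp l (toR e)) * tr w x e).

Lemma perturbE (l : 'rV[R]_d) (lam : R) (w : env R d) (x : 'rV[int]_d) :
  enorm l = 1 -> 0 < lam < 1 ->
  (forall i : 'I_d, tr w x (delta_mx 0 i) = tr w x (- delta_mx 0 i)) ->
  forall e, tr (perturb l lam w) x e = (1 + lam * dotp l (toR e)) * tr w x e.
Proof.
move=> l1 /andP[lam0 lam1] bal e.
set f := fun e => (1 + lam * dotp l (toR e)) * tr w x e.
suff Hf : is_site_law f.
  by rewrite /tr /perturb insubdK//; exact: mem_set.
have dotp0 : dotp l (toR 0) = 0.
  by rewrite /dotp big1// => i _; rewrite !mxE mulr0.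
have dotpN v : dotp l (toR (- v)) = - dotp l (toR v).
  by rewrite /dotp -sumrN; apply: eq_bigr => i _; rewrite !mxE rmorphN mulrN.
have dotp_delta i : dotp l (toR (delta_mx 0 i)) = l 0 i.
  rewrite /dotp (bigD1 i)//= !mxE !eqxx mulr1 big1 ?addr0// => j ji.
  by rewrite !mxE (negPf ji) andbF mulr0.
have l_le1 i : `|l 0 i| <= 1.
  rewrite -l1 /enorm -sqrtr_sqr ler_sqrt; last first.
    by apply: sumr_ge0 => j _; rewrite -expr2 sqr_ge0.
  rewrite /dotp (bigD1 i)//= -expr2 lerDl.
  by apply: sumr_ge0 => j _; rewrite -expr2 sqr_ge0.
have trN v : stepset R v -> tr w x (- v) = tr w x v.
  by case/stepsetP => [->|[i [->|->]]]; rewrite ?oppr0 ?opprK ?bal.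
have dotp_le1 v : stepset R v -> `|dotp l (toR v)| <= 1.
  by case/stepsetP => [->|[i [->|->]]];
    rewrite ?dotpN ?normrN ?dotp_delta// dotp0 normr0.
have stepsetN v : stepset R v -> stepset R (- v).
  rewrite /stepset/= /enorm /dotp; congr (Num.sqrt _ <= _).
  by apply: eq_bigr => i _; rewrite !mxE rmorphN mulrNN.
have finV := @finite_stepset R d.
split=> [v|v /tr_out t0|]; rewrite /f.
- have [Vv|/tr_out->] := pselect (stepset R v); last by rewrite mulr0.
  rewrite mulr_ge0 ?tr_ge0// -lerBlDl sub0r lerNl.
  rewrite (le_trans (ler_norm _))// normrN normrM gtr0_norm//.
  by rewrite (le_trans _ (ltW lam1))// ler_piMr ?dotp_le1// ltW.
- by rewrite t0 mulr0.
pose S := \sum_(v \in @stepset R d) dotp l (toR v) * tr w x v.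
have S0 : S = 0.
  suff : S = - S by lra.
  rewrite {1}/S (reindex_fsbig -%R (@stepset R d)); last first.
    split=> [v /stepsetN//|u v _ _ /oppr_inj//|v Vv].
    by exists (- v); [exact: stepsetN|rewrite opprK].
  rewrite /S !fsbig_finite//= -sumrN; apply: eq_big_seq => v.
  by rewrite in_fset_set// inE => Vv; rewrite dotpN trN// mulNr.
transitivity (\sum_(v \in @stepset R d) tr w x v + lam * S).
  rewrite /S !fsbig_finite//= mulr_sumr -big_split/=; apply: eq_bigr => v _.
  by rewrite mulrDl mul1r mulrA.
by rewrite S0 mulr0 addr0 tr_sum.
Qed.

Definition walk_at (X : traj d) (t : R) : 'rV[R]_d :=
  let n := Num.truncn t in
  toR (X n) + (t - n%:R) *: (toR (X n.+1) - toR (X n)).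

Definition annealed_law (P : probability (env R d) R) (l : 'rV[R]_d) (lam : R)
    (A : set (env R d * traj d)) : \bar R :=
  (\int[P]_w quenched_law (perturb l lam w) 0%R (xsection A w))%E.

Definition is_speed (P : probability (env R d) R) (l : 'rV[R]_d) (lam : R)
    (v : 'rV[R]_d) : Prop :=
  {ae annealed_law P l lam, forall z : env R d * traj d,
     t^-1 *: walk_at z.2 t @[t --> +oo] --> v}.

Definition vexpect dT (T : measurableType dT) (mu : probability T R)
    (f : T -> 'rV[R]_d) : 'rV[R]_d :=
  \row_(i < d) \int[mu]_z f z 0 i.

End random_environment.

(* Main.v *)
(* For a balanced environment the mean displacement of the walk in a direction i is
   lam l_i times the mean u(n) of the sum over k < n of 2 omega(X_k, e_i), and it
   suffices that u be almost additive: |u(m + n) - u(m) - u(n)| is at most a constant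
   times lam^-2 + lam^-1 (1 + sqrt m).  Then u(n) / n is within C / (lam sqrt n) of its
   limit as soon as n >= lam^-2 / 2, which for n = t / lam^2 is even a bound C / sqrt t
   for the rate.

   Write the height of x as l . x.  The walk gains height at a speed at least of
   order lam, so from any point it reaches within a mean time lam^-1 a new half-space,
   where the environment is fresh.  There its future depends on the environment
   already seen, but boundedly so: let D be the largest difference, over pairs of
   environments below height 0, of the annealed values of u(n) from the origin.
   - By the Krylov-Safonov estimate, available at scale 1 / lam because the drift is of
     order lam, the exit laws from the half-space below height 1 / lam of the walks
     in two environments that agree above height 0 overlap by a constant.
   - Two environments that agree down to depth s produce a difference that decays like
     exp(- lam s / 4) D, up to an error of order lam^-2.
   Coupling the walks at their exits gives D <= (1 - c) D + C lam^-2, hence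
   D <= C lam^-2 uniformly in n.  To compare u(m + n) - u(m) with u(n), run the walk
   from time m to the next record height; the environment there being independent of
   the past, this costs D plus the mean delay, of order lam^-1 (1 + sqrt m) since the
   depth below the past record has second moment of order m. *)
Require Import Defs.
From HB Require Import structures.
From mathcomp Require Import all_boot all_order all_algebra.
From mathcomp Require Import all_classical all_reals all_analysis.
From mathcomp Require Import measurable_realfun.
From mathcomp Require Import zify ring lra.

Import Order.TTheory GRing.Theory Num.Theory.
Import numFieldNormedType.Exports.

Local Open Scope classical_set_scope.
Local Open Scope ring_scope.

Set Implicit Arguments.
Unset Strict Implicit.
Unset Printing Implicit Defensive.

(** * Walks tilted in a direction *)

Section walk.
Variables (R : realType) (d : nat) (l : 'rV[R]_d) (lam : R).
Local Notation L := 'rV[int]_d.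
Local Notation cfield := (L -> 'I_d -> R).
Implicit Types (c : cfield) (f g : L -> R) (x y : L).

(** Walks are handled through their generator acting on functions on the lattice. A walk stopped on
    leaving a domain, or at time [N], is the [N]-th iterate of an operator, its law is a finite sum
    over a box, and probabilistic estimates become maximum principles for sub- or superharmonic
    functions. Path measures enter only at the end, when the quenched law is identified with such
    iterates. Stopping at a finite [N] leaves some mass inside the domain, at most the mean exit
    time divided by [N]; as [N] is free, this is made as small as needed.

    The obstacle is the clock: on entering a new half-space the walk has only a random part of its
    [n] steps left. The horizon is nevertheless kept at [n]. Since the generator of [pot] is bounded
    by 1 for every horizon, this costs at most the mean time elapsed, which over a height [1 / lam]
    is of order [lam ^- 2], the very size of the error that the contraction can afford. The
    environment behind the walk may be arbitrary, and only its influence on [Phi] is estimated. *)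

Definition evec (i : 'I_d) : L := delta_mx 0 i.

Definition lev (x : L) : R := dotp l (toR x).

(* [c x i] is the common weight of the two steps [evec i] and [- evec i] at [x]
   before tilting. *)
Definition gen c f x : R :=
  \sum_i c x i * ((1 + lam * l 0 i) * (f (x + evec i) - f x)
                  + (1 - lam * l 0 i) * (f (x - evec i) - f x)).

Definition walk_step c f x : R := f x + gen c f x.

(** Each weight serves two opposite steps, and [1 - 2 * \sum_i c x i] is the probability of not
    moving; hence the bound [1 / 2]. *)
Definition admissible (kap : R) c :=
  (forall x i, kap <= c x i) /\ (forall x, \sum_i c x i <= 1 / 2).

Lemma evecE i j : evec i 0 j = (i == j)%:R.
Proof. by rewrite /evec mxE eqxx eq_sym. Qed.

Lemma lev0 : lev 0 = 0.
Proof. by rewrite /lev /dotp big1// => i _; rewrite !mxE mulr0. Qed.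

Lemma levD x y : lev (x + y) = lev x + lev y.
Proof.
rewrite /lev /dotp -big_split/=; apply: eq_bigr => i _.
by rewrite !mxE rmorphD mulrDr.
Qed.

Lemma levN x : lev (- x) = - lev x.
Proof.
rewrite /lev /dotp -sumrN/=; apply: eq_bigr => i _.
by rewrite !mxE rmorphN mulrN.
Qed.

Lemma levB x y : lev (x - y) = lev x - lev y.
Proof. by rewrite levD levN. Qed.

Lemma lev_evec i : lev (evec i) = l 0 i.
Proof.
rewrite /lev /dotp (bigD1 i)//= big1 => [|j ji]; rewrite !mxE eqxx.
  by rewrite eqxx mulr1 addr0.
by rewrite (negPf ji) mulr0.
Qed.

Lemma gen_lin c a b f g x :
  gen c (fun z => a * f z + b * g z) x = a * gen c f x + b * gen c g x.
Proof.
by rewrite /gen !mulr_sumr -big_split/=; apply: eq_bigr => i _; ring.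
Qed.

Lemma gen_cst c (a : R) x : gen c (fun=> a) x = 0.
Proof. by rewrite /gen big1// => i _; ring. Qed.

Lemma genB c f g x : gen c (fun z => f z - g z) x = gen c f x - gen c g x.
Proof.
transitivity (gen c (fun z => 1 * f z + (-1) * g z) x).
  by apply: eq_bigr => i _; ring.
by rewrite gen_lin; ring.
Qed.

Lemma eq_gen c f g x :
  f x = g x -> (forall i, f (x + evec i) = g (x + evec i)) ->
  (forall i, f (x - evec i) = g (x - evec i)) -> gen c f x = gen c g x.
Proof. by move=> h0 h1 h2; apply: eq_bigr => i _; rewrite h0 h1 h2. Qed.

Lemma eq_gen_field c c' f x : c x = c' x -> gen c f x = gen c' f x.
Proof. by move=> cc; apply: eq_bigr => i _; rewrite cc. Qed.

(** The tilts cancel in the coefficient of [f x]. For an admissible field and small [lam] this is a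
    convex combination of [f x] and its neighbours, from which positivity is read off. *)
Lemma stepE c f x : walk_step c f x = (1 - 2 * \sum_i c x i) * f x +
  \sum_i c x i * ((1 + lam * l 0 i) * f (x + evec i)
                  + (1 - lam * l 0 i) * f (x - evec i)).
Proof.
rewrite /walk_step /gen mulrBl mul1r -addrA; congr (_ + _).
rewrite mulrAC mulr_sumr -sumrN -big_split/=.
by apply: eq_bigr => i _; ring.
Qed.

Lemma gen_lev c x : gen c lev x = 2 * lam * \sum_i c x i * (l 0 i) ^+ 2.
Proof.
rewrite /gen mulr_sumr; apply: eq_bigr => i _.
by rewrite levD levB lev_evec; ring.
Qed.

Section unit_direction.
Hypotheses (l1 : enorm l = 1) (lam0 : 0 < lam) (lam1 : lam <= 1 / 2).

Lemma sum_sqr_dir : \sum_i (l 0 i) ^+ 2 = 1.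
Proof.
have h : dotp l l = \sum_i (l 0 i) ^+ 2.
  by apply: eq_bigr => i _; rewrite expr2.
have h0 : 0 <= dotp l l by rewrite h sumr_ge0// => i _; rewrite sqr_ge0.
by rewrite -h -[LHS]sqr_sqrtr// -/(enorm l) l1 expr1n.
Qed.

Lemma dir_le1 i : `|l 0 i| <= 1.
Proof.
rewrite -(@expr_le1 _ 2)// real_normK ?num_real// -sum_sqr_dir (bigD1 i)//= lerDl.
by rewrite sumr_ge0// => j _; rewrite sqr_ge0.
Qed.

Lemma bias_le i : `|lam * l 0 i| <= 1 / 2.
Proof.
rewrite normrM gtr0_norm//; have := dir_le1 i.
by move=> h; rewrite (le_trans _ lam1)// ler_piMr// ltW.
Qed.

Lemma lev_nbr x i : lev (x + evec i) <= lev x + 1 /\ lev (x - evec i) <= lev x + 1 /\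
  lev x - 1 <= lev (x + evec i) /\ lev x - 1 <= lev (x - evec i).
Proof.
have := dir_le1 i; rewrite ler_norml => /andP[h1 h2].
by rewrite levD levB lev_evec; split; [|split; [|split]]; lra.
Qed.

Variables (kap : R).
Hypothesis kap0 : 0 < kap.

Lemma step_ge0 c f x : admissible kap c -> 0 <= f x ->
  (forall i, 0 <= f (x + evec i)) -> (forall i, 0 <= f (x - evec i)) ->
  0 <= walk_step c f x.
Proof.
move=> [c1 c2] f0 fp fm; rewrite stepE addr_ge0//.
  by rewrite mulr_ge0//; have := c2 x; lra.
apply: sumr_ge0 => i _; apply: mulr_ge0; first exact: le_trans (ltW kap0) (c1 _ _).
have := bias_le i; rewrite ler_norml => /andP[h1 h2].
by rewrite addr_ge0// mulr_ge0//; lra.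
Qed.

Lemma step_mono c f g x : admissible kap c -> f x <= g x ->
  (forall i, f (x + evec i) <= g (x + evec i)) ->
  (forall i, f (x - evec i) <= g (x - evec i)) -> walk_step c f x <= walk_step c g x.
Proof.
move=> ac h0 hp hm; rewrite -subr_ge0.
have -> : walk_step c g x - walk_step c f x = walk_step c (fun z => g z - f z) x.
  by rewrite /walk_step genB; ring.
by apply: step_ge0 => // *; rewrite subr_ge0.
Qed.

(** [kap] bounds the weight of the step and [1 / 2] its tilt; all other terms are nonnegative. *)
Lemma step_nbr_ge c f x i : admissible kap c -> (forall z, 0 <= f z) ->
  kap / 2 * f (x + evec i) <= walk_step c f x /\ kap / 2 * f (x - evec i) <= walk_step c f x.
Proof.
move=> [c1 c2] f0; rewrite stepE (bigD1 i)//= [X in _ * f x + X](bigD1 i)//=.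
have b j : 0 <= c x j * ((1 + lam * l 0 j) * f (x + evec j)
                  + (1 - lam * l 0 j) * f (x - evec j)).
  apply: mulr_ge0; first exact: le_trans (ltW kap0) (c1 _ _).
  have := bias_le j; rewrite ler_norml => /andP[h1 h2].
  by rewrite addr_ge0// mulr_ge0//; lra.
have h1 : 0 <= (1 - 2 * (c x i + \sum_(j < d | j != i) c x j)) * f x.
  by rewrite mulr_ge0//; have := c2 x; rewrite (bigD1 i)//=; lra.
have h2 : 0 <= \sum_(j < d | j != i) c x j * ((1 + lam * l 0 j) * f (x + evec j)
                  + (1 - lam * l 0 j) * f (x - evec j)) by apply: sumr_ge0.
have := bias_le i; rewrite ler_norml => /andP[h3 h4].
have u1 : 1 / 2 * f (x + evec i) <= (1 + lam * l 0 i) * f (x + evec i).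
  by rewrite ler_wpM2r//; lra.
have u2 : 1 / 2 * f (x - evec i) <= (1 - lam * l 0 i) * f (x - evec i).
  by rewrite ler_wpM2r//; lra.
have k1 := c1 x i; have p1 := f0 (x + evec i); have p2 := f0 (x - evec i).
set S := (1 + lam * l 0 i) * f (x + evec i) + (1 - lam * l 0 i) * f (x - evec i).
have hS1 : 1 / 2 * f (x + evec i) <= S by rewrite /S; lra.
have hS2 : 1 / 2 * f (x - evec i) <= S by rewrite /S; lra.
have hS : kap * S <= c x i * S by rewrite ler_wpM2r//; lra.
have q1 : kap * (1 / 2 * f (x + evec i)) <= kap * S by rewrite ler_wpM2l// ltW.
have q2 : kap * (1 / 2 * f (x - evec i)) <= kap * S by rewrite ler_wpM2l// ltW.
by split; lra.
Qed.

(** After multiplication by [1 - u], the left side is at most 1, while the right side is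
    [1 + u ^+ 2 * (1 - 2 * u)], at least 1. *)
Lemma expR_quadr_ub (u : R) : u <= 1 / 2 -> expR u <= 1 + u + 2 * u ^+ 2.
Proof.
move=> u2; have h : 1 - u <= expR (- u) by exact: expR_ge1Dx.
have e0 := expR_gt0 u.
have : expR (- u) * expR u = 1 by rewrite -expRD addNr expR0.
have h3 : (1 - u) * expR u <= expR (- u) * expR u by rewrite ler_wpM2r// ltW.
move=> E; rewrite E in h3.
rewrite -(@ler_pM2l _ (1 - u)); last lra.
apply: (le_trans h3).
by have := sqr_ge0 u; nra.
Qed.

Lemma sum_field_dir c x : admissible kap c -> kap <= \sum_i c x i * l 0 i ^+ 2 <= 1 / 2.
Proof.
move=> [c1 c2]; apply/andP; split.
  rewrite -{1}[kap]mulr1 -sum_sqr_dir mulr_sumr; apply: ler_sum => i _.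
  by rewrite ler_wpM2r ?sqr_ge0.
apply: le_trans (c2 x); apply: ler_sum => i _; rewrite ler_piMr//.
  exact: le_trans (ltW kap0) (c1 x i).
by rewrite -real_normK ?num_real// expr_le1// dir_le1.
Qed.

Lemma gen_lev_ge c x : admissible kap c -> 2 * lam * kap <= gen c lev x.
Proof.
move=> ac; rewrite gen_lev; have /andP[h _] := sum_field_dir x ac.
by rewrite ler_wpM2l// mulr_ge0// ltW.
Qed.

(** Below [r] the drift shortens the gap, so the only positive contribution is the second moment of
    one step in height, at most 1. The second moment of the gap thus grows at most linearly in
    time. *)
Lemma gen_sqr_gap c r x : admissible kap c -> lev x <= r ->
  gen c (fun z => (r - lev z) ^+ 2) x <= 1.
Proof.
move=> ac xr; have /andP[h1 h2] := sum_field_dir x ac.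
have -> : gen c (fun z => (r - lev z) ^+ 2) x =
   - (4 * lam * (r - lev x)) * (\sum_i c x i * l 0 i ^+ 2) +
   2 * (\sum_i c x i * l 0 i ^+ 2).
  rewrite /gen !mulr_sumr -big_split/=; apply: eq_bigr => i _.
  by rewrite levD levB lev_evec; ring.
have : 0 <= 4 * lam * (r - lev x) * (\sum_i c x i * l 0 i ^+ 2).
  apply: mulr_ge0; last by rewrite (le_trans (ltW kap0)).
  by apply: mulr_ge0; rewrite ?subr_ge0// mulr_ge0// ltW.
by lra.
Qed.

(** A supermartingale that is at least 1 beyond depth [s]: it bounds the probability of ever getting
    there. *)
Definition ediscount (s : R) (x : L) : R := expR (- (lam / 4 * (lev x + s))).

Lemma ediscount_gt0 s x : 0 < ediscount s x.
Proof. exact: expR_gt0. Qed.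

(** With the quadratic bound on the exponentials, direction [i] contributes [4 * (lam / 4) ^+ 2 - 2
    * lam * (lam / 4) = - (lam ^+ 2 / 4)] times [l 0 i ^+ 2]: at a rate as small as [lam / 4] the
    drift beats the curvature. *)
Lemma gen_ediscount c s x : admissible kap c ->
  gen c (ediscount s) x <= - (kap * lam ^+ 2 / 4) * ediscount s x.
Proof.
move=> ac; have /andP[h1 h2] := sum_field_dir x ac; have [c1 c2] := ac.
apply: (@le_trans _ _ (\sum_i c x i * (l 0 i ^+ 2 * (- (lam ^+ 2 / 4)) * ediscount s x))).
  apply: ler_sum => i _; apply: ler_wpM2l; first exact: le_trans (ltW kap0) (c1 _ _).
  rewrite /ediscount levD levB lev_evec.
  set E := expR (- (lam / 4 * (lev x + s))); have E0 : 0 < E by exact: expR_gt0.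
  have -> : expR (- (lam / 4 * (lev x + l 0 i + s))) = E * expR (- (lam / 4 * l 0 i)).
    by rewrite /E -expRD; congr expR; ring.
  have -> : expR (- (lam / 4 * (lev x - l 0 i + s))) = E * expR (lam / 4 * l 0 i).
    by rewrite /E -expRD; congr expR; ring.
  have := bias_le i; rewrite ler_norml => /andP[b1 b2].
  have t1 : lam / 4 * l 0 i <= 1 / 2 by lra.
  have t2 : - (lam / 4 * l 0 i) <= 1 / 2 by lra.
  have e1 := expR_quadr_ub t1; have e2 := expR_quadr_ub t2.
  have p1 : (1 + lam * l 0 i) * expR (- (lam / 4 * l 0 i)) <= (1 + lam * l 0 i) *
     (1 + - (lam / 4 * l 0 i) + 2 * (- (lam / 4 * l 0 i)) ^+ 2).
    by rewrite ler_wpM2l//; lra.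
  have p2 : (1 - lam * l 0 i) * expR (lam / 4 * l 0 i) <= (1 - lam * l 0 i) *
     (1 + (lam / 4 * l 0 i) + 2 * (lam / 4 * l 0 i) ^+ 2).
    by rewrite ler_wpM2l//; lra.
  have := lerD p1 p2.
  set e3 := expR (- (lam / 4 * l 0 i)); set e4 := expR (lam / 4 * l 0 i) => p3.
  have -> : (1 + lam * l 0 i) * (E * e3 - E) + (1 - lam * l 0 i) * (E * e4 - E) =
    ((1 + lam * l 0 i) * e3 + (1 - lam * l 0 i) * e4 - 2) * E by ring.
  by apply: ler_wpM2r; [exact: ltW|lra].
have -> : \sum_i c x i * (l 0 i ^+ 2 * - (lam ^+ 2 / 4) * ediscount s x) =
   (\sum_i c x i * l 0 i ^+ 2) * (- (lam ^+ 2 / 4) * ediscount s x).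
  by rewrite mulr_suml; apply: eq_bigr => i _; ring.
have E0 := ediscount_gt0 s x.
have : 0 <= lam ^+ 2 / 4 * ediscount s x by rewrite !mulr_ge0// ltW// exprn_gt0.
by nra.
Qed.

End unit_direction.
End walk.

Section box.
Variable d : nat.
Local Notation L := 'rV[int]_d.

Lemma coord_add (x : L) i j : (x + evec i) 0 j = x 0 j + (if i == j then (1:int) else 0).
Proof. by rewrite mxE evecE; case: (i == j). Qed.

Lemma coord_sub (x : L) i j : (x - evec i) 0 j = x 0 j - (if i == j then (1:int) else 0).
Proof. by rewrite mxE [X in _ + X]mxE evecE; case: (i == j). Qed.

Definition box_point (x : L) (N : nat) (f : {ffun 'I_d -> 'I_(N.*2.+1)}) : L :=
  x + \row_i ((f i)%:Z - N%:Z).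

Definition box (x : L) (N : nat) : seq L :=
  [seq box_point x f | f : {ffun 'I_d -> 'I_(N.*2.+1)}].

Lemma box_uniq x N : uniq (box x N).
Proof.
rewrite map_inj_uniq ?enum_uniq// => f g /addrI /rowP E.
by apply/ffunP => i; apply: val_inj; have := E i; rewrite !mxE => /addIr [].
Qed.

Lemma mem_box x N y : (y \in box x N) = [forall i, `|y 0 i - x 0 i| <= N%:Z].
Proof.
apply/mapP/forallP => [[f _ ->] i|H].
  rewrite !mxE addrAC subrr add0r ler_norml; have := ltn_ord (f i).
  by move: (nat_of_ord (f i)) => k kN; lia.
exists [ffun i => inord `|(y 0 i - x 0 i + N%:Z)%R|%N]; first by rewrite mem_enum.
apply/rowP => i; rewrite !mxE ffunE; have h := H i.
have tE (t : int) : `|t| <= N%:Z -> (`|(t + N%:Z)%R|%N)%:Z = t + N%:Z /\ (`|(t + N%:Z)%R| < N.*2.+1)%N.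
  by rewrite ler_norml => /andP[t1 t2]; lia.
have [e1 e2] := tE _ h.
by rewrite inordK// e1 addrK addrC subrK.
Qed.

Lemma box_refl x N : x \in box x N.
Proof. by rewrite mem_box; apply/forallP => i; rewrite subrr normr0. Qed.

Lemma box_nbr x y N i : y \in box x N ->
  (y + evec i \in box x N.+1) && (y - evec i \in box x N.+1).
Proof.
rewrite !mem_box => /forallP H; apply/andP; split; apply/forallP => j;
  have := H j; rewrite ?coord_add ?coord_sub; move: (y 0 j) (x 0 j) => a b;
  rewrite !ler_norml; case: (_ == _) => /andP[h1 h2]; lia.
Qed.

Lemma box_nbr_le x y N i : (y \in box (x + evec i) N) || (y \in box (x - evec i) N) ->
  y \in box x N.+1.
Proof.
rewrite !mem_box => /orP[] /forallP H; apply/forallP => j;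
  have := H j; rewrite ?coord_add ?coord_sub; move: (y 0 j) (x 0 j) => a b;
  rewrite !ler_norml; case: (_ == _) => /andP[h1 h2]; lia.
Qed.

Lemma box_le x y M N : (M <= N)%N -> y \in box x M -> y \in box x N.
Proof.
move=> MN; rewrite !mem_box => /forallP H; apply/forallP => j.
by apply: le_trans (H j) _; rewrite lez_nat.
Qed.

End box.

(** * Stopped walks and optional stopping *)

Section stopped.
Variables (R : realType) (d : nat) (l : 'rV[R]_d) (lam : R).
Local Notation L := 'rV[int]_d.
Local Notation cfield := (L -> 'I_d -> R).
Local Notation gen := (gen l lam).
Local Notation step := (walk_step l lam).
Local Notation lev := (lev l).
Implicit Types (c : cfield) (f g : L -> R) (x y : L) (D : L -> bool).

Definition stopped_step c D f x : R := if D x then step c f x else f x.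

(* [stopped c D N f x] is the expectation of [f] at the position, at time [N] or at
   the exit time of [D] if earlier, of the walk started at [x]. *)
Definition stopped c D N f : L -> R := iter N (stopped_step c D) f.

Definition ker c D N x y : R := stopped c D N (fun z => (z == y)%:R) x.

Lemma stoppedS c D N f x : stopped c D N.+1 f x =
  if D x then step c (stopped c D N f) x else stopped c D N f x.
Proof. by []. Qed.

Lemma stopped_out c D N f x : ~~ D x -> stopped c D N f x = f x.
Proof. by move=> Dx; elim: N => //= N IH; rewrite /stopped_step (negPf Dx). Qed.

Lemma stopped_eq_field c c' D N f x : (forall z, D z -> c z = c' z) ->
  stopped c D N f x = stopped c' D N f x.
Proof.
move=> cc; elim: N x => //= N IH x; rewrite /stopped_step; case: ifP => // Dx; rewrite /step.
rewrite (eq_gen_field _ _ _ (cc _ Dx)) IH; congr (_ + _).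
by apply: eq_gen => *; exact: IH.
Qed.

Lemma stopped_lin c D N a b f g x :
  stopped c D N (fun z => a * f z + b * g z) x = a * stopped c D N f x + b * stopped c D N g x.
Proof.
elim: N x => [//|N IH] x; rewrite !stoppedS; case: ifP => // Dx.
have -> : stopped c D N (fun z => a * f z + b * g z) =
  (fun z => a * stopped c D N f z + b * stopped c D N g z) by exact/funext.
by rewrite /step gen_lin; ring.
Qed.

Lemma stopped_cst c D N a x : stopped c D N (fun=> a) x = a.
Proof.
elim: N x => [//|N IH] x; rewrite stoppedS; case: ifP => // Dx.
have -> : stopped c D N (fun=> a) = (fun=> a) by exact/funext.
by rewrite /step gen_cst addr0.
Qed.

Lemma stopped_sum (I : Type) (r : seq I) c D N (F : I -> L -> R) x :
  stopped c D N (fun z => \sum_(k <- r) F k z) x = \sum_(k <- r) stopped c D N (F k) x.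
Proof.
elim: r => [|k r IH].
  rewrite big_nil -[RHS](stopped_cst c D N 0 x); congr stopped.
  by apply/funext => z; rewrite big_nil.
rewrite big_cons -IH.
have -> : (fun z => \sum_(j <- k :: r) F j z) = (fun z => 1 * F k z + 1 * \sum_(j <- r) F j z).
  by apply/funext => z; rewrite big_cons; ring.
by rewrite stopped_lin; ring.
Qed.

Section unit_direction.
Hypotheses (l1 : enorm l = 1) (lam0 : 0 < lam) (lam1 : lam <= 1 / 2).
Variables (kap : R).
Hypothesis kap0 : 0 < kap.

(** [J] contains all sites that the stopped walk can visit, typically [D] and one step beyond, so
    the comparison is needed there only. *)
Lemma stopped_mono_on (J : L -> Prop) c D N f g x : admissible kap c ->
  (forall z, J z -> D z -> forall i, J (z + evec i) /\ J (z - evec i)) ->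
  J x -> (forall z, J z -> f z <= g z) -> stopped c D N f x <= stopped c D N g x.
Proof.
move=> ac JD Jx fg; elim: N x Jx => /= [x Jx|N IH x Jx]; first exact: fg.
rewrite /stopped_step; case: ifP => Dx; last exact: IH.
apply: (@step_mono _ _ _ _ _ _ _ kap) => //; first exact: IH.
  by move=> i; apply: IH; have [] := JD _ Jx Dx i.
by move=> i; apply: IH; have [] := JD _ Jx Dx i.
Qed.

Lemma stopped_mono c D N f g x : admissible kap c ->
  (forall z, f z <= g z) -> stopped c D N f x <= stopped c D N g x.
Proof. by move=> ac fg; apply: (@stopped_mono_on (fun=> True)). Qed.

Lemma stopped_ge0 c D N f x : admissible kap c ->
  (forall z, 0 <= f z) -> 0 <= stopped c D N f x.
Proof.
by move=> ac f0; rewrite -[leLHS](stopped_cst c D N 0 x); exact: stopped_mono.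
Qed.

Lemma ker_ge0 c D N x y : admissible kap c -> 0 <= ker c D N x y.
Proof. by move=> ac; apply: stopped_ge0. Qed.

Lemma stopped_local c D N f g x : (forall z, z \in box x N -> f z = g z) ->
  stopped c D N f x = stopped c D N g x.
Proof.
elim: N x => [x H|N IH x H] /=; first exact/H/box_refl.
have e0 : stopped c D N f x = stopped c D N g x.
  by apply: IH => z zx; apply: H; apply: box_le zx.
rewrite /stopped_step; case: ifP => // Dx; rewrite /step e0; congr (_ + _).
by apply: eq_gen => // i; apply: IH => z zx; apply: H; apply: (@box_nbr_le _ _ _ _ i);
  rewrite zx ?orbT.
Qed.

Lemma stopped_ker c D N f x :
  stopped c D N f x = \sum_(y <- box x N) ker c D N x y * f y.
Proof.
transitivity (stopped c D N (fun z => \sum_(y <- box x N) f y * (z == y)%:R) x).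
  apply: stopped_local => z zx.
  rewrite (bigD1_seq z)//= ?box_uniq// eqxx mulr1 big1 ?addr0// => y yz.
  by rewrite eq_sym (negPf yz) mulr0.
rewrite stopped_sum; apply: eq_bigr => y _.
have -> : (fun z => f y * (z == y)%:R) = (fun z => f y * (z == y)%:R + 0 * (0 : R)).
  by apply/funext => z; rewrite mulr0 addr0.
by rewrite (stopped_lin _ _ _ _ _ _ (fun=> 0)) mul0r addr0 mulrC.
Qed.

Lemma sum_ker c D N x : \sum_(y <- box x N) ker c D N x y = 1.
Proof.
rewrite -[RHS](stopped_cst c D N 1 x) stopped_ker.
by apply: eq_bigr => y _; rewrite mulr1.
Qed.

Lemma ker_eq0 (J : L -> Prop) c D N x y : admissible kap c ->
  (forall z, J z -> D z -> forall i, J (z + evec i) /\ J (z - evec i)) ->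
  J x -> ~ J y -> ker c D N x y = 0.
Proof.
move=> ac JD Jx Jy; apply/eqP; rewrite eq_le ker_ge0// andbT.
rewrite -[leRHS](stopped_cst c D N 0 x); apply: (@stopped_mono_on J) => // z Jz.
by case: eqP => // zy; move: Jy; rewrite -zy => /(_ Jz).
Qed.

Lemma stopped_sub c D N f x : admissible kap c ->
  (forall z, D z -> 0 <= gen c f z) -> f x <= stopped c D N f x.
Proof.
move=> ac H; elim: N x => //= N IH x; rewrite /stopped_step; case: ifP => // Dx.
apply: (@le_trans _ _ (step c f x)); first by rewrite /step lerDl H.
by apply: (@step_mono _ _ _ _ _ _ _ kap).
Qed.

Lemma stopped_super c D N f x : admissible kap c ->
  (forall z, D z -> gen c f z <= 0) -> stopped c D N f x <= f x.
Proof.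
move=> ac H; elim: N x => //= N IH x; rewrite /stopped_step; case: ifP => // Dx.
apply: (@le_trans _ _ (step c f x)); last by rewrite /step gerDl H.
by apply: (@step_mono _ _ _ _ _ _ _ kap).
Qed.

(** Markov's inequality for the exit time, whose mean is dominated by [T]. *)
Lemma stopped_inside c D N (T : L -> R) x : admissible kap c ->
  (forall z, 0 <= T z) -> (forall z, D z -> gen c T z <= -1) ->
  N%:R * stopped c D N (fun z => (D z)%:R) x <= T x.
Proof.
move=> ac T0 TD; set f := fun z => (D z)%:R : R.
have dec M : forall z, stopped c D M.+1 f z <= stopped c D M f z.
  elim: M => [z|M IH z].
    rewrite /= /stopped_step; case: ifP => // Dz.
    apply: (@le_trans _ _ (step c (fun=> 1) z)).
      by apply: (@step_mono _ _ _ _ _ _ _ kap) => //; rewrite /f; [|move=> i|move=> i]; case: (D _).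
    by rewrite /step gen_cst addr0 /f Dz.
  rewrite [leLHS]stoppedS [leRHS]stoppedS; case: ifP => [Dz|Dz]; last by rewrite stoppedS Dz.
  exact: (@step_mono _ _ _ _ _ _ _ kap).
(* The value of [T] at the stopped position is carried along to close the induction: each step made
   inside uses up at least 1 of it. *)
suff H : N%:R * stopped c D N f x + stopped c D N T x <= T x.
  by apply: (le_trans _ H); rewrite lerDl stopped_ge0.
elim: N x => [x|N IH x]; first by rewrite mul0r add0r.
rewrite stoppedS [X in _ + X]stoppedS; case: ifP => Dx; last first.
  by rewrite !stopped_out ?Dx// /f Dx mulr0 add0r.
have E : step c (fun z => N%:R * stopped c D N f z + 1 * stopped c D N T z) x <= step c T x.
  by apply: (@step_mono _ _ _ _ _ _ _ kap) => // *; rewrite mul1r.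
have E2 : step c (fun z => N%:R * stopped c D N f z + 1 * stopped c D N T z) x =
  N%:R * step c (stopped c D N f) x + step c (stopped c D N T) x.
  by rewrite /step gen_lin; ring.
have h1 : step c T x <= T x - 1 by rewrite /step; have := TD _ Dx; lra.
have h2 : step c (stopped c D N f) x <= 1.
  rewrite -[leRHS](_ : step c (fun=> 1) x = 1); last by rewrite /step gen_cst addr0.
  have le1 z : stopped c D N f z <= 1.
    rewrite -[leRHS](stopped_cst c D N 1 z); apply: stopped_mono => // y.
    by rewrite /f; case: (D y).
  by apply: (@step_mono _ _ _ _ _ _ _ kap).
rewrite -natr1 mulrDl mul1r.
by rewrite E2 in E; lra.
Qed.

(** Optional stopping for [U + T] and [U - T]: the mean of [U] moves by at most 1 per step, hence by
    at most the mean number of steps. *)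
Lemma stopped_cost c D N (T U : L -> R) x : admissible kap c ->
  (forall z, 0 <= T z) -> (forall z, D z -> gen c T z <= -1) ->
  (forall z, D z -> `|gen c U z| <= 1) ->
  `|stopped c D N U x - U x| <= T x.
Proof.
move=> ac T0 TD UD.
have T1 := stopped_ge0 D N x ac T0.
have h1 : stopped c D N (fun z => 1 * U z + 1 * T z) x <= 1 * U x + 1 * T x.
  apply: (@stopped_super c D N (fun z => 1 * U z + 1 * T z)) => // z Dz.
  by rewrite gen_lin; have := TD _ Dz; have := UD _ Dz; rewrite ler_norml; lra.
have h2 : 1 * U x + (-1) * T x <= stopped c D N (fun z => 1 * U z + (-1) * T z) x.
  apply: (@stopped_sub c D N (fun z => 1 * U z + (-1) * T z)) => // z Dz.
  by rewrite gen_lin; have := TD _ Dz; have := UD _ Dz; rewrite ler_norml; lra.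
by move: h1 h2; rewrite !stopped_lin => h1 h2; rewrite ler_norml; lra.
Qed.

(* Dominates the mean time spent below level [r]; the [+ 1] is the overshoot. *)
Definition exit_cost (r : R) (x : L) : R :=
  Num.max 0 ((r + 1 - lev x) / (2 * kap * lam)).

Lemma exit_cost_ge0 r x : 0 <= exit_cost r x.
Proof. by rewrite /exit_cost le_max lexx. Qed.

Lemma exit_costE r x : lev x <= r + 1 -> exit_cost r x = (r + 1 - lev x) / (2 * kap * lam).
Proof.
move=> h; apply/max_idPr; rewrite divr_ge0//; first by lra.
by rewrite !mulr_ge0// ltW.
Qed.

Lemma gen_exit_cost c r x : admissible kap c -> lev x < r -> gen c (exit_cost r) x <= -1.
Proof.
move=> ac xr.
have kl : 0 < 2 * kap * lam by rewrite !mulr_gt0.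
(* The neighbours of [x] are at level at most [r + 1], where the maximum with 0 is inactive and the
   cost is affine in [lev]. *)
have -> : gen c (exit_cost r) x =
   gen c (fun z => (r + 1) / (2 * kap * lam) * 1 + - (2 * kap * lam)^-1 * lev z) x.
  have := lev_nbr l1 x => H.
  by apply: eq_gen => [|i|i]; rewrite exit_costE; try (by ring);
    try (by have [? [? [? ?]]] := H i; lra); lra.
rewrite (gen_lin _ _ _ _ _ (fun=> 1)) gen_cst mulr0 add0r mulNr lerN2.
rewrite -[leLHS](@mulVf _ (2 * kap * lam)) ?gt_eqF// ler_pM2l ?invr_gt0//.
by have := gen_lev_ge l1 lam0 kap0 x ac; lra.
Qed.

End unit_direction.
End stopped.

Lemma seq_argmax (R : realType) (T : eqType) (F : T -> R) (s : seq T) x0 : x0 \in s ->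
  exists2 y, y \in s & forall z, z \in s -> F z <= F y.
Proof.
move=> x0s; have : s != [::] by apply: contraTneq x0s => ->.
elim: s {x0s} => // x s IH _; have [->|/IH[y ys yM]] := eqVneq s [::].
  by exists x; rewrite ?mem_head// => z; rewrite inE => /eqP->.
have [yx|/ltW xy] := leP (F y) (F x).
  exists x; first exact: mem_head.
  by move=> z; rewrite inE => /predU1P[->//|/yM /le_trans]; apply.
exists y; first by rewrite inE ys orbT.
by move=> z; rewrite inE => /predU1P[->//|/yM].
Qed.

(** * The Alexandrov-Bakelman-Pucci and Krylov-Safonov estimates *)

Section contact.
Variables (R : realType) (d : nat) (l : 'rV[R]_d) (lam : R).
Local Notation L := 'rV[int]_d.
Local Notation cfield := (L -> 'I_d -> R).
Local Notation gen := (gen l lam).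
Local Notation lev := (lev l).
Implicit Types (c : cfield) (f g : L -> R) (x y : L).

Definition sqdist (x z : L) : R := \sum_i ((z 0 i - x 0 i)%:~R) ^+ 2.

Definition plane (p : 'I_d -> R) (x z : L) : R := \sum_i p i * (z 0 i - x 0 i)%:~R.

Lemma sum_coord_add (F : 'I_d -> int -> R) x i :
  \sum_j F j ((x + evec i) 0 j) = \sum_j F j (x 0 j) + (F i (x 0 i + 1) - F i (x 0 i)).
Proof.
rewrite (bigD1 i)//= coord_add eqxx [in RHS](bigD1 i)//=.
rewrite (eq_bigr (fun j => F j (x 0 j))) => [|j ji]; first by ring.
by rewrite coord_add eq_sym (negPf ji) addr0.
Qed.

Lemma sum_coord_sub (F : 'I_d -> int -> R) x i :
  \sum_j F j ((x - evec i) 0 j) = \sum_j F j (x 0 j) + (F i (x 0 i - 1) - F i (x 0 i)).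
Proof.
rewrite (bigD1 i)//= coord_sub eqxx [in RHS](bigD1 i)//=.
rewrite (eq_bigr (fun j => F j (x 0 j))) => [|j ji]; first by ring.
by rewrite coord_sub eq_sym (negPf ji) subr0.
Qed.

Lemma sqdist_add x z i :
  sqdist x (z + evec i) = sqdist x z + 2 * (z 0 i - x 0 i)%:~R + 1.
Proof.
rewrite /sqdist (sum_coord_add (fun j (n : int) => (n - x 0 j)%:~R ^+ 2)).
by rewrite !intrD !intrN; ring.
Qed.

Lemma sqdist_sub x z i :
  sqdist x (z - evec i) = sqdist x z - 2 * (z 0 i - x 0 i)%:~R + 1.
Proof.
rewrite /sqdist (sum_coord_sub (fun j (n : int) => (n - x 0 j)%:~R ^+ 2)).
by rewrite !intrD !intrN; ring.
Qed.

Lemma plane_add p x z i : plane p x (z + evec i) = plane p x z + p i.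
Proof.
rewrite /plane (sum_coord_add (fun j (n : int) => p j * (n - x 0 j)%:~R)).
by rewrite !intrD !intrN; ring.
Qed.

Lemma plane_sub p x z i : plane p x (z - evec i) = plane p x z - p i.
Proof.
rewrite /plane (sum_coord_sub (fun j (n : int) => p j * (n - x 0 j)%:~R)).
by rewrite !intrD !intrN; ring.
Qed.

Lemma gen_sqdist c x y :
  gen c (sqdist x) y = \sum_i c y i * (2 + 4 * (lam * l 0 i) * (y 0 i - x 0 i)%:~R).
Proof.
by rewrite /gen; apply: eq_bigr => i _; rewrite sqdist_add sqdist_sub; ring.
Qed.

Lemma box_coord x y N i : y \in box x N -> `|(y 0 i - x 0 i)%:~R| <= N%:R :> R.
Proof.
rewrite mem_box => /forallP/(_ i) h; rewrite -intr_norm.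
by rewrite -[N%:R]/(N%:Z%:~R) ler_int.
Qed.

Hypotheses (l1 : enorm l = 1) (lam0 : 0 < lam) (lam1 : lam <= 1 / 2).
Variables (kap : R).
Hypothesis kap0 : 0 < kap.

Section at_scale.
Variables (r m : nat) (t : R) (x0 : L) (c : cfield) (h : L -> R).
Hypotheses (d0 : (0 < d)%N) (r0 : (0 < r)%N) (m0 : (0 < m)%N) (t0 : 0 < t).
Hypotheses (lamr : lam * r%:R <= 1) (ac : admissible kap c).
Hypotheses (h0 : forall z, 0 <= h z) (hs : forall z, z \in box x0 r -> gen c h z <= 0).

Let rr : R := r%:R.
Let rr1 : 1 <= rr. Proof. by rewrite /rr ler1n. Qed.
Let rr0 : 0 < rr. Proof. exact: lt_le_trans rr1. Qed.
Let q := t / rr ^+ 2.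
Let q0 : 0 < q. Proof. by rewrite /q divr_gt0// exprn_gt0. Qed.
(** A concave paraboloid, worth [t] at [x0] and nonpositive outside the box, minus [h]. Planes are
    brought down on it from above. *)
Let u z := t - q * sqdist x0 z - h z.

(** At a contact point all second differences of [u] are nonpositive, while the superharmonicity of
    [h] bounds their weighted sum from below; so each of them is small. The tilt is harmless because
    the slopes are at most [t / (8 * d * r)] and [lam * r] is at most 1. *)
Let width (p : 'I_d -> R) y : y \in box x0 r ->
  (forall i, 0 <= p i <= t / (8 * d%:R * rr)) ->
  (forall i, u (y + evec i) - u y <= p i) -> (forall i, p i <= u y - u (y - evec i)) ->
  forall i, kap * (u y - u (y - evec i) - (u (y + evec i) - u y)) <= 8 * q.
Proof.
move=> yb pb bp pa i; have [c1 c2] := ac.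
have dr : 1 <= d%:R :> R by rewrite ler1n.
have gu : - (3 * q) <= gen c u y.
  have -> : gen c u y = gen c (fun z => 1 * (t - q * sqdist x0 z) + (-1) * h z) y.
    by apply: eq_bigr => j _; rewrite /u; ring.
  rewrite gen_lin mul1r mulN1r.
  have -> : gen c (fun z => t - q * sqdist x0 z) y =
     gen c (fun z => t * 1 + (- q) * sqdist x0 z) y.
    by apply: eq_bigr => j _; ring.
  rewrite (gen_lin _ _ _ _ _ (fun=> 1)) gen_cst mulr0 add0r gen_sqdist.
  have := hs yb.
  have : \sum_j c y j * (2 + 4 * (lam * l 0 j) * (y 0 j - x0 0 j)%:~R) <= \sum_j c y j * 6.
    apply: ler_sum => j _; apply: ler_wpM2l; first exact: le_trans (ltW kap0) (c1 _ _).
    have H : `|lam * l 0 j * (y 0 j - x0 0 j)%:~R| <= 1.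
      rewrite !normrM (gtr0_norm lam0); apply: le_trans lamr.
      rewrite -mulrA; apply: ler_wpM2l; first exact: ltW.
      rewrite -[leRHS]mul1r; apply: ler_pM => //; first exact: dir_le1.
      exact: box_coord.
    by move: H; rewrite ler_norml => /andP[_ H]; lra.
  rewrite -mulr_suml; have := c2 y; move: (\sum_j c y j) => s s1 s2 s3.
  have s4 := ler_wpM2l (ltW q0) s2; have s5 := ler_wpM2l (ltW q0) s1.
  by lra.
have term j : c y j * ((1 + lam * l 0 j) * (u (y + evec j) - u y) +
     (1 - lam * l 0 j) * (u (y - evec j) - u y)) <=
   c y j * (q / 4) + - (c y j / 2 * (u y - u (y - evec j) - (u (y + evec j) - u y))).
  have cj : 0 <= c y j by exact: le_trans (ltW kap0) (c1 _ _).
  rewrite [leRHS](_ : _ = c y j * (q / 4 - 1 / 2 *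
      (u y - u (y - evec j) - (u (y + evec j) - u y)))); last by ring.
  apply: ler_wpM2l => //; have := bp j; have := pa j.
  rewrite (_ : u (y - evec j) - u y = - (u y - u (y - evec j))); last by ring.
  move: (u y - u (y - evec j)) (u (y + evec j) - u y) => a b pa1 bp1.
  have /andP[p0 p1] := pb j.
  have := bias_le l1 lam0 lam1 j; rewrite ler_norml => /andP[s1 s2].
  have sp : 2 * (lam * l 0 j) * p j <= q / 4.
    have e1 : lam * l 0 j * p j <= lam * p j.
      rewrite ler_wpM2r// -[leRHS]mulr1 ler_wpM2l ?(ltW lam0)//.
      by have := dir_le1 l1 j; rewrite ler_norml => /andP[].
    have e2 : lam * p j <= rr^-1 * (t / (8 * d%:R * rr)).
      apply: ler_pM => //; first exact: ltW.
      by rewrite -[leRHS]mul1r ler_pdivlMr.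
    have e3 : rr^-1 * (t / (8 * d%:R * rr)) <= q / 8.
      rewrite (_ : rr^-1 * _ = d%:R^-1 * (q / 8)).
        rewrite ger_pMl; last by rewrite divr_gt0.
        by rewrite invf_le1// (lt_le_trans _ dr).
      by rewrite /q; field; rewrite !gt_eqF// ltr0n.
    lra.
  have g1 : 0 <= (1 / 2 - lam * l 0 j) * (a - p j) by rewrite mulr_ge0//; lra.
  have g2 : 0 <= (1 / 2 + lam * l 0 j) * (p j - b) by rewrite mulr_ge0//; lra.
  by lra.
have T2 : - (3 * q) <= (\sum_j c y j) * (q / 4) +
    - \sum_j c y j / 2 * (u y - u (y - evec j) - (u (y + evec j) - u y)).
  apply: (le_trans gu); rewrite mulr_suml -sumrN -big_split/=.
  by apply: ler_sum => j _; exact: term.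
have pos j : 0 <= c y j / 2 * (u y - u (y - evec j) - (u (y + evec j) - u y)).
  rewrite mulr_ge0// ?subr_ge0 ?(le_trans (bp j))//.
  by rewrite divr_ge0// (le_trans (ltW kap0)).
have ki : kap / 2 * (u y - u (y - evec i) - (u (y + evec i) - u y)) <=
   c y i / 2 * (u y - u (y - evec i) - (u (y + evec i) - u y)).
  rewrite ler_wpM2r// ?subr_ge0 ?(le_trans (bp i))//.
  by have := c1 y i; lra.
have si : c y i / 2 * (u y - u (y - evec i) - (u (y + evec i) - u y)) <=
   \sum_j c y j / 2 * (u y - u (y - evec j) - (u (y + evec j) - u y)).
  by rewrite [leRHS](bigD1 i)//= lerDl sumr_ge0.
have : (\sum_j c y j) * (q / 4) <= q / 8.
  have q4 : 0 <= q / 4 by rewrite divr_ge0 ?(ltW q0).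
  by have := ler_wpM2r q4 (c2 y); lra.
move: q0 T2 si ki; set S := \sum_j c y j / 2 * _; lra.
Qed.

Let slope_exists (f : {ffun 'I_d -> 'I_m}) : h x0 <= t / 2 ->
  exists y, [/\ y \in box x0 r, h y < t &
   forall i, u (y + evec i) - u y <= (f i)%:R * (t / (8 * d%:R * rr * m%:R)) <= u y - u (y - evec i)].
Proof.
move=> hx0; set sg := t / _; pose p i := (f i)%:R * sg.
have dr : 1 <= d%:R :> R by rewrite ler1n.
have mr : 1 <= m%:R :> R by rewrite ler1n.
have den0 : 0 < 8 * d%:R * rr by rewrite !mulr_gt0// ?(lt_le_trans _ dr).
have pb i : 0 <= p i <= t / (8 * d%:R * rr).
  rewrite /p /sg; apply/andP; split.
    by rewrite mulr_ge0// divr_ge0 ?mulr_ge0// ltW.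
  rewrite (_ : t / (8 * d%:R * rr * m%:R) = m%:R^-1 * (t / (8 * d%:R * rr))); last first.
    by rewrite [in LHS]invfM; ring.
  rewrite mulrA ger_pMl ?divr_gt0// ler_pdivrMr ?mul1r ?(lt_le_trans _ mr)//.
  by rewrite ler_nat ltnW.
have plane_le N y : (N <= r.+1)%N -> y \in box x0 N -> `|plane p x0 y| <= t / 4 .
  move=> Nr yN; apply: (le_trans (ler_norm_sum _ _ _)).
  apply: (@le_trans _ _ (\sum_(i < d) (t / (8 * d%:R * rr)) * (2 * rr))).
    apply: ler_sum => i _; rewrite normrM; have /andP[p0 p1] := pb i.
    apply: ler_pM => //; first by rewrite ger0_norm.
    apply: (le_trans (box_coord i yN)).
    apply: (@le_trans _ _ (r.+1)%:R); first by rewrite ler_nat.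
    by rewrite -natr1 -/rr; have := rr1; lra.
  rewrite sumr_const card_ord -mulr_natl le_eqVlt; apply/orP; left; apply/eqP.
  by field; rewrite !gt_eqF// ?(lt_le_trans _ dr).
have [y yb ymax] := seq_argmax (fun z => u z - plane p x0 z) (box_refl x0 r).
have y0 : t / 2 <= u y - plane p x0 y.
  apply: le_trans (ymax _ (box_refl x0 r)).
  have -> : plane p x0 x0 = 0 by rewrite /plane big1// => i _; rewrite subrr mulr0.
  have -> : u x0 = t - h x0.
    by rewrite /u /sqdist big1 ?mulr0 ?subr0// => i _; rewrite subrr expr0n.
  by move: hx0; rewrite subr0; lra.
have sq0 z : 0 <= sqdist x0 z by rewrite sumr_ge0// => i _; rewrite sqr_ge0.
(* Just outside the box [u] is nonpositive and the plane is at most [t / 4] in size, whereas the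
   maximum is at least [t / 2]. The maximum over the box thus also dominates the outer neighbours,
   and the first-order conditions hold at [y] even on the boundary. *)
have ynbr z : z \in box x0 r.+1 -> u z - plane p x0 z <= u y - plane p x0 y.
  move=> z1; have [/ymax//|zr] := boolP (z \in box x0 r).
  apply: le_trans y0.
  have := plane_le _ _ (leqnn _) z1; rewrite ler_norml => /andP[z2 _].
  suff : u z <= 0 by move: z2 t0; lra.
  rewrite /u subr_le0; apply: le_trans (h0 z); rewrite subr_le0.
  move: zr; rewrite mem_box negb_forall => /existsP[i]; rewrite -ltNge => zi.
  have : rr ^+ 2 <= sqdist x0 z.
    rewrite /sqdist (bigD1 i)//=.
    apply: (@le_trans _ _ ((z 0 i - x0 0 i)%:~R ^+ 2)); last first.
      by rewrite lerDl sumr_ge0// => j _; rewrite sqr_ge0.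
    rewrite -[leRHS]real_normK ?num_real// -intr_norm.
    rewrite lerXn2r ?nnegrE ?(ltW rr0) ?ler0z//.
    by rewrite /rr -[r%:R]/(r%:Z%:~R) ler_int ltW.
  move=> zz; apply: le_trans (_ : q * rr ^+ 2 <= _); last by rewrite ler_wpM2l// ltW.
  by rewrite /q divfK// gt_eqF// exprn_gt0.
exists y; split=> //.
  have := plane_le _ _ (leqnSn _) yb; rewrite ler_norml => /andP[z2 _].
  have : 0 <= q * sqdist x0 y by rewrite mulr_ge0// ltW.
  by move: y0 z2 t0; rewrite /u; lra.
move=> i; have /andP[n1 n2] := box_nbr i yb.
have := ynbr _ n1; have := ynbr _ n2; rewrite plane_add plane_sub.
rewrite -/(p i); lra.
Qed.

(* A plane of slope [p] touching [u] from above does so at a point where the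
   second differences of [u] are at most a constant times [t / r ^ 2]; hence
   slopes on a grid of larger mesh have distinct contact points. *)
Lemma contact_points : h x0 <= t / 2 -> 64 * d%:R * m%:R < kap * r%:R ->
  exists phi : {ffun 'I_d -> 'I_m} -> L,
    injective phi /\ forall k, phi k \in box x0 r /\ h (phi k) < t.
Proof.
move=> hx0 hm; have [phi H] := choice (fun k => slope_exists k hx0).
exists phi; split; last by move=> k; have [] := H k.
move=> k k' fg; have [yb _ Hf] := H k; have [_ _ Hg] := H k'; rewrite -fg in Hg.
have dr : 1 <= d%:R :> R by rewrite ler1n.
have mr : 1 <= m%:R :> R by rewrite ler1n.
set sg := t / _ in Hf Hg.
have sg0 : 0 < sg by rewrite /sg divr_gt0// !mulr_gt0// ?(lt_le_trans _ dr) ?(lt_le_trans _ mr).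
have den0 : 0 < 8 * d%:R * rr by rewrite !mulr_gt0// ?(lt_le_trans _ dr).
have pb i : 0 <= (k i)%:R * sg <= t / (8 * d%:R * rr).
  rewrite /sg; apply/andP; split.
    by rewrite mulr_ge0// ltW.
  rewrite (_ : t / (8 * d%:R * rr * m%:R) = m%:R^-1 * (t / (8 * d%:R * rr))); last first.
    by rewrite [in LHS]invfM; ring.
  rewrite mulrA ger_pMl ?divr_gt0// ler_pdivrMr ?mul1r ?(lt_le_trans _ mr)//.
  by rewrite ler_nat ltnW.
have W := @width (fun i => (k i)%:R * sg) (phi k) yb pb.
have {}W : forall i, kap * (u (phi k) - u (phi k - evec i) - (u (phi k + evec i) - u (phi k))) <= 8 * q.
  by apply: W => i; have /andP[] := Hf i.
(* [sg] is the mesh of the slopes; the assumption on [m] says exactly that it exceeds the bound on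
   the second differences. *)
have big : 8 * q < kap * sg.
  have -> : 8 * q = (64 * d%:R * m%:R) * (sg / rr).
    by rewrite /sg /q; field; rewrite !gt_eqF// ?(lt_le_trans _ dr) ?(lt_le_trans _ mr).
  have -> : kap * sg = (kap * rr) * (sg / rr).
    by field; rewrite gt_eqF.
  by rewrite ltr_pM2r// divr_gt0.
apply/ffunP => i; apply/eqP; rewrite -[_ == _]negbK; apply/negP => fgi.
have Wi := le_lt_trans (W i) big; rewrite ltr_pM2l// in Wi.
have /andP[f1 f2] := Hf i; have /andP[g1 g2] := Hg i.
have D1 : (k i)%:R * sg - (k' i)%:R * sg < sg by move: Wi f1 f2 g1 g2; lra.
have D2 : (k' i)%:R * sg - (k i)%:R * sg < sg by move: Wi f1 f2 g1 g2; lra.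
move: D1 D2; rewrite -!mulrBl -[ltRHS]mul1r -[X in _ -> _ < X -> _]mul1r !ltr_pM2r// => D1 D2.
move: fgi; rewrite neq_ltn => /orP[] lt.
- have : (k i).+1%:R <= (k' i)%:R :> R by rewrite ler_nat.
  by rewrite -natr1; move: D1 D2; lra.
- have : (k' i).+1%:R <= (k i)%:R :> R by rewrite ler_nat.
  by rewrite -natr1; move: D1 D2; lra.
Qed.
End at_scale.
End contact.

(** * Gaussian barriers *)

Section exponentials.
Variable R : realType.
Implicit Types (s t b : R).

Lemma expR_cosh_lb t : 2 + t ^+ 2 / 4 <= expR t + expR (- t).
Proof.
wlog t0 : t / 0 <= t.
  move=> H; have [/H//|/ltW t0] := leP 0 t.
  by have := H (- t); rewrite oppr_ge0 opprK sqrrN [expR (- t) + _]addrC; apply.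
(* [expR t + expR (- t) - 2] is the square of [a - b]. *)
pose a := expR (t / 2); pose b := expR (- (t / 2)).
have ab : a * b = 1 by rewrite /a /b -expRD subrr expR0.
have -> : expR t = a * a by rewrite /a -expRD; congr expR; field.
have -> : expR (- t) = b * b by rewrite /b -expRD; congr expR; field.
have a1 : 1 + t / 2 <= a by exact: expR_ge1Dx.
have b0 : 0 < b by exact: expR_gt0.
have b1 : b <= 1 by rewrite -ab ler_peMl ?(ltW b0)//; lra.
have h : t / 2 <= a - b by lra.
have : (t / 2) ^+ 2 <= (a - b) ^+ 2 by rewrite lerXn2r ?nnegrE//; lra.
by lra.
Qed.

(** One coordinate of the generator applied to a Gaussian of rate [b] and divided by it: [t] stands
    for [2 * b] times the coordinate, [s] for the tilt [lam * l 0 i]. The cross term in [s * t] is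
    split between the two squares. *)
Lemma expR_biased_lb s t b : `|s| <= 1 / 2 -> 0 <= b <= 1 / 2 ->
  - 2 * b - 16 * s ^+ 2 + t ^+ 2 / 32 <=
  (1 + s) * expR (- t - b) + (1 - s) * expR (t - b) - 2.
Proof.
rewrite ler_norml => /andP[s1 s2] /andP[b0 b1].
rewrite !expRD !mulrA -mulrDl.
have e1 : 1 - b <= expR (- b) by exact: expR_ge1Dx.
have e2 : expR (- b) <= 1 by rewrite -expR0 ler_expR; lra.
have P1 := expR_cosh_lb t.
have p1 : 1 + t <= expR t by exact: expR_ge1Dx.
have p2 : 1 - t <= expR (- t) by exact: expR_ge1Dx.
have S : 2 + t ^+ 2 / 16 - 16 * s ^+ 2 <= (1 + s) * expR (- t) + (1 - s) * expR t.
  move: P1 p1 p2; move: (expR t) (expR (- t)) => a a' P1 p1 p2.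
  have [s0|/ltW s0] := leP 0 s.
    have g1 : 0 <= s * (a' - (1 - t)) by rewrite mulr_ge0//; lra.
    have g2 : 0 <= (1 / 2 - s) * (a + a' - (2 + t ^+ 2 / 4)) by rewrite mulr_ge0//; lra.
    have g3 := sqr_ge0 (t / 4 - 4 * s).
    have g4 : 0 <= (1 / 2 - s) * t ^+ 2 by rewrite mulr_ge0 ?sqr_ge0//; lra.
    by lra.
  have g1 : 0 <= - s * (a - (1 + t)) by rewrite mulr_ge0//; lra.
  have g2 : 0 <= (1 / 2 + s) * (a + a' - (2 + t ^+ 2 / 4)) by rewrite mulr_ge0//; lra.
  have g3 := sqr_ge0 (t / 4 - 4 * s).
  have g4 : 0 <= (1 / 2 + s) * t ^+ 2 by rewrite mulr_ge0 ?sqr_ge0//; lra.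
  by lra.
have e0 : 0 <= expR (- b) by exact: ltW (expR_gt0 _).
have S2 := ler_wpM2r e0 S.
apply: (@le_trans _ _ ((2 + t ^+ 2 / 16 - 16 * s ^+ 2) * expR (- b) - 2)); last by lra.
move: e0 e1 e2; move: (expR (- b)) => e e0 e1 e2.
have t2 := sqr_ge0 t; have ss := sqr_ge0 s.
have g1 : 0 <= (e - 1 / 2) * t ^+ 2 by rewrite mulr_ge0//; lra.
have g2 : 0 <= (1 - e) * s ^+ 2 by rewrite mulr_ge0//; lra.
by lra.
Qed.
End exponentials.

Section barrier.
Variables (R : realType) (d : nat) (l : 'rV[R]_d) (lam : R).
Local Notation L := 'rV[int]_d.
Local Notation cfield := (L -> 'I_d -> R).
Local Notation gen := (gen l lam).
Implicit Types (c : cfield) (f g : L -> R) (x y : L).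
Hypotheses (l1 : enorm l = 1) (lam0 : 0 < lam) (lam1 : lam <= 1 / 2).
Variables (kap : R).
Hypotheses (kap0 : 0 < kap) (kap1 : kap <= 1).

(** With [b = barrier_rate kap rho / r ^+ 2], the positive term in [gen_gauss] exceeds [73 * b / 8]
    beyond radius [rho * r], while the negative ones are at most [9 * b], since [lam ^+ 2] is at
    most [r ^- 2] and so at most [b]. *)
Definition barrier_rate (kap rho : R) : R := 73 / (kap * rho ^+ 2).
(** Height of the barrier at distance [r / 2], once shifted so as to vanish at distance [r]. *)
Definition barrier_cst (kap rho : R) : R :=
  expR (- (barrier_rate kap rho / 4)) - expR (- barrier_rate kap rho).

Lemma barrier_rate_ge rho : 0 < rho <= 1 -> 73 <= barrier_rate kap rho.
Proof.
move=> /andP[r0 r1]; have k0 : 0 < kap * rho ^+ 2 by rewrite mulr_gt0// exprn_gt0.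
rewrite /barrier_rate ler_pdivlMr// ger_pMr//.
by rewrite -[leRHS]mulr1 ler_pM ?(ltW kap0) ?exprn_ge0 ?(ltW r0)// expr_le1 ?(ltW r0).
Qed.

Lemma barrier_cst_gt0 rho : 0 < rho <= 1 -> 0 < barrier_cst kap rho.
Proof.
by move=> /barrier_rate_ge h; rewrite /barrier_cst subr_gt0 ltr_expR; lra.
Qed.

Lemma gen_gauss c (b : R) z0 y : admissible kap c -> 0 <= b <= 1 / 2 ->
  (kap * b ^+ 2 * sqdist R z0 y / 8 - b - 8 * lam ^+ 2) * expR (- (b * sqdist R z0 y)) <=
  gen c (fun z => expR (- (b * sqdist R z0 z))) y.
Proof.
move=> [c1 c2] b01; set E := expR _; have E0 : 0 < E by exact: expR_gt0.
have -> : gen c (fun z => expR (- (b * sqdist R z0 z))) y = (\sum_i c y i *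
  ((1 + lam * l 0 i) * expR (- (2 * b * (y 0 i - z0 0 i)%:~R) - b)
   + (1 - lam * l 0 i) * expR (2 * b * (y 0 i - z0 0 i)%:~R - b) - 2)) * E.
  rewrite /gen mulr_suml; apply: eq_bigr => i _.
  rewrite sqdist_add sqdist_sub -/E.
  have -> : expR (- (b * (sqdist R z0 y + 2 * (y 0 i - z0 0 i)%:~R + 1))) =
    expR (- (2 * b * (y 0 i - z0 0 i)%:~R) - b) * E.
    by rewrite /E -expRD; congr expR; ring.
  have -> : expR (- (b * (sqdist R z0 y - 2 * (y 0 i - z0 0 i)%:~R + 1))) =
    expR (2 * b * (y 0 i - z0 0 i)%:~R - b) * E.
    by rewrite /E -expRD; congr expR; ring.
  by ring.
apply: ler_wpM2r; first exact: ltW.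
have step1 : \sum_i (c y i * (- (2 * b + 16 * lam ^+ 2)) +
     kap * (b ^+ 2 * (y 0 i - z0 0 i)%:~R ^+ 2 / 8)) <= \sum_i c y i *
  ((1 + lam * l 0 i) * expR (- (2 * b * (y 0 i - z0 0 i)%:~R) - b)
   + (1 - lam * l 0 i) * expR (2 * b * (y 0 i - z0 0 i)%:~R - b) - 2).
  apply: ler_sum => i _; set X := (y 0 i - z0 0 i)%:~R.
  have ci : 0 <= c y i by exact: le_trans (ltW kap0) (c1 _ _).
  have := ler_wpM2l ci (expR_biased_lb (2 * b * X) (bias_le l1 lam0 lam1 i) b01).
  apply: le_trans.
  have X0 : 0 <= b ^+ 2 * X ^+ 2 / 8 by rewrite divr_ge0// mulr_ge0// sqr_ge0.
  have h1 := ler_wpM2r X0 (c1 y i).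
  have h2 : c y i * (16 * (lam * l 0 i) ^+ 2) <= c y i * (16 * lam ^+ 2).
    apply: ler_wpM2l => //; rewrite ler_pM2l// exprMn ler_piMr ?sqr_ge0//.
    by rewrite -real_normK ?num_real// expr_le1// dir_le1.
  by lra.
apply: le_trans step1; rewrite big_split/= -mulr_suml -mulr_sumr -mulr_suml -mulr_sumr.
rewrite -/(sqdist R z0 y).
have h0 : 0 <= 2 * b + 16 * lam ^+ 2.
  by have /andP[? _] := b01; have := sqr_ge0 lam; lra.
by have := ler_wpM2r h0 (c2 y); lra.
Qed.

(** Comparison of [h] with [t] times a Gaussian shifted by a constant, which is at most 1 in the
    inner ball, nonpositive beyond radius [r], and has a positive generator in between. *)
Lemma barrier rho r (c : cfield) (h : L -> R) (t : R) z0 :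
  0 < rho <= 1 -> 2 * barrier_rate kap rho <= r -> lam * r <= 1 ->
  admissible kap c -> 0 <= t -> (forall z, 0 <= h z) ->
  (forall z, sqdist R z0 z < r ^+ 2 -> gen c h z <= 0) ->
  (forall z, sqdist R z0 z <= (rho * r) ^+ 2 -> t <= h z) ->
  forall z, sqdist R z0 z <= r ^+ 2 / 4 -> barrier_cst kap rho * t <= h z.
Proof.
move=> rho01 ra lr ac t0 h0 hs ht z zr.
have a73 := barrier_rate_ge rho01; set a := barrier_rate kap rho in ra a73.
have r1 : 1 <= r by lra.
have r0 : 0 < r by lra.
have r2 : 0 < r ^+ 2 by rewrite exprn_gt0.
have rr2 : r <= r ^+ 2 by rewrite expr2 ler_peMl// ltW.
pose b := a / r ^+ 2.
have b01 : 0 <= b <= 1 / 2.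
  apply/andP; split; first by rewrite /b divr_ge0//; lra.
  by rewrite /b ler_pdivrMr//; lra.
pose f z := expR (- (b * sqdist R z0 z)) - expR (- a).
have br2 : b * r ^+ 2 = a by rewrite /b divfK// gt_eqF.
have b0 : 0 < b by rewrite /b divr_gt0//; lra.
suff H : t * f z <= h z.
  apply: le_trans H; rewrite mulrC ler_wpM2l// /f /barrier_cst -/a lerB//.
  rewrite ler_expR lerN2 -br2 -mulrA ler_pM2l//.
rewrite leNgt; apply/negP => hf.
have tp : 0 < t.
  rewrite lt_neqAle t0 andbT; apply/eqP => t00; move: hf.
  by rewrite -t00 mul0r ltNge h0.
have [M rM] : exists M : nat, r <= M%:R.
  by exists (Num.bound r); apply/ltW/archi_boundP/ltW.
have inb y : sqdist R z0 y < r ^+ 2 -> y \in box z0 M.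
  move=> yr; rewrite mem_box; apply/forallP => i.
  rewrite -(ler_int R) intr_norm; apply: le_trans (rM).
  rewrite -(@ler_pXn2r _ 2) ?nnegrE ?(ltW r0)// real_normK ?num_real//.
  apply: le_trans (ltW yr); rewrite /sqdist (bigD1 i)//= lerDl.
  by rewrite sumr_ge0// => j _; rewrite sqr_ge0.
have fneg y : r ^+ 2 <= sqdist R z0 y -> f y <= 0.
  by move=> yr; rewrite /f subr_le0 ler_expR lerN2 -br2 ler_pM2l.
have zb : z \in box z0 M.+1.
  by apply: (@box_le _ _ _ M) => //; apply: inb; lra.
(* A positive maximum has to lie in the annulus, where the generator of [t * f - h] is positive,
   which is impossible at a maximum. The box is one unit larger than the ball so as to contain the
   neighbours of [y]. *)
have [y yb ymax] := seq_argmax (fun y => t * f y - h y) zb.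
have ypos : 0 < t * f y - h y by apply: lt_le_trans (ymax _ zb); rewrite subr_gt0.
have fy : 0 < f y.
  by rewrite -(pmulr_rgt0 _ tp); have := h0 y; lra.
have yr : sqdist R z0 y < r ^+ 2.
  by rewrite ltNge; apply/negP => /fneg; lra.
have yrho : (rho * r) ^+ 2 < sqdist R z0 y.
  rewrite ltNge; apply/negP => /ht ty.
  have : t * f y <= t.
    rewrite ger_pMr// /f; apply: (@le_trans _ _ (1 - 0)); last by rewrite subr0.
    rewrite lerB ?(ltW (expR_gt0 _))// -expR0 ler_expR oppr_le0 mulr_ge0 ?(ltW b0)//.
    by rewrite sumr_ge0// => i _; rewrite sqr_ge0.
  by lra.
have gf : 0 < gen c f y.
  have -> : gen c f y = gen c (fun z => expR (- (b * sqdist R z0 z))) y.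
    by rewrite /f genB gen_cst subr0.
  apply: lt_le_trans (gen_gauss z0 y ac b01).
  rewrite pmulr_lgt0 ?expR_gt0//.
  have l2 : lam ^+ 2 <= (r ^+ 2)^-1.
    rewrite -div1r ler_pdivlMr// -exprMn expr_le1//.
    by rewrite mulr_ge0 ?(ltW lam0) ?(ltW r0).
  have k : kap * b ^+ 2 * (rho * r) ^+ 2 = 73 * b.
    rewrite /b /a /barrier_rate; field.
    have /andP[rho0 _] := rho01.
    by rewrite !gt_eqF.
  have k2 : kap * b ^+ 2 * (rho * r) ^+ 2 < kap * b ^+ 2 * sqdist R z0 y.
    by rewrite ltr_pM2l// mulr_gt0// exprn_gt0.
  have k3 : 73 * (r ^+ 2)^-1 <= b by rewrite /b ler_pM2r// invr_gt0.
  have k4 : 0 < (r ^+ 2)^-1 by rewrite invr_gt0.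
  by lra.
have gh := hs _ yr.
have : 0 < gen c (fun z => t * f z + (-1) * h z) y.
  by rewrite gen_lin; have := mulr_gt0 tp gf; lra.
apply/negP; rewrite -leNgt; apply: sumr_le0 => i _.
have [c1 _] := ac.
rewrite mulr_ge0_le0//; first exact: le_trans (ltW kap0) (c1 _ _).
have /andP[n1 n2] := box_nbr i (inb _ yr).
have := ymax _ n1; have := ymax _ n2.
have := bias_le l1 lam0 lam1 i; rewrite ler_norml => /andP[s1 s2] m2 m1.
have g1 : 0 <= (1 + lam * l 0 i) * (t * f y - h y - (t * f (y + evec i) - h (y + evec i))).
  by rewrite mulr_ge0//; lra.
have g2 : 0 <= (1 - lam * l 0 i) * (t * f y - h y - (t * f (y - evec i) - h (y - evec i))).
  by rewrite mulr_ge0//; lra.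
by lra.
Qed.
End barrier.

(** * Dyadic cubes and growth of density *)

Section cubes.
Variable d : nat.
Local Notation L := 'rV[int]_d.
Implicit Types (z x : L) (P Q : pred L) (k : nat).

Definition cube z k x := [forall i, z 0 i <= x 0 i < z 0 i + (2 ^ k)%:Z].

Definition child z k (e : {ffun 'I_d -> bool}) : L :=
  z + \row_i (if e i then (2 ^ k)%:Z else 0).

(** The number of points of [P] in the dyadic cube, computed along the tree of its subcubes so that
    the stopping argument is an induction on [k]. *)
Fixpoint cnt P z k : nat :=
  if k is j.+1 then \sum_(e : {ffun 'I_d -> bool}) cnt P (child z j e) j else P z.

Definition vol k : nat := (2 ^ d) ^ k.

Lemma childE z k e i : child z k e 0 i = z 0 i + (if e i then (2 ^ k)%:Z else 0).
Proof. by rewrite !mxE. Qed.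

Lemma cube_child z k e x : cube (child z k e) k x -> cube z k.+1 x.
Proof.
move=> /forallP H; apply/forallP => i; have := H i; rewrite childE expnS.
by move: (z 0 i) (x 0 i) (2 ^ k)%N => a b s; case: (e i) => /andP[h1 h2]; lia.
Qed.

Lemma cube_in_child z k x : cube z k.+1 x -> exists e, cube (child z k e) k x.
Proof.
move=> /forallP H; exists [ffun i => z 0 i + (2 ^ k)%:Z <= x 0 i].
apply/forallP => i; have := H i; rewrite childE ffunE expnS.
by move: (z 0 i) (x 0 i) (2 ^ k)%N => a b s; case: ifP => h /andP[h1 h2]; lia.
Qed.

Lemma cube_self z k : cube z k z.
Proof.
apply/forallP => i; move: (z 0 i) (expn_gt0 2 k) => a; move: (2 ^ k)%N => s; lia.
Qed.

Lemma cube0 z x : cube z 0 x -> x = z.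
Proof.
by move=> /forallP H; apply/rowP => i; have := H i; rewrite expn0;
  move: (z 0 i) (x 0 i) => a b /andP[h1 h2]; lia.
Qed.

Lemma cnt_predC P z k : (cnt P z k + cnt (predC P) z k = vol k)%N.
Proof.
elim: k z => [|k IH] z /=; first by rewrite /vol expn0; case: (P z).
rewrite -big_split/= (eq_bigr (fun=> vol k)) => [|e _]; last exact: IH.
by rewrite sum_nat_const card_ffun card_bool card_ord /vol expnS.
Qed.

Lemma cnt_le_vol P z k : (cnt P z k <= vol k)%N.
Proof. by rewrite -(cnt_predC P z k) leq_addr. Qed.

Lemma cnt_full P z k : (forall x, cube z k x -> P x) -> cnt P z k = vol k.
Proof.
elim: k z => [|k IH] z H /=; first by rewrite /vol expn0 H// cube_self.
rewrite (eq_bigr (fun=> vol k)) => [|e _]; last first.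
  by apply: IH => x /cube_child; exact: H.
by rewrite sum_nat_const card_ffun card_bool card_ord /vol expnS.
Qed.

Lemma cnt_gt0 P z k : (0 < cnt P z k)%N -> exists2 x, cube z k x & P x.
Proof.
elim: k z => [|k IH] z /=; first by case Pz: (P z) => // _; exists z => //; exact: cube_self.
rewrite lt0n sum_nat_eq0 negb_forall => /existsP[e] /=; rewrite -lt0n => /IH[x xc Px].
by exists x => //; exact: cube_child xc.
Qed.

Lemma size_le_cnt P z k (s : seq L) : uniq s ->
  (forall x, x \in s -> cube z k x && P x) -> (size s <= cnt P z k)%N.
Proof.
elim: k z s => [|k IH] z s us H.
  case: s us H => // x s us H; have /andP[/cube0 xz Px] := H x (mem_head _ _).
  rewrite /= -xz Px; case: s us H => // y s us H.
  have /andP[/cube0 yz _] : cube z 0 y && P y by apply: H; rewrite !inE eqxx orbT.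
  by move: us; rewrite /= yz xz inE eqxx.
apply: (@leq_trans (\sum_(e : {ffun 'I_d -> bool}) count (cube (child z k e) k) s)).
  rewrite -sum1_size.
  under [leqRHS]eq_bigr do rewrite -sum1_count big_mkcond/=.
  rewrite exchange_big/= big_seq [leqRHS]big_seq; apply: leq_sum => x xs.
  have /andP[/cube_in_child[e ce] _] := H x xs.
  by rewrite (bigD1 e)//= ce.
apply: leq_sum => e _; rewrite -size_filter; apply: IH; first exact: filter_uniq.
by move=> x; rewrite mem_filter => /andP[-> /H/andP[_ ->]].
Qed.

Section growth.
Variables (R : realType) (del : R) (P Q : pred L) (ok : L -> nat -> Prop).
Hypotheses (del0 : 0 < del) (del1 : del < 1).
Hypothesis ok_child : forall z k e, ok z k.+1 -> ok (child z k e) k.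
Hypothesis dense : forall z k e, ok z k.+1 ->
  (1 - del) * (vol k)%:R < (cnt P (child z k e) k)%:R -> forall x, cube z k.+1 x -> Q x.

(* Calderon-Zygmund stopping: descend until some child is dense. *)
Lemma cnt_growth z k : ok z k -> (cnt P z k)%:R <= (1 - del) * (vol k)%:R ->
  (cnt P z k)%:R <= (1 - del) * (cnt Q z k)%:R.
Proof.
elim: k z => [|k IH] z okz nd.
  move: nd; rewrite /= /vol expn0; case: (P z) => /=.
    by have := del0; lra.
  by move=> _; rewrite mulr_ge0 ?ler0n// subr_ge0 ltW.
have [[e de]|nde] := pselect (exists e,
    (1 - del) * (vol k)%:R < (cnt P (child z k e) k)%:R).
  by rewrite (cnt_full (dense okz de)).
rewrite /= !natr_sum mulr_sumr; apply: ler_sum => e _.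
apply: IH; first exact: ok_child.
by rewrite leNgt; apply/negP => de; apply: nde; exists e.
Qed.
End growth.

End cubes.

Section hitting.
Variables (R : realType) (d : nat).
Local Notation L := 'rV[int]_d.
Local Notation cfield := (L -> 'I_d -> R).

Definition l1dist (x y : L) : nat := (\sum_i `|(y 0 i - x 0 i)%R|)%N.

(** An elementary Harnack chain, moving one coordinate towards [y] at each step. The loss is
    exponential in the distance, so it serves only at bounded scales. *)
Lemma chain_ge (l : 'rV[R]_d) (lam kap : R) (c : cfield) (h : L -> R) z M n x y :
  enorm l = 1 -> 0 < lam -> lam <= 1 / 2 -> 0 < kap -> admissible kap c ->
  (forall w, 0 <= h w) -> (forall w, w \in box z M -> gen l lam c h w <= 0) ->
  x \in box z M -> y \in box z M -> l1dist x y = n -> (kap / 2) ^+ n * h y <= h x.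
Proof.
move=> l1 lam0 lam1 kap0 ac h0 hs xb yb; elim: n x xb => [|n IH] x xb xy.
  suff -> : x = y by rewrite expr0 mul1r.
  apply/rowP => i; move/eqP: xy; rewrite sum_nat_eq0 => /forallP/(_ i)/=.
  by rewrite absz_eq0 subr_eq0 => /eqP.
have [i xi] : exists i, x 0 i != y 0 i.
  apply/existsP; apply: contraPT xy; rewrite negb_exists => /forallP H.
  rewrite /l1dist big1 => // i _; have := H i; rewrite negbK => /eqP->.
  by rewrite subrr.
have nbr x' : x' \in box z M -> l1dist x' y = n ->
    kap / 2 * h x' <= h x + gen l lam c h x -> (kap / 2) ^+ n.+1 * h y <= h x.
  move=> x'b x'y hx; have := IH _ x'b x'y; have k2 : 0 <= kap / 2 by lra.
  move=> /(ler_wpM2l k2); rewrite exprS -mulrA => /le_trans; apply.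
  by apply: (le_trans hx); have := hs _ xb; lra.
have [n1 n2] := step_nbr_ge l1 lam0 lam1 kap0 x i ac h0.
move: xb yb; rewrite !mem_box => /forallP xb /forallP yb.
have sumE (F G : 'I_d -> nat) : (forall j, j != i -> F j = G j) -> (F i = (G i).+1) ->
    (\sum_j F j = (\sum_j G j).+1)%N.
  move=> FG Fi; rewrite (bigD1 i)//= Fi [in RHS](bigD1 i)//= addSn; congr (_ + _).+1.
  by apply: eq_bigr => j /FG.
have [lt|gt|//] := ltgtP (x 0 i) (y 0 i); last by move/eqP: xi.
- apply: (nbr (x + evec i)); last exact: n1.
    rewrite mem_box; apply/forallP => j; rewrite coord_add.
    have := xb j; have := yb j; have := lt; rewrite !ler_norml.
    have [<-|_] := eqVneq i j; last by rewrite addr0.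
    by move: (x 0 i) (y 0 i) (z 0 i) => a b e h1 /andP[h2 h3] /andP[h4 h5]; lia.
  apply/eqP; rewrite -eqSS -xy; apply/eqP; symmetry; apply: sumE => [j ji|].
    by rewrite coord_add eq_sym (negPf ji) addr0.
  by rewrite coord_add eqxx; move: lt; move: (x 0 i) (y 0 i) => a b; lia.
- apply: (nbr (x - evec i)); last exact: n2.
    rewrite mem_box; apply/forallP => j; rewrite coord_sub.
    have := xb j; have := yb j; have := gt; rewrite !ler_norml.
    have [<-|_] := eqVneq i j; last by rewrite subr0.
    by move: (x 0 i) (y 0 i) (z 0 i) => a b e h1 /andP[h2 h3] /andP[h4 h5]; lia.
  apply/eqP; rewrite -eqSS -xy; apply/eqP; symmetry; apply: sumE => [j ji|].
    by rewrite coord_sub eq_sym (negPf ji) subr0.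
  by rewrite coord_sub eqxx; move: gt; move: (x 0 i) (y 0 i) => a b; lia.
Qed.
End hitting.

Section integer_bounds.
Implicit Types (a b q : int) (s n K N d : nat).

Lemma dist_center_region b a q N K d : (0 < d)%N -> (K <= N)%N ->
  `|b - a| <= (8 * d * K)%:Z -> q <= a < q + (2 * N)%:Z -> `|b - q| <= (16 * d * N)%:Z.
Proof.
move=> d0 KN; rewrite !ler_norml => /andP[g1 g2] /andP[g3 g4].
have e1 : (8 * d * K <= 8 * d * N)%N by rewrite leq_mul2l KN orbT.
have e2 : (N <= d * N)%N by rewrite leq_pmull.
lia.
Qed.

Lemma dist_add3 a b q s : `|a - b| <= (2 * s)%:Z -> `|b - q| <= s%:Z -> `|a - q| <= (3 * s)%:Z.
Proof. by rewrite !ler_norml => /andP[g1 g2] /andP[g3 g4]; lia. Qed.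

Lemma dist_center_in a b s : (0 < s)%N -> `|b - (a + (4 * s)%:Z)| <= (3 * s)%:Z ->
  a <= b < a + (8 * s)%:Z.
Proof. by rewrite !ler_norml => s0 /andP[g1 g2]; lia. Qed.

Lemma dist_center_parent a b s (e : bool) : a <= b < a + (2 * (8 * s))%:Z ->
  `|b - (a + (if e then (8 * s)%:Z else 0) + (4 * s)%:Z)| <= (16 * s)%:Z.
Proof. by rewrite ler_norml; case: e => /andP[g1 g2]; lia. Qed.

Lemma dist_cube_region a b N d : (0 < d)%N -> a <= b < a + (2 * N)%:Z ->
  `|b - a| <= (16 * d * N)%:Z.
Proof.
move=> d0 /andP[g1 g2]; rewrite ler_norml.
have e2 : (N <= d * N)%N by rewrite leq_pmull.
lia.
Qed.

Lemma dist_in_cube a b q N : q <= a < q + N%:Z -> q <= b < q + N%:Z ->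
  (`|(b - a)%R| <= N)%N.
Proof. by move=> /andP[g1 g2] /andP[g3 g4]; lia. Qed.

Lemma mul3_le s d : (0 < d)%N -> (3 * s <= 8 * d * (8 * s))%N.
Proof. by move=> d0; have : (s <= d * s)%N by [rewrite leq_pmull]; lia. Qed.

Lemma center_in a s : (0 < s)%N -> a <= a + (4 * s)%:Z < a + (8 * s)%:Z.
Proof. lia. Qed.
End integer_bounds.

(** * From positive density to pointwise lower bounds *)

Section krylov_safonov.
Variables (R : realType) (d : nat) (kap : R).
Local Notation L := 'rV[int]_d.
Local Notation cfield := (L -> 'I_d -> R).
Hypotheses (d0 : (0 < d)%N) (kap0 : 0 < kap) (kap1 : kap <= 1).

(** Fraction of a cube of side [s] filled by contact points. Boxes of radius [s / 4] allow about
    [kap * s / (512 * d)] slopes in each direction, and truncation to an integer costs at most a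
    factor 2. *)
Definition ks_density : R := (kap / (32 * 32 * d%:R)) ^+ d.
(** Ratio of the radius [s / 8] of the ball where the contact argument applies to the radius
    [8 * d * s] of the barrier. *)
Definition ks_ratio : R := (64 * d%:R)^-1.
(** Side from which the large-scale argument works: the summands provide two slopes per direction,
    room for the barrier, and a side divisible by 8. *)
Definition ks_scale : R := 32 * 32 * d%:R / kap + 2 * barrier_rate kap ks_ratio + 8.
Definition ks_path : nat := Num.bound (2 * d%:R * ks_scale).
(** The minimum covers both scales: barrier above [ks_scale], Harnack chain of [ks_path] steps
    below. *)
Definition ks_loss : R := Num.min (barrier_cst kap ks_ratio / 2) ((kap / 2) ^+ ks_path).

Let dr : 1 <= d%:R :> R. Proof. by rewrite ler1n. Qed.

Let ratio01 : 0 < ks_ratio <= 1.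
Proof.
have := dr; rewrite /ks_ratio => h; rewrite invr_gt0; apply/andP; split; first lra.
by rewrite invf_le1; lra.
Qed.

Lemma ks_density_bounds : 0 < ks_density < 1.
Proof.
have h := dr; rewrite /ks_density; set q := kap / _.
have q0 : 0 < q by apply: divr_gt0 => //; lra.
have q1 : q < 1 by rewrite /q ltr_pdivrMr; have := kap1; lra.
by rewrite exprn_gt0//= exprn_ilt1 ?(ltW q0)// -lt0n.
Qed.

Lemma ks_loss_bounds : 0 < ks_loss <= 1.
Proof.
have k2 : 0 < kap / 2 by rewrite divr_gt0.
rewrite /ks_loss lt_min ge_min divr_gt0 ?barrier_cst_gt0//= exprn_gt0//=.
apply/orP; right; rewrite exprn_ile1 ?(ltW k2)//.
by have := kap1; lra.
Qed.

Variables (l : 'rV[R]_d) (lam : R).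
Hypotheses (l1 : enorm l = 1) (lam0 : 0 < lam) (lam1 : lam <= 1 / 2).
Local Notation gen := (gen l lam).

Section superharmonic.
Variables (c : cfield) (h : L -> R) (z0 : L) (n : nat).
Hypotheses (ac : admissible kap c) (h0 : forall z, 0 <= h z).
Hypothesis lamn : lam * (8 * d%:R * (2 ^ n)%:R) <= 1.
Hypothesis hs : forall z, z \in box z0 (16 * d * 2 ^ n)%N -> gen c h z <= 0.

Let level t : pred L := fun x => t <= h x.

(** If [h] were below [t / 2] at a point near the centre of the child, the contact points, where
    [h < t], would occupy a fraction [ks_density] of it, against the density assumed. So [h] is at
    least [t / 2] on a ball around the centre, and the barrier extends a lower bound to the
    parent. *)
Let big_dense z k e t : (k <= n)%N -> (forall x, cube z k.+1 x -> cube z0 n.+1 x) ->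
  0 < t -> ks_scale <= (2 ^ k)%:R ->
  (1 - ks_density) * (vol d k)%:R < (cnt (level t) (child z k e) k)%:R ->
  forall x, cube z k.+1 x -> ks_loss * t <= h x.
Proof.
move=> kn sub t0 sb dense x xc.
have h_dr := dr; have hk := kap0; have hk1 := kap1.
have dN0 : d%:R != 0 :> R by rewrite gt_eqF//; lra.
have dR0 : 0 <= d%:R - 1 :> R by lra.
set s : R := (2 ^ k)%:R in sb.
have a73 := barrier_rate_ge kap0 kap1 ratio01.
have dk0 : 0 < 32 * 32 * d%:R / kap by rewrite divr_gt0//; lra.
have s8 : 8 <= s by move: sb; rewrite /ks_scale; lra.
have k3 : (3 <= k)%N.
  rewrite leqNgt; apply/negP => kk.
  have : (2 ^ k <= 4)%N by rewrite (@leq_exp2l 2 _ 2).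
  by rewrite -(ler_nat R) -/s; lra.
have [s' ss'] : exists s' : nat, (2 ^ k = 8 * s')%N.
  by exists (2 ^ (k - 3))%N; rewrite -(@expnD 2 3) subnKC.
have sE : s = 8 * s'%:R by rewrite /s ss' natrM.
have s'1 : 1 <= s'%:R :> R by move: s8; rewrite sE; lra.
pose r := (2 * s')%N.
pose m := Num.truncn (kap * s / (32 * 16 * d%:R)).
have ks0 : 2 <= kap * s / (32 * 16 * d%:R).
  rewrite ler_pdivlMr; last by lra.
  have : 32 * 32 * d%:R / kap <= s by move: sb; rewrite /ks_scale; lra.
  by rewrite ler_pdivrMr//; lra.
have mle : m%:R <= kap * s / (32 * 16 * d%:R) by rewrite /m truncn_le//; lra.
have mgt : kap * s / (32 * 16 * d%:R) < m%:R + 1.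
  by rewrite natr1; exact: truncnS_gt.
have m0 : (0 < m)%N by rewrite -(ltr_nat R); lra.
have s'0 : (0 < s')%N by rewrite -(ltr_nat R); lra.
have rE : r%:R = s / 4 by rewrite /r natrM sE; lra.
have r0 : (0 < r)%N by rewrite -(ltr_nat R) rE; lra.
have lamr : lam * r%:R <= 1.
  apply: le_trans lamn; apply: ler_wpM2l; first exact: ltW.
  rewrite rE; have : s <= (2 ^ n)%:R by rewrite /s ler_nat leq_exp2l.
  move: (2 ^ n)%:R => w sw.
  have : 0 <= (d%:R - 1) * w by rewrite mulr_ge0// (le_trans _ sw)// ler0n.
  lra.
have hm : 64 * d%:R * m%:R < kap * r%:R.
  rewrite rE; have d64 : 0 <= 64 * d%:R :> R by lra.
  have := ler_wpM2l d64 mle.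
  have -> : 64 * d%:R * (kap * s / (32 * 16 * d%:R)) = kap * s / 8.
    by field.
  have : 0 < kap * s by rewrite mulr_gt0//; lra.
  by lra.
pose ctr : L := child z k e + const_mx (4 * s')%:Z.
have inregion (w : L) : (forall i, `|w 0 i - ctr 0 i| <= (8 * d * 2 ^ k)%:Z) ->
    w \in box z0 (16 * d * 2 ^ n)%N.
  move=> H; rewrite mem_box; apply/forallP => i; have := H i.
  have /forallP/(_ i) : cube z0 n.+1 ctr.
    apply: sub; apply: (@cube_child _ _ _ e); apply/forallP => j.
    by rewrite [ctr 0 j]mxE [const_mx _ _ _]mxE ss'; exact: center_in.
  rewrite expnS => h1 h2; apply: dist_center_region h2 h1 => //.
  by rewrite leq_exp2l.
have center (y : L) : (forall i, `|y 0 i - ctr 0 i| <= s'%:Z) -> t / 2 <= h y.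
  move=> yc; rewrite leNgt; apply/negP => hy.
  have sub2 (w : L) : w \in box y r -> forall i, `|w 0 i - ctr 0 i| <= (3 * s')%:Z.
    rewrite mem_box => /forallP H i; have := H i; have := yc i.
    by move=> h1 h2; exact: dist_add3 h2 h1.
  have hsb (w : L) : w \in box y r -> gen c h w <= 0.
    move=> /sub2 H; apply: hs; apply: inregion => i; apply: le_trans (H i) _.
    by rewrite lez_nat ss'; exact: mul3_le.
  have [phi [phi_inj phiP]] := contact_points l1 lam0 lam1 kap0 d0 r0 m0 t0 lamr ac h0
    hsb (ltW hy) hm.
  have := @size_le_cnt _ (predC (level t)) (child z k e) k
    [seq phi f | f : {ffun 'I_d -> 'I_m}].
  rewrite map_inj_uniq ?enum_uniq// size_map -cardE card_ffun !card_ord => H.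
  have {}H : (m ^ d <= cnt (predC (level t)) (child z k e) k)%N.
    apply: H => // w /mapP[f _ ->]; have [fb hf] := phiP f.
    rewrite /= -ltNge hf andbT; apply/forallP => i; have := sub2 _ fb i.
    by rewrite [ctr 0 i]mxE [const_mx _ _ _]mxE ss'; exact: dist_center_in.
  have := cnt_predC (level t) (child z k e) k.
  move/(congr1 (fun w : nat => w%:R : R)); rewrite natrD => E.
  move: H; rewrite -(ler_nat R) natrX => H.
  have : ks_density * (vol d k)%:R <= m%:R ^+ d.
    rewrite /vol -expnM mulnC expnM natrX -/s /ks_density -exprMn.
    rewrite lerXn2r ?nnegrE ?ler0n//.
      by rewrite mulr_ge0 ?divr_ge0//; lra.
    have -> : kap / (32 * 32 * d%:R) * s = (kap * s / (32 * 16 * d%:R)) / 2.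
      by field.
    by lra.
  by lra.
have bar := @barrier _ _ l lam l1 lam0 lam1 kap kap0 kap1 ks_ratio (8 * d%:R * s) c h (t / 2) ctr
  ratio01.
have {}bar := bar _ _ ac _ h0.
have kl : ks_loss * t <= barrier_cst kap ks_ratio * (t / 2).
  have : ks_loss <= barrier_cst kap ks_ratio / 2 by rewrite /ks_loss ge_min lexx.
  by move=> /(ler_wpM2r (ltW t0)); lra.
apply: le_trans kl _; apply: bar => //.
- have : 2 * barrier_rate kap ks_ratio <= s by move: sb; rewrite /ks_scale; lra.
  have : 0 <= (d%:R - 1) * s by rewrite mulr_ge0// ler0n.
  by lra.
- apply: le_trans lamn; apply: ler_wpM2l; first exact: ltW.
  apply: ler_wpM2l; first lra.
  by rewrite /s ler_nat leq_exp2l.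
- by lra.
- move=> w wr; apply: hs; apply: inregion => i.
  rewrite -(ler_int R) intr_norm.
  have e8 : (8 * d * 2 ^ k)%N%:~R = 8 * d%:R * s :> R.
    by rewrite -[_%:~R]/((8 * d * 2 ^ k)%N%:R) !natrM.
  rewrite e8 -(@ler_pXn2r _ 2) ?nnegrE//; last by rewrite mulr_ge0//; lra.
  rewrite real_normK ?num_real//; apply: le_trans (ltW wr).
  by rewrite /sqdist (bigD1 i)//= lerDl sumr_ge0// => j _; rewrite sqr_ge0.
- move=> w wr; apply: center => i.
  rewrite -(ler_int R) intr_norm -[s'%:~R]/(s'%:R).
  rewrite -(@ler_pXn2r _ 2) ?nnegrE//.
  rewrite real_normK ?num_real//; apply: (le_trans _ (le_trans wr _)).
    by rewrite /sqdist (bigD1 i)//= lerDl sumr_ge0// => j _; rewrite sqr_ge0.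
  rewrite sE /ks_ratio le_eqVlt; apply/orP; left; apply/eqP.
  by field.
- rewrite /sqdist; apply: (@le_trans _ _ (\sum_(i < d) (2 * s) ^+ 2)).
    apply: ler_sum => i _; rewrite -real_normK ?num_real// lerXn2r ?nnegrE//; first lra.
    rewrite -intr_norm.
    have -> : 2 * s = (16 * s')%N%:~R.
      by rewrite -[_%:~R]/((16 * s')%N%:R) natrM sE; ring.
    rewrite ler_int; have /forallP/(_ i) := xc.
    rewrite /ctr mxE childE [const_mx _ _ _]mxE expnS ss'.
    exact: dist_center_parent.
  rewrite sumr_const card_ord -mulr_natl.
  have : 0 <= (d%:R - 1) * s ^+ 2 * d%:R by rewrite !mulr_ge0 ?sqr_ge0//; lra.
  have : 0 <= s ^+ 2 * d%:R by rewrite !mulr_ge0 ?sqr_ge0//; lra.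
  by lra.
Qed.

(** At a bounded scale, density is used only to find one point where [h] is at least [t]. *)
Let small_dense z k e t : (k <= n)%N -> (forall x, cube z k.+1 x -> cube z0 n.+1 x) ->
  0 < t -> (2 ^ k)%:R < ks_scale ->
  (1 - ks_density) * (vol d k)%:R < (cnt (level t) (child z k e) k)%:R ->
  forall x, cube z k.+1 x -> ks_loss * t <= h x.
Proof.
move=> kn sub t0 sb dense x xc.
have h_dr := dr; have hk := kap0; have hk1 := kap1.
have /andP[del0 del1] := ks_density_bounds.
have cpos : (0 < cnt (level t) (child z k e) k)%N.
  rewrite -(ltr_nat R); apply: le_lt_trans dense.
  by rewrite mulr_ge0 ?ler0n// subr_ge0 ltW.
have [y yc hy] := cnt_gt0 cpos; have {}yc := cube_child yc.
have inbox (w : L) : cube z k.+1 w -> w \in box z0 (16 * d * 2 ^ n)%N.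
  move=> /sub /forallP H; rewrite mem_box; apply/forallP => i; have := H i.
  by rewrite expnS; exact: dist_cube_region.
have := @chain_ge _ _ l lam kap c h z0 _ (l1dist x y) x y l1 lam0 lam1 kap0 ac h0 hs
  (inbox _ xc) (inbox _ yc) erefl.
apply: le_trans; apply: ler_pM => //.
- by have /andP[? _] := ks_loss_bounds; exact: ltW.
- exact: ltW.
apply: (@le_trans _ _ ((kap / 2) ^+ ks_path)); first by rewrite /ks_loss ge_min lexx orbT.
have k2 : 0 <= kap / 2 by rewrite divr_ge0// ltW.
apply: ler_wiXn2l => //; first lra.
apply/ltnW; rewrite -(ltr_nat R).
have pos : 0 <= 2 * d%:R * ks_scale.
  apply: mulr_ge0; first by lra.
  by apply: ltW; apply: le_lt_trans sb; rewrite ler0n.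
apply: le_lt_trans (archi_boundP pos).
apply: (@le_trans _ _ (2 * d%:R * (2 ^ k)%:R)); last by apply: ler_wpM2l; [lra|exact: ltW].
have -> : 2 * d%:R * (2 ^ k)%:R = (\sum_(i < d) 2 ^ k.+1)%N%:R :> R.
  by rewrite sum_nat_const card_ord expnS !natrM; ring.
rewrite ler_nat; apply: leq_sum => i _; move: xc yc => /forallP/(_ i) + /forallP/(_ i).
exact: dist_in_cube.
Qed.

Let dense_parent z k e t : (k <= n)%N -> (forall x, cube z k.+1 x -> cube z0 n.+1 x) ->
  0 < t -> (1 - ks_density) * (vol d k)%:R < (cnt (level t) (child z k e) k)%:R ->
  forall x, cube z k.+1 x -> ks_loss * t <= h x.
Proof.
move=> kn sub t0; have [sb|sb] := leP ks_scale (2 ^ k)%:R; first exact: big_dense.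
exact: small_dense.
Qed.

(** After so many steps [(1 - ks_density) ^+ j] is below [1 / 2], by [pow_density], and a density
    that started at [1 / 2] would have grown past 1. *)
Definition ks_steps : nat := Num.bound (2 / ks_density).

Let pow_density j : (1 - ks_density) ^+ j * (1 + j%:R * ks_density) <= 1.
Proof.
have /andP[e0 e1] := ks_density_bounds.
elim: j => [|j IH]; first by rewrite expr0 mul0r addr0 mul1r.
apply: le_trans IH; rewrite exprSr -mulrA; apply: ler_wpM2l.
  by rewrite exprn_ge0// subr_ge0 ltW.
rewrite -natr1; have : 0 <= j%:R * ks_density ^+ 2 by rewrite mulr_ge0 ?sqr_ge0.
have : 0 <= ks_density ^+ 2 by rewrite sqr_ge0.
by lra.
Qed.

(* The density of [{h >= ks_loss ^ j * t}] grows by a factor [1 / (1 - ks_density)]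
   at each step as long as the cube is not dense. *)
Lemma measure_to_pointwise t : 0 < t ->
  (vol d n)%:R / 2 <= (cnt (level t) z0 n)%:R :> R ->
  forall x, cube z0 n.+1 x -> ks_loss ^+ ks_steps * t <= h x.
Proof.
move=> t0 half.
have /andP[e0 e1] := ks_density_bounds; have /andP[s0 s1] := ks_loss_bounds.
(* The cube at [z0] is a child of the cube of double side at [z0], so its being dense bounds [h] on
   the latter. *)
have z0E : child z0 n [ffun=> false] = z0.
  by apply/rowP => i; rewrite childE ffunE addr0.
have key j : (forall x, cube z0 n.+1 x -> ks_loss ^+ j * t <= h x) \/
   (vol d n)%:R / 2 <= (1 - ks_density) ^+ j * (cnt (level (ks_loss ^+ j * t)) z0 n)%:R :> R.
  elim: j => [|j [IH|IH]]; first by right; rewrite !expr0 !mul1r.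
    left => x /IH; apply: le_trans; rewrite exprS -mulrA ger_pMl//.
    by rewrite mulr_gt0// exprn_gt0.
  have tj : 0 < ks_loss ^+ j * t by rewrite mulr_gt0// exprn_gt0.
  have [nd|dense] := leP ((cnt (level (ks_loss ^+ j * t)) z0 n)%:R : R)
      ((1 - ks_density) * (vol d n)%:R).
    right; apply: le_trans IH _; rewrite exprSr -mulrA; apply: ler_wpM2l.
      by rewrite exprn_ge0// subr_ge0 ltW.
    rewrite exprS -mulrA.
    pose ok z k := (k <= n)%N /\ forall x, cube z k x -> cube z0 n x.
    apply: (@cnt_growth _ R ks_density _ _ ok) => //.
    - move=> z k e [kn H]; split; first exact: ltnW.
      by move=> x /cube_child; exact: H.
    - move=> z k e [kn H] dense x xc; apply: (dense_parent _ _ tj dense xc).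
        exact: ltnW.
      by move=> y /H yc; apply: (@cube_child _ _ _ [ffun=> false]); rewrite z0E.
  left => x xc; rewrite exprS -mulrA.
  by apply: (@dense_parent z0 n [ffun=> false] _ (leqnn n) _ tj _ x xc) => //; rewrite z0E.
have [//|abs] := key ks_steps.
have vpos : 0 < (vol d n)%:R :> R by rewrite ltr0n /vol expn_gt0 expn_gt0.
exfalso.
have c1 : (cnt (level (ks_loss ^+ ks_steps * t)) z0 n)%:R <= (vol d n)%:R :> R.
  by rewrite ler_nat cnt_le_vol.
have p0 : 0 <= (1 - ks_density) ^+ ks_steps by rewrite exprn_ge0// subr_ge0 ltW.
have := le_trans abs (ler_wpM2l p0 c1).
rewrite mulrC ler_pM2r// => half2.
have := pow_density ks_steps.
have big : 2 < ks_steps%:R * ks_density.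
  by rewrite -ltr_pdivrMr//; apply: archi_boundP; rewrite divr_ge0// ltW.
have : 1 / 2 * (1 + ks_steps%:R * ks_density) <=
  (1 - ks_density) ^+ ks_steps * (1 + ks_steps%:R * ks_density).
  by apply: ler_wpM2r; lra.
by lra.
Qed.
End superharmonic.
End krylov_safonov.

Section hitting_limit.
Variables (R : realType) (d : nat) (l : 'rV[R]_d) (lam : R).
Local Notation L := 'rV[int]_d.
Local Notation cfield := (L -> 'I_d -> R).
Local Notation gen := (gen l lam).
Local Notation step := (walk_step l lam).
Local Notation stopped := (stopped l lam).
Hypotheses (l1 : enorm l = 1) (lam0 : 0 < lam) (lam1 : lam <= 1 / 2).
Variables (kap : R).
Hypothesis kap0 : 0 < kap.

Lemma stopped_subdomain (c : cfield) (D D' : L -> bool) N (f : L -> R) x : admissible kap c ->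
  (forall z, D' z -> D z) -> (forall z, 0 <= f z) -> (forall z, D z -> ~~ D' z -> f z = 0) ->
  stopped c D' N f x <= stopped c D N f x.
Proof.
move=> ac DD f0 fD; elim: N x => [//|N IH] x.
have [D'x|D'x] := boolP (D' x).
  rewrite !stoppedS D'x (DD _ D'x).
  by apply: (@step_mono _ _ _ _ _ _ _ kap).
rewrite stopped_out//; have [Dx|Dx] := boolP (D x); last by rewrite stopped_out.
by rewrite fD// (stopped_ge0 l1 lam0 lam1 kap0).
Qed.

(** The Krylov-Safonov estimate needs a function that is superharmonic at every site, which the
    hitting probability before time [N] is not. Its supremum over [N] is, and the two differ by at
    most [T x / N]. *)
Lemma hitting_limit (c : cfield) (D : L -> bool) (f T : L -> R) : admissible kap c ->
  (forall z, 0 <= f z <= 1) -> (forall z, D z -> f z = 0) ->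
  (forall z, 0 <= T z) -> (forall z, D z -> gen c T z <= -1) ->
  exists H : L -> R, [/\ forall x, 0 <= H x, forall N x, stopped c D N f x <= H x,
    forall x, D x -> gen c H x <= 0 &
    forall N x, (0 < N)%N -> H x <= stopped c D N f x + T x / N%:R].
Proof.
move=> ac f01 fD T0 TD.
have f0 z : 0 <= f z by have /andP[] := f01 z.
have f1 z : f z <= 1 by have /andP[] := f01 z.
have mono := stopped_mono l1 lam0 lam1 kap0.
have nd N x : stopped c D N f x <= stopped c D N.+1 f x.
  rewrite [leRHS](_ : _ = stopped c D N (stopped_step l lam c D f) x); last first.
    by rewrite /stopped iterSr.
  apply: mono => // z; rewrite /stopped_step; case: ifP => // Dz; rewrite fD//.
  by apply: (@step_ge0 _ _ _ _ _ _ _ kap).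
have ndl M N x : (M <= N)%N -> stopped c D M f x <= stopped c D N f x.
  move=> /subnKC <-; elim: (N - M)%N => [|k IH]; first by rewrite addn0.
  by rewrite addnS; apply: le_trans IH _.
have le1 N x : stopped c D N f x <= 1.
  by rewrite -[leRHS](stopped_cst l lam c D N 1 x); exact: mono.
have inc N k x : stopped c D (N + k) f x <= stopped c D N f x + stopped c D N (fun z => (D z)%:R) x.
  rewrite {1}/stopped iterD -!/(stopped _ _ _ _).
  apply: le_trans (_ : stopped c D N (fun z => 1 * f z + 1 * (D z)%:R) x <= _); last first.
    by rewrite stopped_lin !mul1r.
  apply: mono => // z; have [Dz|Dz] := boolP (D z); last first.
    by rewrite stopped_out// !mul1r lerDl ler0n.
  by apply: le_trans (le1 k z) _; rewrite fD// mulr0 add0r mul1r.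
pose A x := [set stopped c D N f x | N in [set: nat]].
have supA x : has_sup (A x).
  split; first by exists (stopped c D 0 f x), 0%N.
  by exists 1 => _ [N _ <-].
exists (fun x => sup (A x)).
have ub N x : stopped c D N f x <= sup (A x).
  by apply: ub_le_sup; [by case: (supA x)|exists N].
have near_sup x e : 0 < e -> exists N, sup (A x) <= stopped c D N f x + e.
  move=> e0; have [_ [N _ <-] h] := sup_adherent e0 (supA x).
  by exists N; lra.
split=> //.
- by move=> x; apply: le_trans (ub 0%N x); exact: f0.
- move=> x Dx.
  suff : step c (fun x => sup (A x)) x <= sup (A x) by rewrite /walk_step gerDl.
  apply/ler_addgt0Pr => e e0.
  (* One step involves finitely many sites, so a single [N] comes within [e] of all the suprema. *)
  have [N HN] : exists N, forall y, y \in box x 1 -> sup (A y) <= stopped c D N f y + e.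
    elim: (box x 1) => [|y s [N HN]]; first by exists 0%N.
    have [M HM] := near_sup y e e0; exists (maxn M N) => w; rewrite inE => /predU1P[->|/HN h].
      by apply: le_trans HM _; rewrite lerD2r ndl// leq_maxl.
    by apply: le_trans h _; rewrite lerD2r ndl// leq_maxr.
  apply: (@le_trans _ _ (step c (fun z => 1 * stopped c D N f z + 1 * e) x)).
    apply: (@step_mono _ _ _ _ _ _ _ kap) => //.
    - by rewrite !mul1r; apply: HN; exact: box_refl.
    - by move=> i; rewrite !mul1r; apply: HN; have /andP[] := box_nbr i (box_refl x 0).
    - by move=> i; rewrite !mul1r; apply: HN; have /andP[] := box_nbr i (box_refl x 0).
  have := ub N.+1 x; rewrite stoppedS Dx /walk_step (gen_lin _ _ _ _ _ _ (fun=> e)) gen_cst.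
  lra.
- move=> N x N0; have Nr : 0 < N%:R :> R by rewrite ltr0n.
  have ins := stopped_inside l1 lam0 lam1 kap0 N x ac T0 TD.
  have {}ins : stopped c D N (fun z => (D z)%:R) x <= T x / N%:R.
    by rewrite ler_pdivlMr// mulrC.
  apply: ge_sup; first by exists (stopped c D 0 f x), 0%N.
  move=> _ [M _ <-]; have [MN|NM] := leqP M N.
    apply: le_trans (ndl _ _ x MN) _; rewrite lerDl divr_ge0//.
  have := inc N (M - N)%N x; rewrite subnKC ?(ltnW NM)//; lra.
Qed.
End hitting_limit.

Lemma cube_of_center (b q : int) (K : nat) : `|b - (q + K%:Z)| < K%:Z ->
  q <= b < q + (2 * K)%:Z.
Proof. by rewrite ltr_norml => /andP[g1 g2]; lia. Qed.

Lemma dist_corner (b q : int) (K : nat) : q <= b < q + K%:Z -> `|b - q| <= K%:Z.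
Proof. by move=> /andP[g1 g2]; rewrite ler_norml; lia. Qed.

(** * Overlap of exit laws *)

Section overlap.
Variables (R : realType) (d : nat) (kap : R).
Local Notation L := 'rV[int]_d.
Local Notation cfield := (L -> 'I_d -> R).
Hypotheses (d2 : (2 <= d)%N) (kap0 : 0 < kap) (kap1 : kap <= 1).

Let D : R := d%:R.
Let D2 : 2 <= D. Proof. by rewrite /D (ler_nat R 2). Qed.
Let d0 : (0 < d)%N. Proof. exact: leq_trans d2. Qed.

(** It serves twice: as the ratio of radii in the barrier that leads back to 0, and as the hitting
    probability above which a point counts as good. It is also [g / a], where [g] is the unit of
    length of the construction. *)
Definition ov_thr : R := (64 * d%:R ^+ 2)^-1.
Definition ov_gain : R :=
  barrier_cst kap ov_thr * (ks_loss d kap ^+ ks_steps d kap * ov_thr).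
(** Lower bound required of [1 / lam]: the first term makes [g] at least [d], so that lattice
    rounding is negligible, and the second makes the radius [a / (2 * d)] admissible for the
    barrier. *)
Definition ov_scale : R := 64 * d%:R ^+ 3 + 4 * d%:R * barrier_rate kap ov_thr.

Let thr01 : 0 < ov_thr <= 1.
Proof.
have h := D2; have h2 : 4 <= D ^+ 2 by rewrite expr2; nra.
rewrite /ov_thr -/D invr_gt0; apply/andP; split; first by lra.
by rewrite invf_le1; lra.
Qed.

Lemma ov_gain_gt0 : 0 < ov_gain.
Proof.
have /andP[t0 t1] := thr01; have /andP[s0 _] := ks_loss_bounds d0 kap0 kap1.
apply: mulr_gt0; first exact: barrier_cst_gt0.
by rewrite mulr_gt0// exprn_gt0.
Qed.

Lemma ov_scale_ge2 : 2 <= ov_scale.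
Proof.
have h := D2; have h4 : 4 <= D * D by nra.
have h2 : 8 <= D ^+ 3 by rewrite !exprS expr0 mulr1; nra.
have := barrier_rate_ge kap0 kap1 thr01; rewrite /ov_scale -/D => h3.
have : 0 <= D * barrier_rate kap ov_thr by rewrite mulr_ge0//; lra.
lra.
Qed.

Lemma cnt_mono (P Q : pred L) z k : (forall x : L, cube z k x -> P x -> Q x) -> (cnt P z k <= cnt Q z k)%N.
Proof.
elim: k z => [|k IH] z H /=.
  by case Pz : (P z) => //; rewrite (H z)// cube_self.
by apply: leq_sum => e _; apply: IH => x /cube_child; exact: H.
Qed.

Variables (l : 'rV[R]_d) (lam : R).
Hypotheses (l1 : enorm l = 1) (lam0 : 0 < lam) (lamS : lam * ov_scale <= 1).
Local Notation gen := (gen l lam).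
Local Notation stopped := (stopped l lam).
Local Notation lev := (lev l).

Lemma lev_dist (x y : L) (M : R) :
  (forall i, `|(x 0 i - y 0 i)%:~R| <= M) -> `|lev x - lev y| <= d%:R * M.
Proof.
move=> H; rewrite -levB /lev /dotp; apply: le_trans (ler_norm_sum _ _ _) _.
apply: (@le_trans _ _ (\sum_(i < d) M)); last by rewrite sumr_const card_ord mulr_natl.
apply: ler_sum => i _; rewrite normrM -[leRHS]mul1r; apply: ler_pM => //.
  exact: dir_le1.
by have := H i; rewrite !mxE.
Qed.

Lemma lam_le_half : lam <= 1 / 2.
Proof.
have := ov_scale_ge2 => h; have h2 := ler_wpM2l (ltW lam0) h.
by have := le_trans h2 lamS; lra.
Qed.

Let lam1 := lam_le_half.
Let a : R := lam^-1.
Let la : lam * a = 1. Proof. by rewrite /a divff// gt_eqF. Qed.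
Let a_ge : ov_scale <= a.
Proof. by rewrite -[leRHS]mul1r ler_pdivlMr// mulrC. Qed.

Let g : R := a / (64 * D ^+ 2).
Let aE : a = 64 * D ^+ 2 * g.
Proof. by rewrite /g; field; rewrite gt_eqF//; have := D2; lra. Qed.

Let gD : D <= g.
Proof.
have h := D2; rewrite /g ler_pdivlMr; last by rewrite mulr_gt0// exprn_gt0; lra.
apply: le_trans a_ge; rewrite /ov_scale -/D.
have := barrier_rate_ge kap0 kap1 thr01 => h3.
have : 0 <= D * barrier_rate kap ov_thr by rewrite mulr_ge0//; lra.
lra.
Qed.

Let scale_exists : exists n : nat, D * (2 ^ n)%:R <= g < 2 * D * (2 ^ n)%:R.
Proof.
have h := D2; have h2 := gD.
have q1 : 1 <= g / D by rewrite ler_pdivlMr; lra.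
have t1 : (0 < Num.truncn (g / D))%N by rewrite truncn_gt0.
have /andP[b1 b2] := trunc_log_bounds (isT : (1 < 2)%N) t1.
exists (trunc_log 2 (Num.truncn (g / D))); apply/andP; split.
  rewrite mulrC -ler_pdivlMr; last lra.
  by apply: (@le_trans _ _ (Num.truncn (g / D))%:R); [rewrite ler_nat|rewrite truncn_le; lra].
have := @truncnS_gt R (g / D).
have : (Num.truncn (g / D)).+1%:R <= (2 ^ (trunc_log 2 (Num.truncn (g / D))).+1)%:R :> R.
  by rewrite ler_nat.
rewrite expnS natrM; move: (2 ^ _)%:R => w w1 w2.
have : g / D < 2 * w by lra.
by rewrite ltr_pdivrMr; lra.
Qed.

Let below : L -> bool := fun x => lev x < a.
Let slab : L -> bool := fun x => (0 <= lev x) && (lev x < a).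
Let top (S : pred L) (x : L) : R := (~~ below x && S x)%:R.
Let cost0 : R := (a + 1) / (2 * kap * lam).

Let cost_le x : 0 <= lev x -> exit_cost l lam kap a x <= cost0.
Proof.
move=> x0; rewrite /exit_cost /cost0 ge_max.
have k : 0 < 2 * kap * lam by rewrite !mulr_gt0.
have a0 : 0 < a by rewrite invr_gt0.
by rewrite divr_ge0 ?(ltW k)//= ?ler_pM2r ?invr_gt0//; lra.
Qed.

(** [lev / (a + 1)] is a submartingale, at most 1 after an exit at the top, where the overshoot is
    at most 1, and negative after an exit at the bottom. The term [cost0 / N] accounts for the mass
    still inside. *)
Let top_slab c N S x : admissible kap c -> (0 < N)%N -> 0 <= lev x < a + 1 ->
  lev x / (a + 1) - cost0 / N%:R <= stopped c slab N (top S) x + stopped c slab N (top (predC S)) x.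
Proof.
move=> ac N0 /andP[x0 xa].
have a0 : 0 < a by rewrite invr_gt0.
have Nr : 0 < N%:R :> R by rewrite ltr0n.
have T0 := exit_cost_ge0 l lam kap a.
have TD z : slab z -> gen c (exit_cost l lam kap a) z <= -1.
  by move=> /andP[_ za]; exact: gen_exit_cost.
have ins := stopped_inside l1 lam0 lam1 kap0 N x ac T0 TD.
have {}ins : stopped c slab N (fun z => (slab z)%:R) x <= cost0 / N%:R.
  by rewrite ler_pdivlMr// mulrC; apply: le_trans ins _; exact: cost_le.
have sub : lev x * (a + 1)^-1 <= stopped c slab N (fun z => (a + 1)^-1 * lev z + 0 * lev z) x.
  have := @stopped_sub _ _ l lam l1 lam0 lam1 kap kap0 c slab N
    (fun z => (a + 1)^-1 * lev z + 0 * lev z) x ac.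
  rewrite mul0r addr0 mulrC; apply => z _; rewrite gen_lin mul0r addr0.
  have := gen_lev_ge l1 lam0 kap0 z ac; have : 0 < (a + 1)^-1 by rewrite invr_gt0; lra.
  move=> i0 h; rewrite mulr_ge0 ?(ltW i0)//; apply: le_trans h.
  by rewrite !mulr_ge0// ltW.
have dom : stopped c slab N (fun z => (a + 1)^-1 * lev z + 0 * lev z) x <=
  stopped c slab N (fun z => 1 * (1 * top S z + 1 * top (predC S) z) + 1 * (slab z)%:R) x.
  apply: (@stopped_mono_on _ _ _ _ l1 lam0 lam1 kap kap0 (fun z => lev z < a + 1)) => //.
    move=> z _ /andP[_ za] i; have [h1 [h2 _]] := lev_nbr l1 z i; split; lra.
  move=> z za; rewrite mul0r addr0 !mul1r /top /slab /below.
  have h1 : (a + 1)^-1 * lev z <= 1 by rewrite mulrC ler_pdivrMr; lra.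
  case: (ltP (lev z) a) => h2 /=; last first.
    by rewrite andbF; case: (S z); rewrite ?addr0 ?add0r.
  rewrite andbT !add0r; case: (leP 0 (lev z)) => h3 //=.
  by rewrite mulr_ge0_le0 ?invr_ge0; lra.
by move: (le_trans sub dom); rewrite !stopped_lin !mul1r; lra.
Qed.

(** A lattice approximation of [16 * g] times the direction: a corner of the cube on which the two
    events are compared. *)
Let z0 : L := \row_i Num.floor (l 0 i * (16 * g)).

Let z0_coord i : `|(z0 0 i)%:~R - l 0 i * (16 * g)| <= 1.
Proof.
rewrite mxE; have := @floor_le_tmp R (l 0 i * (16 * g)); have := @floorD1_gt R (l 0 i * (16 * g)).
by rewrite intrD ler_norml; move: (_%:~R) => w h1 h2; apply/andP; split; lra.
Qed.

Let lev_z0 : 16 * g - D <= lev z0 <= 16 * g + D.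
Proof.
have E : lev z0 - 16 * g = \sum_i l 0 i * ((z0 0 i)%:~R - l 0 i * (16 * g)).
  have E0 : 16 * g = \sum_i l 0 i ^+ 2 * (16 * g) by rewrite -mulr_suml sum_sqr_dir// mul1r.
  rewrite {1}E0 /lev /dotp -sumrB.
  by apply: eq_bigr => i _; rewrite [toR _ _ _]mxE; ring.
have : `|lev z0 - 16 * g| <= D.
  rewrite E; apply: le_trans (ler_norm_sum _ _ _) _.
  apply: (@le_trans _ _ (\sum_(i < d) 1)); last by rewrite sumr_const card_ord.
  apply: ler_sum => i _; rewrite normrM -[leRHS]mul1r; apply: ler_pM => //.
  exact: dir_le1.
by rewrite ler_norml; lra.
Qed.

Let coord17 (x y w : R) : `|x - y| <= 1 -> `|y| <= 16 * g -> 2 * w <= g -> 1 <= w ->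
  `|x + w| <= 17 * g.
Proof.
by have hD := D2; have hg := gD; rewrite !ler_norml => /andP[? ?] /andP[? ?] ? ?; lra.
Qed.

(** The Krylov-Safonov estimate gives a lower bound on the cube of double side, and the barrier,
    centred in it, brings this bound down to 0. Every region used has levels below [a]; this is what
    the ratio [64 * D ^+ 2] between [a] and [g] is for. *)
Let hit_from_half c S N n : admissible kap c -> (0 < N)%N ->
  D * (2 ^ n)%:R <= g < 2 * D * (2 ^ n)%:R ->
  (vol d n)%:R / 2 <= (cnt (fun x => ov_thr <= stopped c below N (top S) x) z0 n)%:R :> R ->
  ov_gain <= stopped c below N (top S) 0 + cost0 / N%:R.
Proof.
move=> ac N0 /andP[wg gw] half; set w : R := (2 ^ n)%:R in wg gw.
have hD := D2; have hg := gD; have /andP[z1m z1p] := lev_z0.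
have w1 : 1 <= w by rewrite /w ler1n expn_gt0.
have a0 : 0 < a by rewrite invr_gt0.
have gDD : 0 <= (D - 2) * g by rewrite mulr_ge0; lra.
have D0 : 0 < D by lra.
have g0 : 0 < g by lra.
have w0 : 0 <= w by lra.
have DN0 : D != 0 by rewrite gt_eqF.
have D20 : 0 <= D - 2 by rewrite subr_ge0.
have gDD2 : 0 <= (D - 2) * D * g by exact: mulr_ge0 (mulr_ge0 D20 (ltW D0)) (ltW g0).
have w2g : 2 * w <= g by have := ler_wpM2r w0 hD; lra.
have DDw : D * (D * w) <= D * g by rewrite ler_pM2l.
have g17 : 0 <= 17 * g by lra.
have g16 : 0 <= 16 * g by lra.
have g2D : g / (2 * D) < w by rewrite ltr_pdivrMr ?mulr_gt0//; lra.
have DDg : D ^+ 2 * g = a / 64 by rewrite aE; field.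
have top01 z : 0 <= top S z <= 1 by rewrite /top ler0n lern1 leq_b1.
have topD z : below z -> top S z = 0 by rewrite /top => ->.
have T0 := exit_cost_ge0 l lam kap a.
have TD z : below z -> gen c (exit_cost l lam kap a) z <= -1.
  by move=> za; exact: gen_exit_cost.
have [H [H0 HN Hs HT]] := hitting_limit l1 lam0 lam1 kap0 ac top01 topD T0 TD.
have H00 : H 0 <= stopped c below N (top S) 0 + cost0 / N%:R.
  apply: le_trans (HT N 0 N0) _; rewrite lerD2l ler_wpM2r ?invr_ge0 ?ler0n//.
  by apply: cost_le; rewrite lev0.
apply: le_trans H00.
have /andP[t0 t1] := thr01.
have lamw : lam * (8 * d%:R * (2 ^ n)%:R) <= 1.
  rewrite -[leRHS]la; apply: ler_wpM2l; first exact: ltW.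
  by rewrite -/D -/w; lra.
have region z : z \in box z0 (16 * d * 2 ^ n)%N -> gen c H z <= 0.
  move=> zb; apply: Hs; rewrite /below.
  have := @lev_dist z z0 (16 * D * w).
  rewrite -/D => h; have {}h : `|lev z - lev z0| <= D * (16 * D * w).
    apply: h => i; have := box_coord R i zb.
    by rewrite !natrM.
  move: h; rewrite ler_norml => /andP[_ h].
  by lra.
have ks := @measure_to_pointwise R d kap d0 kap0 kap1 l lam l1 lam0 lam1 c H z0 n ac H0 lamw
  region ov_thr t0.
have {}ks : forall x, cube z0 n.+1 x -> ks_loss d kap ^+ ks_steps d kap * ov_thr <= H x.
  apply: ks; apply: le_trans half _; rewrite ler_nat; apply: cnt_mono => x _ h.
  exact: le_trans h (HN _ _).
(* Centre of the doubled cube. The inner ball of the barrier has radius [g / (2 * D)], less than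
   [w], and so lies in that cube. *)
pose z1 : L := z0 + const_mx (2 ^ n)%N%:Z.
have z1E i : (z1 0 i)%:~R = (z0 0 i)%:~R + w :> R.
  by rewrite /z1 mxE [const_mx _ _ _]mxE intrD.
have r0 : 0 < a / (2 * D) by rewrite divr_gt0// mulr_gt0.
have rE : a / (2 * D) = 32 * D * g by rewrite aE; field.
have lz1 : lev z1 <= 18 * g.
  have := @lev_dist z1 z0 w; rewrite -/D => h.
  have {}h : `|lev z1 - lev z0| <= D * w.
    apply: h => i; rewrite intrB z1E addrAC subrr add0r ger0_norm//.
  by move: h; rewrite ler_norml => /andP[_ h]; lra.
have bar := @barrier R d l lam l1 lam0 lam1 kap kap0 kap1 ov_thr (a / (2 * D)) c H
   (ks_loss d kap ^+ ks_steps d kap * ov_thr) z1 thr01.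
apply: bar => //.
- rewrite ler_pdivlMr ?mulr_gt0//; apply: le_trans a_ge; rewrite /ov_scale -/D.
  by have := exprn_ge0 3 (ltW D0); lra.
- by rewrite mulrA la ler_pdivrMr ?mulr_gt0//; lra.
- have /andP[s0 _] := ks_loss_bounds d0 kap0 kap1.
  by rewrite mulr_ge0 ?exprn_ge0// ltW.
- move=> z zr; apply: Hs; rewrite /below.
  have := @lev_dist z z1 (32 * D * g); rewrite -/D => h.
  have {}h : `|lev z - lev z1| <= D * (32 * D * g).
    apply: h => i; rewrite -rE -(@ler_pXn2r _ 2) ?nnegrE ?(ltW r0)//.
    rewrite real_normK ?num_real//; apply: le_trans (ltW zr).
    by rewrite /sqdist (bigD1 i)//= lerDl sumr_ge0// => j _; rewrite sqr_ge0.
  by move: h; rewrite ler_norml => /andP[_ h]; lra.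
- move=> z zr; apply: ks; apply/forallP => i.
  have rw : ov_thr * (a / (2 * D)) < w.
    have -> : ov_thr * (a / (2 * D)) = g / (2 * D).
      by rewrite /ov_thr -/D aE; field.
    exact: g2D.
  have r1 : 0 <= ov_thr * (a / (2 * D)) by rewrite mulr_ge0 ?ltW.
  have : `|(z 0 i - z1 0 i)%:~R| < w :> R.
    rewrite -(@ltr_pXn2r _ 2) ?nnegrE//.
    rewrite real_normK ?num_real//; apply: (@le_lt_trans _ _ ((ov_thr * (a / (2 * D))) ^+ 2)).
      apply: le_trans zr.
      by rewrite /sqdist (bigD1 i)//= lerDl sumr_ge0// => j _; rewrite sqr_ge0.
    by rewrite ltr_pXn2r ?nnegrE.
  rewrite -intr_norm /w -[(2 ^ n)%:R]/((2 ^ n)%N%:Z%:~R) ltr_int.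
  rewrite /z1 mxE [const_mx _ _ _]mxE expnS.
  exact: cube_of_center.
- have coord i : (((0 : L) 0 i - z1 0 i)%:~R) ^+ 2 <= (17 * g) ^+ 2 :> R.
    rewrite -real_normK ?num_real// lerXn2r ?nnegrE//.
    rewrite mxE sub0r intrN normrN z1E.
    have h1 := z0_coord i.
    have h2 : `|l 0 i * (16 * g)| <= 16 * g.
      by rewrite normrM [`|16 * g|]ger0_norm// ler_piMl// dir_le1.
    exact: coord17 h1 h2 w2g w1.
  rewrite /sqdist; apply: (@le_trans _ _ (\sum_(i < d) (17 * g) ^+ 2)).
    by apply: ler_sum => i _; exact: coord.
  rewrite sumr_const card_ord -mulr_natl -/D rE.
  have : 0 <= (D - 2) * D * g ^+ 2 by exact: mulr_ge0 (mulr_ge0 D20 (ltW D0)) (sqr_ge0 _).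
  have : 0 <= D * g ^+ 2 by apply: mulr_ge0; [exact: ltW|exact: sqr_ge0].
  by lra.
Qed.

(* The slab keeps both walks in the common half-space: from any point at height
   comparable to [a] they leave at the top with probability bounded below, so on a
   cube at that height one of the two events, for [c1] or for [c2], is likely at
   half of the points, and the Krylov-Safonov estimate carries this down to 0. *)
Lemma overlap : exists N0 : nat, forall N, (N0 <= N)%N -> forall c1 c2 S,
  admissible kap c1 -> admissible kap c2 -> (forall x, 0 <= lev x -> c1 x = c2 x) ->
  ov_gain / 2 <= stopped c1 below N (top S) 0 + stopped c2 below N (top (predC S)) 0.
Proof.
have hD := D2; have hg := gD; have /andP[z1m z1p] := lev_z0.
have a0 : 0 < a by rewrite invr_gt0.
have /andP[t0 t1] := thr01; have gain0 := ov_gain_gt0.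
have c00 : 0 < cost0 by rewrite /cost0 divr_gt0// ?mulr_gt0//; lra.
have [n /andP[wg gw]] := scale_exists; set w : R := (2 ^ n)%:R in wg gw.
have gDD : 0 <= (D - 2) * g by rewrite mulr_ge0; lra.
have gDD2 : 0 <= (D - 2) * D * g by apply: mulr_ge0; [apply: mulr_ge0|]; lra.
(* The mass not yet out at time [N] is made smaller than the threshold and than half of the gain. *)
pose N0 := (Num.bound (cost0 / ov_thr + 2 * cost0 / ov_gain)).+1.
exists N0 => N NN0 c1 c2 S ac1 ac2 c12.
have N1 : (0 < N)%N by apply: leq_trans NN0.
have Nr : 0 < N%:R :> R by rewrite ltr0n.
have q1 : 0 <= cost0 / ov_thr by rewrite divr_ge0 ?ltW.
have q2 : 0 <= 2 * cost0 / ov_gain.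
  by apply: divr_ge0; [rewrite mulr_ge0 ?(ltW c00)|exact: ltW].
have Nb : cost0 / ov_thr + 2 * cost0 / ov_gain <= N%:R.
  apply/ltW/(lt_le_trans (archi_boundP (addr_ge0 q1 q2))).
  by rewrite ler_nat; apply: leq_trans NN0.
have Nt : cost0 / N%:R <= ov_thr.
  have : cost0 / ov_thr <= N%:R by lra.
  by rewrite ler_pdivrMr// => h; rewrite ler_pdivrMr//; lra.
have Ng : cost0 / N%:R <= ov_gain / 2.
  have : 2 * cost0 / ov_gain <= N%:R by lra.
  by rewrite ler_pdivrMr// => h; rewrite ler_pdivrMr//; lra.
have thrE : ov_thr * (64 * D ^+ 2) = 1.
  by rewrite /ov_thr -/D mulVf// gt_eqF// mulr_gt0// exprn_gt0; lra.
pose P1 : pred L := fun x => ov_thr <= stopped c1 below N (top S) x.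
pose P2 : pred L := fun x => ov_thr <= stopped c2 below N (top (predC S)) x.
have sub c S' x : admissible kap c -> stopped c slab N (top S') x <= stopped c below N (top S') x.
  move=> ac; apply: (stopped_subdomain l1 lam0 lam1 kap0) => //.
  - by move=> z /andP[].
  - by move=> z zb _; rewrite /top zb.
have cover x : cube z0 n x -> predC P1 x -> P2 x.
  move=> xc; rewrite /= -ltNge => h1.
  have := @lev_dist x z0 w; rewrite -/D => h.
  have {}h : `|lev x - lev z0| <= D * w.
    apply: h => i; rewrite -intr_norm /w -[(2 ^ n)%:R]/((2 ^ n)%N%:Z%:~R) ler_int.
    by apply: dist_corner; move/forallP: xc; exact.
  move: h; rewrite ler_norml => /andP[h2 h3].
  have x14 : 14 * g <= lev x by lra.
  have xa : lev x < a by rewrite aE; lra.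
  have := @top_slab c1 N S x ac1 N1; rewrite (_ : 0 <= lev x < a + 1); last first.
    by rewrite (le_trans _ x14) ?ltr_wpDr// mulr_ge0// (le_trans _ hg)// (le_trans _ hD).
  move=> /(_ isT) h4.
  have h5 : stopped c1 slab N (top (predC S)) x = stopped c2 slab N (top (predC S)) x.
    by apply: stopped_eq_field => z /andP[z00 _]; exact: c12.
  have h6 := sub c1 S x ac1; have h7 := sub c2 (predC S) x ac2.
  rewrite /P2; suff : 7 * ov_thr <= lev x / (a + 1).
    by rewrite h5 in h4; move: t0 Nt; lra.
  rewrite ler_pdivlMr; last by rewrite ltr_wpDr.
  have a1 : 1 <= a by have := ov_scale_ge2; have := a_ge; lra.
  have : ov_thr * a = g by rewrite aE mulrA thrE mul1r.
  have : ov_thr * 1 <= ov_thr * a by rewrite ler_pM2l.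
  by lra.
have tot := cnt_predC P1 z0 n.
have cc : (cnt (predC P1) z0 n <= cnt P2 z0 n)%N by apply: cnt_mono => x; exact: cover.
have pos c S' : admissible kap c -> 0 <= stopped c below N (top S') 0.
  by move=> ac; apply: (stopped_ge0 l1 lam0 lam1 kap0) => // z; rewrite /top ler0n.
have scale : D * (2 ^ n)%:R <= g < 2 * D * (2 ^ n)%:R by rewrite wg gw.
have [h|h] := leP ((vol d n)%:R / 2) ((cnt P1 z0 n)%:R : R).
  have := hit_from_half ac1 N1 scale h; have := pos c2 (predC S) ac2; lra.
have {}h : (vol d n)%:R / 2 <= (cnt P2 z0 n)%:R :> R.
  have : (cnt P1 z0 n)%:R + (cnt P2 z0 n)%:R >= (vol d n)%:R :> R.
    by rewrite -natrD ler_nat -tot leq_add2l.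
  by lra.
have := hit_from_half ac2 N1 scale h; have := pos c1 S ac1; lra.
Qed.
End overlap.

(** * Annealed displacement *)

Section potential.
Variables (R : realType) (d : nat) (l : 'rV[R]_d) (lam : R) (j : 'I_d).
Local Notation L := 'rV[int]_d.
Local Notation cfield := (L -> 'I_d -> R).
Local Notation gen := (gen l lam).
Local Notation step := (walk_step l lam).
Local Notation stopped := (stopped l lam).
Local Notation lev := (lev l).
Implicit Types (c : cfield) (x y : L) (n : nat).

(* [lam * l 0 j * pot c n x] is the mean displacement in direction [j] after [n]
   steps, see [iter_step_coord]. *)
Fixpoint pot c n x : R :=
  if n is m.+1 then 2 * c x j + step c (pot c m) x else 0.

Lemma pot_local c c' n x : (forall y, y \in box x n -> c y = c' y) ->
  pot c n x = pot c' n x.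
Proof.
elim: n x => [//|n IH] x H; rewrite /= H ?box_refl//; congr (_ + _).
rewrite /walk_step (@eq_gen_field _ _ l lam c c') ?H ?box_refl//.
congr (_ + _); first by apply: IH => y yx; apply: H; apply: box_le yx.
by apply: eq_gen => [|i|i]; apply: IH => y yx; apply: H;
  [apply: box_le yx|apply: (@box_nbr_le _ _ _ _ i); rewrite yx|
   apply: (@box_nbr_le _ _ _ _ i); rewrite yx orbT].
Qed.

Lemma pot_shift c n x y : pot c n (x + y) = pot (fun z => c (z + y)) n x.
Proof.
elim: n x => [//|n IH] x; rewrite /= /walk_step IH; congr (_ + (_ + _)).
by apply: eq_bigr => i _; rewrite -!IH ![_ + y + _]addrAC.
Qed.

Section unit_direction.
Hypotheses (l1 : enorm l = 1) (lam0 : 0 < lam) (lam1 : lam <= 1 / 2).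
Variables (kap : R).
Hypothesis kap0 : 0 < kap.

Lemma field_bounds c x i : admissible kap c -> 0 <= c x i <= 1 / 2.
Proof.
move=> [c1 c2]; have c0 k : 0 <= c x k by exact: le_trans (ltW kap0) (c1 _ _).
rewrite c0/=; apply: le_trans (c2 x); rewrite (bigD1 i)//= lerDl.
by apply: sumr_ge0 => k _; exact: c0.
Qed.

Lemma step_le c f g x : admissible kap c -> (forall z, f z <= g z) -> step c f x <= step c g x.
Proof. by move=> ac fg; apply: (step_mono l1 lam0 lam1 kap0 ac). Qed.

Lemma pot_incr c n x : admissible kap c -> 0 <= pot c n.+1 x - pot c n x <= 1.
Proof.
move=> ac; elim: n x => [|n IH] x.
  rewrite /= /walk_step gen_cst; have /andP[h1 h2] := field_bounds x j ac.
  by apply/andP; split; lra.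
have -> : pot c n.+2 x - pot c n.+1 x = step c (fun z => pot c n.+1 z - pot c n z) x.
  by rewrite [in RHS]/walk_step genB /= /walk_step; ring.
have E (a : R) : step c (fun=> a) x = a by rewrite /walk_step gen_cst addr0.
apply/andP; split.
  by rewrite -[leLHS](E 0); apply: step_le => // z; have /andP[] := IH z.
by rewrite -[leRHS](E 1); apply: step_le => // z; have /andP[] := IH z.
Qed.

Lemma pot_bounds c n x : admissible kap c -> 0 <= pot c n x <= n%:R.
Proof.
move=> ac; elim: n => [|n /andP[IH1 IH2]]; first by rewrite lexx.
by have /andP[h1 h2] := pot_incr n x ac; rewrite -natr1; apply/andP; split; lra.
Qed.

(** The generator of [pot c n] is its increment in [n] minus [2 * c x j], both in [[0, 1]], whatever
    the horizon. *)
Lemma gen_pot c n x : admissible kap c -> `|gen c (pot c n) x| <= 1.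
Proof.
move=> ac; have /andP[h1 h2] := pot_incr n x ac.
have /andP[h3 h4] := field_bounds x j ac.
by move: h1 h2; rewrite /= /walk_step ler_norml => h1 h2; apply/andP; split; lra.
Qed.

Lemma ediscount_ge1 s x : lev x < - s -> 1 <= ediscount l lam s x.
Proof.
move=> xs; rewrite /ediscount -expR0 ler_expR oppr_ge0 mulr_ge0_le0//.
  by rewrite divr_ge0// ltW.
by lra.
Qed.

Lemma gen_ediscount_le0 c s x : admissible kap c -> gen c (ediscount l lam s) x <= 0.
Proof.
move=> ac; apply: le_trans (gen_ediscount l1 lam0 lam1 kap0 s x ac) _.
rewrite mulNr oppr_le0 mulr_ge0//; last exact/ltW/ediscount_gt0.
by rewrite divr_ge0// mulr_ge0 ?sqr_ge0// ltW.
Qed.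

(** The increment is the mean of [2 * c] at the position at time [n]; two walks in fields that agree
    down to depth [s] differ only if they have gone deeper. *)
Lemma pot_incr_diff c1 c2 s n x : admissible kap c1 -> admissible kap c2 ->
  (forall y, - s <= lev y -> c1 y = c2 y) ->
  `|(pot c1 n.+1 x - pot c1 n x) - (pot c2 n.+1 x - pot c2 n x)| <= ediscount l lam s x.
Proof.
move=> a1 a2 c12; have e0 y : 0 < ediscount l lam s y by exact: ediscount_gt0.
elim: n x => [|n IH] x; have [xs|xs] := leP (- s) (lev x).
- by rewrite /= /walk_step !gen_cst c12// subrr normr0 ltW.
- have := ediscount_ge1 xs; have /andP[] := pot_incr 0 x a1.
  by have /andP[] := pot_incr 0 x a2; rewrite ler_norml; lra.
- set z := fun y => (pot c1 n.+1 y - pot c1 n y) - (pot c2 n.+1 y - pot c2 n y).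
  have -> : (pot c1 n.+2 x - pot c1 n.+1 x) - (pot c2 n.+2 x - pot c2 n.+1 x) = step c1 z x.
    have -> : step c1 z x = step c1 (pot c1 n.+1) x - step c1 (pot c1 n) x -
       (step c1 (pot c2 n.+1) x - step c1 (pot c2 n) x).
      by rewrite /walk_step /z !genB; ring.
    have E f : step c1 f x = step c2 f x.
      by rewrite /walk_step (@eq_gen_field _ _ l lam c1 c2) ?c12.
    rewrite (E (pot c2 n.+1)) (E (pot c2 n)) -[pot c1 n.+2 x]/(2 * c1 x j + step c1 (pot c1 n.+1) x).
    rewrite -[pot c2 n.+2 x]/(2 * c2 x j + step c2 (pot c2 n.+1) x).
    rewrite -[pot c1 n.+1 x]/(2 * c1 x j + step c1 (pot c1 n) x).
    by rewrite -[pot c2 n.+1 x]/(2 * c2 x j + step c2 (pot c2 n) x) c12//; ring.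
  have up : step c1 z x <= step c1 (ediscount l lam s) x.
    by apply: step_le => // y; apply: le_trans (ler_norm _) _; exact: IH.
  have dn : step c1 (fun y => 0 - ediscount l lam s y) x <= step c1 z x.
    by apply: step_le => // y; rewrite sub0r lerNl; apply: le_trans (IH y); rewrite -normrN ler_norm.
  have gE : gen c1 (fun y => 0 - ediscount l lam s y) x = - gen c1 (ediscount l lam s) x.
    by rewrite genB gen_cst sub0r.
  move: up dn; rewrite /walk_step gE ler_norml.
  by have := gen_ediscount_le0 s x a1; move: (gen c1 z x) (z x) => ? ? ? ? ?; apply/andP; split; lra.
- have := ediscount_ge1 xs; have /andP[] := pot_incr n.+1 x a1.
  by have /andP[] := pot_incr n.+1 x a2; rewrite ler_norml; lra.
Qed.

(** Where the fields agree, the generator of the difference is at least [- ediscount]. As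
    [ediscount] itself decreases at rate [kap * lam ^+ 2 / 4], subtracting [4 / (kap * lam ^+ 2)]
    times it produces a submartingale. *)
Lemma pot_diff_slab c1 c2 s (D : L -> bool) n N x : admissible kap c1 -> admissible kap c2 ->
  (forall y, - s <= lev y -> c1 y = c2 y) -> (forall y, D y -> - s <= lev y) ->
  pot c1 n x - pot c2 n x <=
  stopped c1 D N (fun y => pot c1 n y - pot c2 n y) x
  + 4 / (kap * lam ^+ 2) * ediscount l lam s x.
Proof.
move=> a1 a2 c12 Ds; set C := 4 / _.
have kl : 0 < kap * lam ^+ 2 by rewrite mulr_gt0// exprn_gt0.
have C0 : 0 < C by rewrite divr_gt0.
pose z y := pot c1 n y - pot c2 n y.
have gz y : D y -> - ediscount l lam s y <= gen c1 z y.
  move=> Dy; have := pot_incr_diff n y a1 a2 c12.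
  have e : gen c1 (pot c2 n) y = gen c2 (pot c2 n) y by rewrite (@eq_gen_field _ _ l lam c1 c2) ?c12 ?Ds.
  rewrite /z genB e /= /walk_step c12 ?Ds// ler_norml => /andP[h _].
  by move: h; lra.
have : 1 * z x + (- C) * ediscount l lam s x <=
   stopped c1 D N (fun y => 1 * z y + (- C) * ediscount l lam s y) x.
  apply: (@stopped_sub _ _ l lam l1 lam0 lam1 kap kap0 c1 D N (fun y => 1 * z y + (- C) * ediscount l lam s y)) => // y Dy.
  rewrite gen_lin; have := gz y Dy; have := gen_ediscount l1 lam0 lam1 kap0 s y a1.
  move=> /(ler_wpM2l (ltW C0)).
  have -> : C * (- (kap * lam ^+ 2 / 4) * ediscount l lam s y) = - ediscount l lam s y.
    by rewrite /C; field; rewrite !gt_eqF.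
  by lra.
rewrite stopped_lin.
have : 0 <= stopped c1 D N (ediscount l lam s) x.
  by apply: (stopped_ge0 l1 lam0 lam1 kap0) => // y; exact/ltW/ediscount_gt0.
move=> /(mulr_ge0 (ltW C0)); rewrite -/(z x) -/z; lra.
Qed.

End unit_direction.
End potential.

(** * Bounded random variables and their expectations *)

Section bounded_measurable.
Context dT (T : measurableType dT) (R : realType) (P : probability T R).
Implicit Types (F G : T -> R).

Definition bmeas F := measurable_fun setT F /\ exists M, forall w, `|F w| <= M.

Definition Ex F : R := Rintegral P setT F.

Lemma bmeas_cst (a : R) : bmeas (fun=> a).
Proof. by split; [exact: measurable_cst|exists `|a|]. Qed.

Lemma bmeasD F G : bmeas F -> bmeas G -> bmeas (fun w => F w + G w).
Proof.
move=> [mF [M HM]] [mG [N HN]]; split; first exact: measurable_funD.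
by exists (M + N) => w; apply: le_trans (ler_normD _ _) _; exact: lerD.
Qed.

Lemma bmeasM F G : bmeas F -> bmeas G -> bmeas (fun w => F w * G w).
Proof.
move=> [mF [M HM]] [mG [N HN]]; split; first exact: measurable_funM.
by exists (M * N) => w; rewrite normrM; exact: ler_pM.
Qed.

Lemma bmeasZ (a : R) F : bmeas F -> bmeas (fun w => a * F w).
Proof. by move=> bF; apply: bmeasM => //; exact: bmeas_cst. Qed.

Lemma bmeasB F G : bmeas F -> bmeas G -> bmeas (fun w => F w - G w).
Proof.
move=> bF bG; have := bmeasD bF (bmeasZ (-1) bG).
by under eq_fun do rewrite mulN1r.
Qed.

Lemma bmeas_sum (I : Type) (s : seq I) (F : I -> T -> R) :
  (forall i, bmeas (F i)) -> bmeas (fun w => \sum_(i <- s) F i w).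
Proof.
move=> bF; elim: s => [|i s IH].
  by under eq_fun do rewrite big_nil; exact: bmeas_cst.
by under eq_fun do rewrite big_cons; exact: bmeasD.
Qed.

Lemma bmeas_min F G : bmeas F -> bmeas G -> bmeas (fun w => Num.min (F w) (G w)).
Proof.
move=> [mF [M HM]] [mG [N HN]]; split; first exact: measurable_minr.
exists (M + N) => w; have := HM w; have := HN w.
have := normr_ge0 (F w); have := normr_ge0 (G w).
by rewrite /Num.min; case: ifP => _; lra.
Qed.

Lemma bmeas_integrable F : bmeas F -> P.-integrable setT (EFin \o F).
Proof.
move=> [mF [M HM]]; apply: measurable_bounded_integrable => //.
  by rewrite (le_lt_trans (probability_le1 P measurableT))// ltry.
exists M; split; first exact: num_real.
by move=> x Mx w _; apply: le_trans (HM w) (ltW Mx).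
Qed.

Lemma Ex_cst a : Ex (fun=> a) = a.
Proof. by rewrite /Ex Rintegral_cst//= probability_setT mulr1. Qed.

Lemma ExD F G : bmeas F -> bmeas G -> Ex (fun w => F w + G w) = Ex F + Ex G.
Proof. by move=> bF bG; rewrite /Ex RintegralD//; exact: bmeas_integrable. Qed.

Lemma ExZ a F : bmeas F -> Ex (fun w => a * F w) = a * Ex F.
Proof. by move=> bF; rewrite /Ex RintegralZl//; exact: bmeas_integrable. Qed.

Lemma ExB F G : bmeas F -> bmeas G -> Ex (fun w => F w - G w) = Ex F - Ex G.
Proof. by move=> bF bG; rewrite /Ex RintegralB//; exact: bmeas_integrable. Qed.

Lemma Ex_sum (I : Type) (s : seq I) (F : I -> T -> R) :
  (forall i, bmeas (F i)) -> Ex (fun w => \sum_(i <- s) F i w) = \sum_(i <- s) Ex (F i).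
Proof.
move=> bF; elim: s => [|i s IH].
  by rewrite big_nil -[RHS]Ex_cst; congr Ex; apply/funext => w; rewrite big_nil.
rewrite big_cons -IH -ExD//; last exact: bmeas_sum.
by congr Ex; apply/funext => w; rewrite big_cons.
Qed.

Lemma Ex_le F G : bmeas F -> bmeas G -> (forall w, F w <= G w) -> Ex F <= Ex G.
Proof.
by move=> bF bG FG; rewrite /Ex; apply: le_Rintegral => //; exact: bmeas_integrable.
Qed.

Lemma Ex_ge0 F : bmeas F -> (forall w, 0 <= F w) -> 0 <= Ex F.
Proof. by move=> bF F0; rewrite -[leLHS](Ex_cst 0); apply: Ex_le => //; exact: bmeas_cst. Qed.

End bounded_measurable.

Section random_fields.
Context dT (T : measurableType dT) (R : realType) (d : nat).
Variables (l : 'rV[R]_d) (lam : R).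
Local Notation L := 'rV[int]_d.
Local Notation cfield := (L -> 'I_d -> R).
Variable C : T -> cfield.
Hypothesis mC : forall x i, bmeas (fun w => C w x i).

Lemma bmeas_gen (f : T -> L -> R) x : (forall y, bmeas (fun w => f w y)) ->
  bmeas (fun w => gen l lam (C w) (f w) x).
Proof.
move=> mf; apply: bmeas_sum => i; apply: bmeasM => //.
by apply: bmeasD; apply: bmeasZ; exact: bmeasB.
Qed.

Lemma bmeas_stopped D N (f : L -> R) x : bmeas (fun w => stopped l lam (C w) D N f x).
Proof.
elim: N x => [|N IH] x; first exact: bmeas_cst.
under eq_fun do rewrite stoppedS; case: (D x) => //.
by apply: bmeasD => //; apply: bmeas_gen.
Qed.

Lemma bmeas_pot j n x : bmeas (fun w => pot l lam j (C w) n x).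
Proof.
elim: n x => [|n IH] x /=; first exact: bmeas_cst.
apply: bmeasD; first exact: bmeasZ.
by apply: bmeasD => //; exact: bmeas_gen.
Qed.
End random_fields.

(** * Walks entering fresh half-spaces *)

Section annealed.
Context dT (T : measurableType dT) (R : realType) (d : nat) (P : probability T R).
Variables (l : 'rV[R]_d) (lam kap : R) (j : 'I_d).
Local Notation L := 'rV[int]_d.
Local Notation cfield := (L -> 'I_d -> R).
Local Notation gen := (gen l lam).
Local Notation step := (walk_step l lam).
Local Notation stopped := (stopped l lam).
Local Notation ker := (ker l lam).
Local Notation pot := (pot l lam j).
Local Notation lev := (lev l).
Local Notation Ex := (Ex P).
Local Notation cost := (exit_cost l lam kap).
Implicit Types (c eta : cfield) (x y z : L) (g : T -> R) (D : L -> bool) (C : T -> cfield).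
Hypotheses (l1 : enorm l = 1) (lam0 : 0 < lam) (lam1 : lam <= 1 / 2) (kap0 : 0 < kap).
Variables (cf : T -> cfield) (spl : L -> T -> T -> T) (theta : L -> T -> T).

(* [spl y w' w] is the environment equal to [w] in the half-space of levels at
   least [lev y] and to [w'] below; only the induced fields matter. *)
Hypothesis mcf : forall x i, bmeas (fun w => cf w x i).
Hypothesis acf : forall w, admissible kap (cf w).
Hypothesis cf_spl : forall y w' w x,
  cf (spl y w' w) x = if lev y <= lev x then cf w x else cf w' x.
(** Independence of the two half-spaces, in the form of conditioning on the lower one: [w'] is what
    is frozen, [w] what is averaged. *)
Hypothesis resample : forall y (F G : T -> R), bmeas F -> bmeas G ->
  (forall w', Ex (fun w => F (spl y w' w)) <= G w') -> Ex F <= Ex G.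
Hypothesis cf_theta : forall y w x, cf (theta y w) x = cf w (x + y).
Hypothesis Ex_theta : forall y (F : T -> R), bmeas F -> Ex (fun w => F (theta y w)) = Ex F.

Definition splice (eta c : cfield) : cfield := fun x => if 0 <= lev x then c x else eta x.

Definition exits (D : L -> bool) x N := [seq y <- box x N | ~~ D y].

Definition depends_below r (g : T -> R) := forall w w',
  (forall x, lev x < r -> cf w x = cf w' x) -> g w = g w'.

(* Fields that are those of the environment at nonnegative levels, possibly frozen
   at negative levels. *)
Definition rfield (C : T -> cfield) := [/\ forall x i, bmeas (fun w => C w x i),
  forall w, admissible kap (C w),
  forall y w' w x, 0 <= lev y ->
    C (spl y w' w) x = if lev y <= lev x then cf w x else C w' x &
  forall r w w', (forall x, lev x < r -> cf w x = cf w' x) ->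
    forall x, lev x < r -> C w x = C w' x].

Lemma rfield_id : rfield cf.
Proof. by split. Qed.

Lemma rfield_splice eta : admissible kap eta -> rfield (fun w => splice eta (cf w)).
Proof.
move=> [e1 e2]; split.
- by move=> x i; rewrite /splice; case: (0 <= lev x) => //; exact: bmeas_cst.
- by move=> w; have [a1 a2] := acf w; split=> x; rewrite /splice; case: ifP.
- move=> y w' w x y0; rewrite /splice cf_spl.
  by case: (leP (lev y)) => yx //; rewrite (le_trans y0 yx).
- by move=> r w w' H x xr; rewrite /splice; case: ifP => // _; exact: H.
Qed.

Section horizon.
Variable n : nat.

(* What the walk, entering a new half-space, expects to gain if it has seen [eta]
   behind. *)
Definition Phi (eta : cfield) : R := Ex (fun w => pot (splice eta (cf w)) n 0).

(** Translation by [y] turns the half-space above [y] into the fresh one of [Phi], and all that lies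
    behind into its [eta]. *)
Lemma inner_pot C w' y : rfield C -> 0 <= lev y ->
  Ex (fun w => pot (C (spl y w' w)) n y) = Phi (fun x => C w' (x + y)).
Proof.
move=> [mC aC sC _] y0; rewrite /Phi.
rewrite -[RHS](Ex_theta y); last first.
  apply: bmeas_pot => x i; rewrite /splice; case: (0 <= lev x) => //; exact: bmeas_cst.
congr Ex; apply/funext => w.
rewrite -[y in LHS]add0r pot_shift; apply: pot_local => z _.
by rewrite add0r sC// /splice levD cf_theta lerDr.
Qed.

Lemma admissible_shift c y : admissible kap c -> admissible kap (fun x => c (x + y)).
Proof. by move=> [c1 c2]; split. Qed.

Lemma bmeas_potC C x : rfield C -> bmeas (fun w => pot (C w) n x).
Proof. by move=> [mC _ _ _]; exact: bmeas_pot. Qed.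

Lemma bmeas_ker C D N x y : rfield C -> bmeas (fun w => ker (C w) D N x y).
Proof. by move=> [mC _ _ _]; exact: bmeas_stopped. Qed.

Lemma ker_depends C D N x y r : rfield C -> (forall z, D z -> lev z < r) ->
  depends_below r (fun w => ker (C w) D N x y).
Proof.
move=> [_ _ _ dC] Dr w w' H; apply: stopped_eq_field => z /Dr; exact: dC.
Qed.

Lemma depends_mono r r' g : r <= r' -> depends_below r g -> depends_below r' g.
Proof. by move=> rr dg w w' H; apply: dg => x xr; apply: H; exact: lt_le_trans rr. Qed.

Lemma depends_spl r g y w' w : depends_below r g -> r <= lev y -> g (spl y w' w) = g w'.
Proof.
by move=> dg ry; apply: dg => x xr; rewrite cf_spl leNgt (lt_le_trans xr ry).
Qed.

Section weights.
Variables (r : R) (g : T -> R).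
Hypotheses (bg : bmeas g) (g0 : forall w, 0 <= g w) (dg : depends_below r g).

(** The weight [g], in practice an exit probability at [y], depends only on the environment below
    [y]; it is therefore constant under resampling, and the future of the walk averages to a value
    of [Phi]. *)
Lemma Ex_fresh_le C y M : rfield C -> r <= lev y -> 0 <= lev y ->
  (forall eta, admissible kap eta -> Phi eta <= M) ->
  Ex (fun w => g w * pot (C w) n y) <= M * Ex g.
Proof.
move=> rC ry y0 HM; rewrite -ExZ//; apply: (@resample y).
- by apply: bmeasM => //; exact: bmeas_potC.
- exact: bmeasZ.
move=> w'; rewrite (_ : (fun _ => _) = fun w => g w' * pot (C (spl y w' w)) n y).
  rewrite ExZ; last first.
    by apply: bmeas_pot => x i; have [mC _ sC _] := rC;
      under eq_fun do rewrite sC//; case: (lev y <= lev x); [|exact: bmeas_cst].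
  rewrite inner_pot// mulrC ler_wpM2r//; apply: HM; apply: admissible_shift.
  by have [_ aC _ _] := rC.
by apply/funext => w; rewrite (depends_spl _ _ dg ry).
Qed.

Lemma Ex_fresh_ge C y m : rfield C -> r <= lev y -> 0 <= lev y ->
  (forall eta, admissible kap eta -> m <= Phi eta) ->
  m * Ex g <= Ex (fun w => g w * pot (C w) n y).
Proof.
move=> rC ry y0 Hm; have bF : bmeas (fun w => g w * pot (C w) n y).
  by apply: bmeasM => //; exact: bmeas_potC.
rewrite -lerN2 -mulNr -[leRHS]ExZ// -[leLHS]mulN1r -[leLHS]ExZ//.
apply: (@resample y); try exact: bmeasZ.
move=> w'; rewrite (_ : (fun _ => _) = fun w => (- g w') * pot (C (spl y w' w)) n y).
  rewrite ExZ; last first.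
    by apply: bmeas_pot => x i; have [mC _ sC _] := rC;
      under eq_fun do rewrite sC//; case: (lev y <= lev x); [|exact: bmeas_cst].
  rewrite inner_pot// !mulNr lerN2 mulrC ler_wpM2l//; apply: Hm; apply: admissible_shift.
  by have [_ aC _ _] := rC.
by apply/funext => w; rewrite (depends_spl _ _ dg ry) mulN1r mulNr.
Qed.

(** Fields that agree down to depth [s] agree down to depth [s + lev y] when seen from [y]. *)
Lemma Ex_fresh_diff C1 C2 y s (D : R) : rfield C1 -> rfield C2 -> r <= lev y -> 0 <= lev y ->
  (forall w x, - s <= lev x -> C1 w x = C2 w x) ->
  (forall eta1 eta2, admissible kap eta1 -> admissible kap eta2 ->
     (forall x, - (s + lev y) <= lev x -> eta1 x = eta2 x) -> Phi eta1 - Phi eta2 <= D) ->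
  Ex (fun w => g w * (pot (C1 w) n y - pot (C2 w) n y)) <= D * Ex g.
Proof.
move=> rC1 rC2 ry y0 C12 HD.
have bp C : rfield C -> forall w', bmeas (fun w => pot (C (spl y w' w)) n y).
  move=> rC w'; apply: bmeas_pot => x i; have [mC _ sC _] := rC.
  by under eq_fun do rewrite sC//; case: (lev y <= lev x); [|exact: bmeas_cst].
rewrite -ExZ//; apply: (@resample y).
- by apply: bmeasM => //; apply: bmeasB; exact: bmeas_potC.
- exact: bmeasZ.
move=> w'; rewrite (_ : (fun _ => _) =
    fun w => g w' * (pot (C1 (spl y w' w)) n y - pot (C2 (spl y w' w)) n y)).
  rewrite ExZ; last by apply: bmeasB; exact: bp.
  rewrite ExB; [|exact: bp|exact: bp].
  rewrite !inner_pot// mulrC ler_wpM2r//.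
  have [_ aC1 _ _] := rC1; have [_ aC2 _ _] := rC2.
  apply: HD; [exact: admissible_shift|exact: admissible_shift|move=> x xs].
  by apply: C12; rewrite levD; lra.
by apply/funext => w; rewrite (depends_spl _ _ dg ry).
Qed.
End weights.

Lemma potn_bounds C w x : rfield C -> 0 <= pot (C w) n x <= n%:R.
Proof. by move=> [_ aC _ _]; apply: (pot_bounds _ l1 lam0 lam1 kap0 _ _ (aC w)). Qed.

Lemma stopped_split c D N f x :
  stopped c D N f x = \sum_(y <- exits D x N) ker c D N x y * f y +
    \sum_(y <- box x N | D y) ker c D N x y * f y.
Proof.
by rewrite stopped_ker (bigID D)/= addrC big_filter.
Qed.

Lemma inner_mass c D N f x M Tc : admissible kap c -> (0 < N)%N ->
  (forall z, 0 <= Tc z) -> (forall z, D z -> gen c Tc z <= -1) ->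
  0 <= M -> (forall y, f y <= M) ->
  \sum_(y <- box x N | D y) ker c D N x y * f y <= M * (Tc x / N%:R).
Proof.
move=> ac N0 T0 TD M0 fM; have Nr : 0 < N%:R :> R by rewrite ltr0n.
have ins := stopped_inside l1 lam0 lam1 kap0 N x ac T0 TD.
have {}ins : stopped c D N (fun z => (D z)%:R) x <= Tc x / N%:R by rewrite ler_pdivlMr// mulrC.
apply: le_trans (ler_wpM2l M0 ins).
rewrite stopped_ker mulr_sumr [leRHS](bigID D)/= -[leLHS]addr0; apply: lerD.
  apply: ler_sum => y Dy; rewrite Dy mulr1 mulrC ler_wpM2r//.
  exact: (ker_ge0 l1 lam0 lam1 kap0).
apply: sumr_ge0 => y /negPf Dy; rewrite Dy mulr0 mulr0//.
Qed.

Lemma sum_exits c D N x Tc : admissible kap c -> (0 < N)%N ->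
  (forall z, 0 <= Tc z) -> (forall z, D z -> gen c Tc z <= -1) ->
  1 - Tc x / N%:R <= \sum_(y <- exits D x N) ker c D N x y <= 1.
Proof.
move=> ac N0 T0 TD.
have E : 1 = \sum_(y <- exits D x N) ker c D N x y +
    \sum_(y <- box x N | D y) ker c D N x y :> R.
  by rewrite -[LHS](sum_ker l lam c D N x) (bigID D)/= addrC [in RHS]/exits big_filter.
have h1 : 0 <= \sum_(y <- box x N | D y) ker c D N x y.
  by apply: sumr_ge0 => y _; exact: (ker_ge0 l1 lam0 lam1 kap0).
have h2 : \sum_(y <- box x N | D y) ker c D N x y <= Tc x / N%:R.
  have := @inner_mass c D N (fun=> 1) x 1 Tc ac N0 T0 TD ler01 (fun=> lexx _).
  by under eq_bigr do rewrite mulr1; rewrite mul1r.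
by apply/andP; split; lra.
Qed.

Section runs.
Variables (r : R) (g : T -> R).
Hypotheses (bg : bmeas g) (g0 : forall w, 0 <= g w) (dg : depends_below r g) (r0 : 0 <= r).
Let D : L -> bool := fun x => lev x < r.
(** [pot] is at most [n] and the mass still inside at time [N] at most [cost / N], so that [N > n]
    keeps the loss below one more [cost]. *)
Let N := n.+1.

Let cost_frac x : n%:R * (cost r x / N%:R) <= cost r x.
Proof.
have N0 : 0 < N%:R :> R by rewrite ltr0n.
rewrite mulrCA -[leRHS]mulr1; apply: ler_wpM2l; first exact: exit_cost_ge0.
by rewrite ler_pdivrMr// mul1r ler_nat.
Qed.

Let D_below z : D z -> lev z < r. Proof. by []. Qed.

(** Of the two costs, one is for the time spent before the exit, the other for the mass not yet
    out. *)
Lemma run_up C x M : rfield C -> 0 <= M ->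
  (forall eta, admissible kap eta -> Phi eta <= M) ->
  Ex (fun w => g w * pot (C w) n x) <= (M + 2 * cost r x) * Ex g.
Proof.
move=> rC M0 HM; have [mC aC _ _] := rC.
have T0 := exit_cost_ge0 l lam kap r.
have TD w z : D z -> gen (C w) (cost r) z <= -1.
  by move=> /D_below zr; exact: (gen_exit_cost l1 lam0 kap0 (aC w) zr).
have bk y : bmeas (fun w => g w * ker (C w) D N x y).
  by apply: bmeasM => //; exact: bmeas_ker.
have bp y : bmeas (fun w => pot (C w) n y) by exact: bmeas_potC.
have kg0 w y : 0 <= g w * ker (C w) D N x y.
  by rewrite mulr_ge0// (ker_ge0 l1 lam0 lam1 kap0).
apply: (@le_trans _ _ (Ex (fun w => \sum_(y <- exits D x N) g w * ker (C w) D N x y * pot (C w) n y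
    + 2 * cost r x * g w))).
  apply: Ex_le.
  - exact: bmeasM.
  - by apply: bmeasD; [apply: bmeas_sum => y; exact: bmeasM|exact: bmeasZ].
  move=> w; have := stopped_cost l1 lam0 lam1 kap0 N x (aC w) T0 (TD w)
    (fun z _ => gen_pot j l1 lam0 lam1 kap0 n z (aC w)).
  rewrite ler_norml stopped_split => /andP[h _].
  have := @inner_mass (C w) D N (pot (C w) n) x n%:R (cost r) (aC w) isT T0 (TD w) (ler0n _ _)
    (fun y => proj2 (andP (potn_bounds w y rC))).
  move=> h2; have h3 := le_trans h2 (cost_frac x).
  have -> : \sum_(y <- exits D x N) g w * ker (C w) D N x y * pot (C w) n y =
      g w * \sum_(y <- exits D x N) ker (C w) D N x y * pot (C w) n y.
    by rewrite mulr_sumr; apply: eq_bigr => y _; rewrite mulrA.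
  rewrite [2 * _ * _]mulrC -mulrDr; apply: ler_wpM2l => //.
  by lra.
rewrite ExD; [|by apply: bmeas_sum => y; exact: bmeasM|exact: bmeasZ].
rewrite ExZ// [leRHS]mulrDl lerD2r Ex_sum; last by move=> y; exact: bmeasM.
apply: (@le_trans _ _ (\sum_(y <- exits D x N) M * Ex (fun w => g w * ker (C w) D N x y))).
  rewrite big_seq [leRHS]big_seq; apply: ler_sum => y.
  rewrite mem_filter => /andP[Dy _].
  have ry : r <= lev y by rewrite leNgt.
  apply: (@Ex_fresh_le r) => //; last exact: le_trans ry.
  move=> w w' H; rewrite (dg H); congr (_ * _).
  exact: (ker_depends N x y rC D_below H).
rewrite -mulr_sumr -Ex_sum//; apply: ler_wpM2l => //.
apply: Ex_le => //; first exact: bmeas_sum.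
move=> w; rewrite -mulr_sumr ler_piMr//.
by have /andP[] := @sum_exits (C w) D N x (cost r) (aC w) isT T0 (TD w).
Qed.

Lemma run_lo C x m : rfield C -> 0 <= m <= n%:R ->
  (forall eta, admissible kap eta -> m <= Phi eta) ->
  (m - 2 * cost r x) * Ex g <= Ex (fun w => g w * pot (C w) n x).
Proof.
move=> rC /andP[m0 mn] HM; have [mC aC _ _] := rC.
have T0 := exit_cost_ge0 l lam kap r.
have TD w z : D z -> gen (C w) (cost r) z <= -1.
  by move=> /D_below zr; exact: (gen_exit_cost l1 lam0 kap0 (aC w) zr).
have bk y : bmeas (fun w => g w * ker (C w) D N x y).
  by apply: bmeasM => //; exact: bmeas_ker.
have bp y : bmeas (fun w => pot (C w) n y) by exact: bmeas_potC.
have kg0 w y : 0 <= g w * ker (C w) D N x y.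
  by rewrite mulr_ge0// (ker_ge0 l1 lam0 lam1 kap0).
apply: (@le_trans _ _ (Ex (fun w => \sum_(y <- exits D x N) g w * ker (C w) D N x y * pot (C w) n y
    + (- cost r x) * g w))); last first.
  apply: Ex_le.
  - by apply: bmeasD; [apply: bmeas_sum => y; exact: bmeasM|exact: bmeasZ].
  - exact: bmeasM.
  move=> w; have := stopped_cost l1 lam0 lam1 kap0 N x (aC w) T0 (TD w)
    (fun z _ => gen_pot j l1 lam0 lam1 kap0 n z (aC w)).
  rewrite ler_norml stopped_split => /andP[_ h].
  have h2 : 0 <= \sum_(y <- box x N | D y) ker (C w) D N x y * pot (C w) n y.
    apply: sumr_ge0 => y _; rewrite mulr_ge0//; first exact: (ker_ge0 l1 lam0 lam1 kap0).
    by have /andP[] := potn_bounds w y rC.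
  have -> : \sum_(y <- exits D x N) g w * ker (C w) D N x y * pot (C w) n y =
      g w * \sum_(y <- exits D x N) ker (C w) D N x y * pot (C w) n y.
    by rewrite mulr_sumr; apply: eq_bigr => y _; rewrite mulrA.
  rewrite [- _ * _]mulrC -mulrDr; apply: ler_wpM2l => //.
  by lra.
rewrite ExD; [|by apply: bmeas_sum => y; exact: bmeasM|exact: bmeasZ].
rewrite ExZ// Ex_sum; last by move=> y; exact: bmeasM.
rewrite (_ : m - 2 * cost r x = (m - cost r x) + (- cost r x)); last by ring.
rewrite [leLHS]mulrDl lerD2r.
apply: (@le_trans _ _ (\sum_(y <- exits D x N) m * Ex (fun w => g w * ker (C w) D N x y))); last first.
  rewrite big_seq [leRHS]big_seq; apply: ler_sum => y.
  rewrite mem_filter => /andP[Dy _].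
  have ry : r <= lev y by rewrite leNgt.
  apply: (@Ex_fresh_ge r) => //; last exact: le_trans ry.
  move=> w w' H; rewrite (dg H); congr (_ * _).
  exact: (ker_depends N x y rC D_below H).
rewrite -mulr_sumr -Ex_sum// -!ExZ//; last exact: bmeas_sum.
apply: Ex_le => //; [exact: bmeasZ|by apply: bmeasZ; exact: bmeas_sum|].
move=> w; rewrite -mulr_sumr mulrCA mulrC; apply: ler_wpM2l => //.
have /andP[h _] := @sum_exits (C w) D N x (cost r) (aC w) isT T0 (TD w).
have := ler_wpM2l m0 h; have := cost_frac x.
have : m * (cost r x / N%:R) <= n%:R * (cost r x / N%:R).
  by apply: ler_wpM2r => //; rewrite divr_ge0.
by lra.
Qed.
End runs.

Lemma Phi_bounds eta : admissible kap eta -> 0 <= Phi eta <= n%:R.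
Proof.
move=> ae; have rC := rfield_splice ae; have b := bmeas_potC 0 rC.
apply/andP; split; first by apply: Ex_ge0 => // w; have /andP[] := potn_bounds w 0 rC.
rewrite -[leRHS](Ex_cst P); apply: Ex_le => //; first exact: bmeas_cst.
by move=> w; have /andP[] := potn_bounds w 0 rC.
Qed.

Definition osc (D0 : R) := forall eta1 eta2, admissible kap eta1 -> admissible kap eta2 ->
  Phi eta1 - Phi eta2 <= D0.

Definition osc_depth (s D0 : R) := forall eta1 eta2,
  admissible kap eta1 -> admissible kap eta2 ->
  (forall x, - s <= lev x -> eta1 x = eta2 x) -> Phi eta1 - Phi eta2 <= D0.

(** A common lower end [m] allows the two terms of a difference to be bounded separately. *)
Lemma Phi_range (D0 : R) : osc D0 -> exists m, 0 <= m <= n%:R /\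
  forall eta, admissible kap eta -> m <= Phi eta <= m + D0.
Proof.
move=> HD; pose A := [set Phi eta | eta in [set eta | admissible kap eta]].
have [w0 _] : [set: T] !=set0.
  apply/set0P/eqP => T0; have := probability_setT P; rewrite T0 measure0.
  by move=> /eqP; rewrite eq_sym onee_eq0.
have A0 : A !=set0 by exists (Phi (cf w0)), (cf w0) => //; exact: acf.
have lb : has_lbound A by exists 0 => _ [eta ae <-]; have /andP[] := Phi_bounds ae.
have inf_le eta : admissible kap eta -> inf A <= Phi eta.
  by move=> ae; apply: ge_inf => //; exists eta.
exists (inf A); split=> [|eta ae]; apply/andP; split.
- by apply: lb_le_inf => // _ [eta ae <-]; have /andP[] := Phi_bounds ae.
- by apply: le_trans (inf_le _ (acf w0)) _; have /andP[] := Phi_bounds (acf w0).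
- exact: inf_le.
- rewrite -lerBlDr; apply: lb_le_inf => // _ [eta' ae' <-].
  by have := HD _ _ ae ae'; lra.
Qed.

Let a := lam^-1.
Let a0 : 0 < a. Proof. by rewrite invr_gt0. Qed.
Let kl0 : 0 < 2 * kap * lam. Proof. by rewrite !mulr_gt0. Qed.

(** The walk is run until it leaves the slab between depth [s] and height [a]. At the top the fields
    agree to depth at least [s + a] and the deeper bound applies; at the bottom the whole
    oscillation [D0] and the way back up to [a] are paid, but this exit is unlikely. *)
Lemma osc_depth_step (s D0 A : R) : 0 <= s -> 0 <= A -> 0 <= D0 -> osc D0 ->
  (forall s', s + a <= s' -> osc_depth s' (expR (- (lam / 4 * s')) * D0 + A)) ->
  osc_depth s (expR (- (lam / 4 * s)) *
    (D0 + 4 * ((a + s + 2) / (2 * kap * lam)) + 4 / (kap * lam ^+ 2) + (lam ^+ 2)^-1) + A).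
Proof.
move=> s0 A0 D00 HD Hdeep eta1 eta2 ae1 ae2 eta12.
have [m [/andP[m0 mn] Hm]] := Phi_range HD.
have rC1 := rfield_splice ae1; have rC2 := rfield_splice ae2.
set C1 := fun w => splice eta1 (cf w) in rC1; set C2 := fun w => splice eta2 (cf w) in rC2.
have [mC1 aC1 _ _] := rC1; have [mC2 aC2 _ _] := rC2.
have C12 w x : - s <= lev x -> C1 w x = C2 w x.
  by move=> xs; rewrite /C1 /C2 /splice; case: ifP => // _; exact: eta12.
pose D : L -> bool := fun x => (- s <= lev x) && (lev x < a).
have Da z : D z -> lev z < a by case/andP.
have ed0 y : 0 < ediscount l lam s y by exact: ediscount_gt0.
have edE : ediscount l lam s 0 = expR (- (lam / 4 * s)) by rewrite /ediscount lev0 add0r.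
set es := expR (- (lam / 4 * s)); have es0 : 0 < es by exact: expR_gt0.
have l20 : 0 < lam ^+ 2 by rewrite exprn_gt0.
have T0 := exit_cost_ge0 l lam kap a.
have TD w z : D z -> gen (C1 w) (cost a) z <= -1.
  by move=> /Da zr; exact: (gen_exit_cost l1 lam0 kap0 (aC1 w) zr).
(* The mass still in the slab is made to cost at most [es / lam ^+ 2]; this is the last term in the
   statement. *)
pose N := (Num.bound (n%:R * cost a 0 / (es / lam ^+ 2))).+1.
have NT : n%:R * (cost a 0 / N%:R) <= es / lam ^+ 2.
  have N0 : 0 < N%:R :> R by rewrite ltr0n.
  have e0 : 0 < es / lam ^+ 2 by rewrite divr_gt0.
  rewrite mulrA ler_pdivrMr// [leRHS]mulrC -ler_pdivrMr//.
  have h : 0 <= n%:R * cost a 0 / (es / lam ^+ 2) by rewrite divr_ge0 ?(ltW e0)// mulr_ge0.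
  by apply/ltW/(lt_le_trans (archi_boundP h)); rewrite ler_nat.
pose B := 4 * ((a + s + 2) / (2 * kap * lam)).
have B0 : 0 <= B by rewrite mulr_ge0// divr_ge0 ?(ltW kl0)//; have := a0; lra.
pose z w y := pot (C1 w) n y - pot (C2 w) n y.
have bk y : bmeas (fun w => ker (C1 w) D N 0 y) by exact: bmeas_ker.
have bz y : bmeas (fun w => z w y) by apply: bmeasB; exact: bmeas_potC.
have k0 w y : 0 <= ker (C1 w) D N 0 y by exact: (ker_ge0 l1 lam0 lam1 kap0).
have dk y : depends_below a (fun w => ker (C1 w) D N 0 y) by exact: (ker_depends N 0 y rC1 Da).
have E1 : Phi eta1 - Phi eta2 = Ex (fun w => z w 0).
  by rewrite ExB//; exact: bmeas_potC.
have bS : bmeas (fun w => \sum_(y <- exits D 0 N) ker (C1 w) D N 0 y * z w y).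
  by apply: bmeas_sum => y; exact: bmeasM.
have E2 : Ex (fun w => z w 0) <=
    Ex (fun w => \sum_(y <- exits D 0 N) ker (C1 w) D N 0 y * z w y) +
    (es / lam ^+ 2 + 4 / (kap * lam ^+ 2) * es).
  rewrite -[X in _ + X](Ex_cst P) -ExD//; last exact: bmeas_cst.
  apply: Ex_le => //; first by apply: bmeasD => //; exact: bmeas_cst.
  move=> w; have := @pot_diff_slab _ _ l lam j l1 lam0 lam1 kap kap0 _ _ s D n N 0 (aC1 w) (aC2 w)
    (C12 w) (fun y Dy => proj1 (andP Dy)).
  rewrite stopped_split edE -/es.
  have zn y : z w y <= n%:R.
    have /andP[_ h1] := potn_bounds w y rC1; have /andP[h2 _] := potn_bounds w y rC2.
    by rewrite /z; lra.
  have := @inner_mass (C1 w) D N (z w) 0 n%:R (cost a) (aC1 w) isT T0 (TD w) (ler0n _ _) zn.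
  by rewrite /z; lra.
have exit_bound y : y \in exits D 0 N -> Ex (fun w => ker (C1 w) D N 0 y * z w y) <=
    (ediscount l lam s y * (D0 + B) + A) * Ex (fun w => ker (C1 w) D N 0 y).
  rewrite mem_filter => /andP[Dy _].
  have Ek : 0 <= Ex (fun w => ker (C1 w) D N 0 y) by exact: Ex_ge0.
  have [ya|ya] := leP a (lev y).
    apply: le_trans (@Ex_fresh_diff a _ (bk y) (k0^~ y) (dk y) C1 C2 y s
      (expR (- (lam / 4 * (s + lev y))) * D0 + A) rC1 rC2 ya _ C12 _) _.
    - by apply: le_trans ya; exact: ltW.
    - by apply: Hdeep; rewrite lerD2l.
    rewrite ler_wpM2r// lerD2r.
    (* The bound assumed at depth [s + lev y] is the value of the supermartingale at the exit point.
       Its mean is at most its value at 0, so the factor [D0] returns multiplied by [es], without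
       loss. *)
    have -> : expR (- (lam / 4 * (s + lev y))) = ediscount l lam s y.
      by rewrite /ediscount addrC.
    by rewrite ler_pM2l// lerDl.
  have ys : lev y < - s by move: Dy; rewrite /D ya andbT -ltNge.
  (* A step changes the level by at most 1, so no exit takes place below [- s - 1]. *)
  have [ym|ym] := leP (- s - 1) (lev y); last first.
    have kz w : ker (C1 w) D N 0 y = 0.
      apply: (@ker_eq0 _ _ _ _ l1 lam0 lam1 kap kap0 (fun z => - s - 1 <= lev z)) => //.
      - by move=> x _ /andP[xs _] i; have [_ [_ [h3 h4]]] := lev_nbr l1 x i; split; lra.
      - by rewrite lev0; lra.
      - by apply/negP; rewrite -ltNge.
    under eq_fun do rewrite kz mul0r; under [X in _ * Ex X]eq_fun do rewrite kz.
    by rewrite Ex_cst mulr0.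
  have up := @run_up a _ (bk y) (k0^~ y) (dk y) (ltW a0) C1 y (m + D0) rC1 (addr_ge0 m0 D00)
    (fun eta ae => proj2 (andP (Hm eta ae))).
  have lo := @run_lo a _ (bk y) (k0^~ y) (dk y) (ltW a0) C2 y m rC2.
  have {}lo := lo (introT andP (conj m0 mn)) (fun eta ae => proj1 (andP (Hm eta ae))).
  have -> : Ex (fun w => ker (C1 w) D N 0 y * z w y) =
      Ex (fun w => ker (C1 w) D N 0 y * pot (C1 w) n y) - Ex (fun w => ker (C1 w) D N 0 y * pot (C2 w) n y).
    rewrite -ExB; [|apply: bmeasM => //; exact: bmeas_potC..].
    by congr Ex; apply/funext => w; rewrite /z mulrBr.
  apply: (@le_trans _ _ ((D0 + 4 * cost a y) * Ex (fun w => ker (C1 w) D N 0 y))); first by lra.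
  apply: ler_wpM2r => //.
  have ge1 := ediscount_ge1 lam0 ys.
  have cB : 4 * cost a y <= B.
    rewrite exit_costE//; last by have := a0; lra.
    rewrite /B ler_pM2l// ler_pM2r ?invr_gt0//; lra.
  have := ler_wpM2r (addr_ge0 D00 B0) ge1; rewrite mul1r.
  lra.
have E3 : Ex (fun w => \sum_(y <- exits D 0 N) ker (C1 w) D N 0 y * z w y) <= es * (D0 + B) + A.
  rewrite Ex_sum; last by move=> y; exact: bmeasM.
  apply: (@le_trans _ _ (\sum_(y <- exits D 0 N) (ediscount l lam s y * (D0 + B) + A) *
     Ex (fun w => ker (C1 w) D N 0 y))).
    by rewrite big_seq [leRHS]big_seq; apply: ler_sum => y yN; exact: exit_bound.
  rewrite (eq_bigr (fun y => Ex (fun w => (ediscount l lam s y * (D0 + B) + A) * ker (C1 w) D N 0 y)));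
    last by move=> y _; rewrite ExZ.
  rewrite -Ex_sum; last by move=> y; exact: bmeasZ.
  rewrite -[leRHS](Ex_cst P); apply: Ex_le.
  - by apply: bmeas_sum => y; exact: bmeasZ.
  - exact: bmeas_cst.
  move=> w; rewrite (eq_bigr (fun y => (D0 + B) * (ker (C1 w) D N 0 y * ediscount l lam s y)
    + A * ker (C1 w) D N 0 y)); last by move=> y _; ring.
  rewrite big_split/= -!mulr_sumr; apply: lerD.
    rewrite mulrC; apply: ler_wpM2r; first exact: addr_ge0.
    have := @stopped_super _ _ l lam l1 lam0 lam1 kap kap0 (C1 w) D N (ediscount l lam s) 0 (aC1 w)
      (fun y _ => gen_ediscount_le0 l1 lam0 lam1 kap0 s y (aC1 w)).
    rewrite stopped_split edE -/es; apply: le_trans; rewrite lerDl.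
    by apply: sumr_ge0 => y _; rewrite mulr_ge0// ltW.
  rewrite ler_piMr//.
  by have /andP[] := @sum_exits (C1 w) D N 0 (cost a) (aC1 w) isT T0 (TD w).
by rewrite E1 -/B; move: E2 E3; lra.
Qed.

Section contraction.
Hypotheses (d2 : (2 <= d)%N) (kap1 : kap <= 1) (lamS : lam * ov_scale d kap <= 1).

Let below : L -> bool := fun x => lev x < a.

(** In [overlap], [S] is taken to be the set where the first exit law is the smaller one; its
    complement then receives the second law where that one is smaller. *)
Lemma overlap_min : exists N0 : nat, forall N, (N0 <= N)%N -> forall c1 c2,
  admissible kap c1 -> admissible kap c2 -> (forall x, 0 <= lev x -> c1 x = c2 x) ->
  ov_gain d kap / 2 <=
  \sum_(y <- exits below 0 N) Num.min (ker c1 below N 0 y) (ker c2 below N 0 y).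
Proof.
have [N0 H] := overlap d2 kap0 kap1 l1 lam0 lamS; exists N0 => N NN c1 c2 ac1 ac2 c12.
have := H N NN c1 c2 (fun y => ker c1 below N 0 y <= ker c2 below N 0 y) ac1 ac2 c12.
move=> /le_trans; apply; rewrite !stopped_split -/below.
rewrite [X in _ + X + _]big1 ?addr0; last by move=> y By; have Ey : lev y < lam^-1 := By; rewrite /= Ey mulr0.
rewrite [X in _ + (_ + X)]big1 ?addr0; last by move=> y By; have Ey : lev y < lam^-1 := By; rewrite /= Ey mulr0.
rewrite -big_split/= big_seq [leRHS]big_seq; apply: ler_sum => y.
rewrite mem_filter => /andP[By _]; have Ey : ~~ (lev y < lam^-1) := By; rewrite /= Ey/=.
by case: (leP (ker c1 below N 0 y)) => /= _; rewrite mulr1 mulr0 ?addr0 ?add0r.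
Qed.

(* The exit laws of the walks in the two fields overlap by a fixed amount; on the
   common part the two continuations start from the same point with the same
   environment down to depth [a], and differ by [D1] only. *)
Lemma osc_contraction (D0 D1 : R) : 0 <= D1 -> D1 <= D0 -> osc D0 ->
  (forall s, a <= s -> osc_depth s D1) ->
  osc (D0 - ov_gain d kap / 2 * (D0 - D1) + 4 * cost a 0).
Proof.
move=> D10 D01 HD Hd eta1 eta2 ae1 ae2.
have [m [/andP[m0 mn] Hm]] := Phi_range HD.
have rC1 := rfield_splice ae1; have rC2 := rfield_splice ae2.
set C1 := fun w => splice eta1 (cf w) in rC1; set C2 := fun w => splice eta2 (cf w) in rC2.
have [mC1 aC1 _ _] := rC1; have [mC2 aC2 _ _] := rC2.
have C12 w x : 0 <= lev x -> C1 w x = C2 w x.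
  by move=> xs; rewrite /C1 /C2 /splice xs.
have [N0 HN0] := overlap_min.
pose N := (n + N0).+1.
have NN0 : (N0 <= N)%N by rewrite leqW// leq_addl.
have T0 := exit_cost_ge0 l lam kap a.
have TD C w z : rfield C -> below z -> gen (C w) (cost a) z <= -1.
  by move=> [_ aC _ _] zr; exact: (gen_exit_cost l1 lam0 kap0 (aC w) zr).
have NT M : 0 <= M <= n%:R -> M * (cost a 0 / N%:R) <= cost a 0.
  have Nr : 0 < N%:R :> R by rewrite ltr0n.
  move=> /andP[M0 Mn]; rewrite mulrCA -[leRHS]mulr1; apply: ler_wpM2l => //.
  rewrite ler_pdivrMr// mul1r; apply: le_trans Mn _.
  by rewrite ler_nat leqW// leq_addr.
pose q1 w y := ker (C1 w) below N 0 y; pose q2 w y := ker (C2 w) below N 0 y.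
pose mu w y := Num.min (q1 w y) (q2 w y).
have bq1 y : bmeas (fun w => q1 w y) by exact: bmeas_ker.
have bq2 y : bmeas (fun w => q2 w y) by exact: bmeas_ker.
have bmu y : bmeas (fun w => mu w y) by exact: bmeas_min.
have bp1 y : bmeas (fun w => pot (C1 w) n y) by exact: bmeas_potC.
have bp2 y : bmeas (fun w => pot (C2 w) n y) by exact: bmeas_potC.
have q10 w y : 0 <= q1 w y by exact: (ker_ge0 l1 lam0 lam1 kap0).
have q20 w y : 0 <= q2 w y by exact: (ker_ge0 l1 lam0 lam1 kap0).
have mu0 w y : 0 <= mu w y by rewrite le_min q10 q20.
have mu1 w y : 0 <= q1 w y - mu w y by rewrite subr_ge0 ge_min lexx.
have mu2 w y : 0 <= q2 w y - mu w y by rewrite subr_ge0 ge_min lexx orbT.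
have dq1 y : depends_below a (fun w => q1 w y) by exact: (ker_depends N 0 y rC1).
have dq2 y : depends_below a (fun w => q2 w y) by exact: (ker_depends N 0 y rC2).
have dmu y : depends_below a (fun w => mu w y).
  by move=> w w' H; rewrite /mu (dq1 y w w' H) (dq2 y w w' H).
have E1 : Phi eta1 - Phi eta2 = Ex (fun w => pot (C1 w) n 0 - pot (C2 w) n 0) by rewrite ExB.
(* Common part of the exit laws, then the excess of each: the first excess is valued at most
   [m + D0], the second at least [m]. *)
pose F y w := mu w y * (pot (C1 w) n y - pot (C2 w) n y) + (q1 w y - mu w y) * pot (C1 w) n y
   - (q2 w y - mu w y) * pot (C2 w) n y.
have bF y : bmeas (F y).
  by apply: bmeasB; [apply: bmeasD|]; apply: bmeasM => //; exact: bmeasB.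
have E2 : Phi eta1 - Phi eta2 <= \sum_(y <- exits below 0 N) Ex (F y) + 3 * cost a 0.
  rewrite E1 -Ex_sum// -[X in _ + X](Ex_cst P) -ExD; [|exact: bmeas_sum|exact: bmeas_cst].
  apply: Ex_le; [exact: bmeasB|apply: bmeasD; [exact: bmeas_sum|exact: bmeas_cst]|].
  move=> w; rewrite /F.
  have h1 := stopped_cost l1 lam0 lam1 kap0 N 0 (aC1 w) T0 (fun z => TD _ w z rC1)
    (fun z _ => gen_pot j l1 lam0 lam1 kap0 n z (aC1 w)).
  have h2 := stopped_cost l1 lam0 lam1 kap0 N 0 (aC2 w) T0 (fun z => TD _ w z rC2)
    (fun z _ => gen_pot j l1 lam0 lam1 kap0 n z (aC2 w)).
  move: h1 h2; rewrite !ler_norml !stopped_split => /andP[h1 _] /andP[_ h2].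
  have i1 := @inner_mass (C1 w) below N (pot (C1 w) n) 0 n%:R (cost a) (aC1 w) isT T0
    (fun z => TD _ w z rC1) (ler0n _ _) (fun y => proj2 (andP (potn_bounds w y rC1))).
  have i2 : 0 <= \sum_(y <- box 0 N | below y) ker (C2 w) below N 0 y * pot (C2 w) n y.
    apply: sumr_ge0 => y _; rewrite mulr_ge0//; first exact: (ker_ge0 l1 lam0 lam1 kap0).
    by have /andP[] := potn_bounds w y rC2.
  have i3 : n%:R * (cost a 0 / N%:R) <= cost a 0 by apply: NT; rewrite ler0n lexx.
  rewrite (eq_bigr (fun y => q1 w y * pot (C1 w) n y - q2 w y * pot (C2 w) n y)); last first.
    by move=> y _; ring.
  by rewrite sumrB /q1 /q2; lra.
have E3 y : y \in exits below 0 N -> Ex (F y) <= D1 * Ex (fun w => mu w y) +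
    (m + D0) * (Ex (fun w => q1 w y) - Ex (fun w => mu w y))
    - m * (Ex (fun w => q2 w y) - Ex (fun w => mu w y)).
  rewrite mem_filter => /andP[By _].
  have ya : a <= lev y by rewrite leNgt.
  have y0 : 0 <= lev y by apply: le_trans ya; exact: ltW.
  rewrite /F ExB; [|by apply: bmeasD; apply: bmeasM => //; exact: bmeasB|
     by apply: bmeasM => //; exact: bmeasB].
  rewrite ExD; [|by apply: bmeasM => //; exact: bmeasB..].
  rewrite -!ExB//; apply: lerB; first apply: lerD.
  - apply: (@Ex_fresh_diff a _ (bmu y) (mu0^~ y) (dmu y) C1 C2 y 0) => //.
      by move=> w x; rewrite oppr0; exact: C12.
    by rewrite add0r; exact: Hd.
  - apply: (@Ex_fresh_le a) => //.
    + exact: bmeasB.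
    + by move=> w w' H; rewrite (dq1 y w w' H) (dmu y w w' H).
    + by move=> eta /Hm /andP[].
  - apply: (@Ex_fresh_ge a) => //.
    + exact: bmeasB.
    + by move=> w w' H; rewrite (dq2 y w w' H) (dmu y w w' H).
    + by move=> eta /Hm /andP[].
have E4 : \sum_(y <- exits below 0 N) Ex (F y) <=
    D1 * Ex (fun w => \sum_(y <- exits below 0 N) mu w y) +
    (m + D0) * (Ex (fun w => \sum_(y <- exits below 0 N) q1 w y)
      - Ex (fun w => \sum_(y <- exits below 0 N) mu w y))
    - m * (Ex (fun w => \sum_(y <- exits below 0 N) q2 w y)
      - Ex (fun w => \sum_(y <- exits below 0 N) mu w y)).
  rewrite !Ex_sum// -!sumrB !mulr_sumr -big_split -sumrB/=.
  by rewrite big_seq [leRHS]big_seq; apply: ler_sum => y yN; exact: E3.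
have s1 : Ex (fun w => \sum_(y <- exits below 0 N) q1 w y) <= 1.
  rewrite -[leRHS](Ex_cst P); apply: Ex_le; [exact: bmeas_sum|exact: bmeas_cst|move=> w].
  by have /andP[] := @sum_exits (C1 w) below N 0 (cost a) (aC1 w) isT T0 (fun z => TD _ w z rC1).
have s2 : 1 - cost a 0 / N%:R <= Ex (fun w => \sum_(y <- exits below 0 N) q2 w y).
  rewrite -[leLHS](Ex_cst P); apply: Ex_le; [exact: bmeas_cst|exact: bmeas_sum|move=> w].
  by have /andP[] := @sum_exits (C2 w) below N 0 (cost a) (aC2 w) isT T0 (fun z => TD _ w z rC2).
have s3 : ov_gain d kap / 2 <= Ex (fun w => \sum_(y <- exits below 0 N) mu w y).
  rewrite -[leLHS](Ex_cst P); apply: Ex_le; [exact: bmeas_cst|exact: bmeas_sum|move=> w].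
  by apply: HN0 => //; exact: C12.
have s4 : m * (cost a 0 / N%:R) <= cost a 0 by apply: NT; rewrite m0 mn.
move: E2 E4 s1 s2 s3; set X1 := Ex _; set X2 := Ex _; set X3 := Ex _ => E2 E4 s1 s2 s3.
(* [m] multiplies only the difference of the two exit masses, which is at most [cost a 0 / N]
   although [m] may be as large as [n]. *)
have f1 : m * (X2 - X3) <= m * (cost a 0 / N%:R).
  by apply: ler_wpM2l => //; lra.
have D00 : 0 <= D0 by exact: le_trans D10 D01.
have f2 : D0 * X2 <= D0 * 1 by exact: ler_wpM2l.
have f3 : (D0 - D1) * (ov_gain d kap / 2) <= (D0 - D1) * X1 by apply: ler_wpM2l => //; lra.
by lra.
Qed.

(** [25] bounds [x * (9 + 16 * u)] for [x = expR (- u)] and [0 <= u]; [9] sums a geometric series of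
    ratio at most [8 / 9], a bound for [expR (- (1 / 8))]. *)
Let decay_cst : R := 9 * 25 / kap.

Let osc_depth_mono s (A B : R) : A <= B -> osc_depth s A -> osc_depth s B.
Proof. by move=> AB H e1 e2 a1 a2 e12; apply: le_trans AB; exact: H. Qed.

(** The coefficient grows linearly in [s]: half of the rate [lam / 4] is spent to absorb this
    growth, and the rate [lam / 8] is kept. *)
Let numeric_decay s : 0 <= s ->
  expR (- (lam / 4 * s)) * (4 * ((a + s + 2) / (2 * kap * lam)) + 4 / (kap * lam ^+ 2)
    + (lam ^+ 2)^-1) + decay_cst / lam ^+ 2 * expR (- (lam / 8 * (s + a))) <=
  decay_cst / lam ^+ 2 * expR (- (lam / 8 * s)).
Proof.
move=> s0; have hl := lam0; have hl1 := lam1; have hk := kap0; have hk1 := kap1.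
set u := lam / 8 * s; set x := expR (- u).
have u0 : 0 <= u by rewrite mulr_ge0// divr_ge0// ltW.
have x0 : 0 < x by exact: expR_gt0.
have x1 : x <= 1 by rewrite /x -expR0 ler_expR; lra.
have xu : x * u <= 1.
  rewrite -(expR0 R) -(subrr u) addrC expRD -/x; apply: ler_wpM2l; first exact: ltW.
  by have := expR_ge1Dx u; lra.
have -> : expR (- (lam / 4 * s)) = x * x by rewrite /x -expRD; congr expR; rewrite /u; field.
have -> : expR (- (lam / 8 * (s + a))) = x * expR (- (1 / 8)).
  rewrite /x -expRD; congr expR; rewrite /u /a; field.
  by rewrite gt_eqF.
have e8 : expR (- (1 / 8)) <= 8 / 9 :> R.
  rewrite expRN -[leRHS]invrK lef_pV2 ?posrE ?expR_gt0 ?invr_gt0//.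
  by apply: le_trans (expR_ge1Dx _); rewrite invf_div; lra.
have P0 : 0 < (lam ^+ 2)^-1 by rewrite invr_gt0 exprn_gt0.
have k1 : 1 <= kap^-1 by rewrite invf_ge1.
set p := (lam ^+ 2)^-1 in P0 *.
have -> : 4 * ((a + s + 2) / (2 * kap * lam)) = p * kap^-1 * (2 + 16 * u + 4 * lam).
  by rewrite /p /u /a; field; rewrite !gt_eqF.
have -> : 4 / (kap * lam ^+ 2) = p * kap^-1 * 4 by rewrite /p; field; rewrite !gt_eqF.
have -> : decay_cst = 9 * 25 * kap^-1 by [].
rewrite -/p.
have pk0 : 0 < p * kap^-1 by rewrite mulr_gt0// invr_gt0.
have h1 : p <= p * kap^-1 by rewrite ler_peMr// ltW.
have h2 : x * x * (p * kap^-1 * (2 + 16 * u + 4 * lam) + p * kap^-1 * 4 + p) <=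
    x * x * (p * kap^-1 * (9 + 16 * u)).
  apply: ler_wpM2l; first by rewrite mulr_ge0 ?ltW.
  have : p * kap^-1 * (4 * lam) <= p * kap^-1 * 2 by apply: ler_wpM2l; [exact: ltW|lra].
  by lra.
have h3 : x * x * (p * kap^-1 * (9 + 16 * u)) <= x * (p * kap^-1 * 25).
  rewrite -mulrA; apply: ler_wpM2l; first exact: ltW.
  rewrite mulrCA; apply: ler_wpM2l; first exact: ltW.
  by lra.
have h4 : 9 * 25 * kap^-1 * p * (x * expR (- (1 / 8))) <= 9 * 25 * kap^-1 * p * (x * (8 / 9)).
  apply: ler_wpM2l; last by apply: ler_wpM2l => //; exact: ltW.
  by move: pk0; lra.
by lra.
Qed.

(* Downward induction on [s], starting from depths that [n] steps cannot reach. *)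
Lemma osc_depth_decay (D0 : R) : 0 <= D0 -> osc D0 -> forall s, 0 <= s ->
  osc_depth s (expR (- (lam / 4 * s)) * D0 + decay_cst / lam ^+ 2 * expR (- (lam / 8 * s))).
Proof.
move=> D00 HD.
have C0 : 0 <= decay_cst / lam ^+ 2.
  by rewrite divr_ge0 ?exprn_ge0 ?(ltW lam0)// divr_ge0// ltW.
(* Within [n] steps the level stays at least [- d * n], where the two fields coincide. *)
have base s : 0 <= s -> d%:R * n%:R <= s ->
  osc_depth s (expR (- (lam / 4 * s)) * D0 + decay_cst / lam ^+ 2 * expR (- (lam / 8 * s))).
  move=> s0 sn eta1 eta2 ae1 ae2 e12.
  have -> : Phi eta1 = Phi eta2.
    congr Ex; apply/funext => w; apply: pot_local => y yb; rewrite /splice; case: ifP => // _.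
    apply: e12; have := @lev_dist _ _ l l1 y 0 n%:R (fun i => box_coord R i yb).
    by rewrite lev0 subr0 ler_norml => /andP[h _]; apply: le_trans h; rewrite lerN2.
  rewrite subrr addr_ge0// mulr_ge0//; exact/ltW/expR_gt0.
suff H : forall k s, 0 <= s -> d%:R * n%:R <= s + k%:R * a ->
  osc_depth s (expR (- (lam / 4 * s)) * D0 + decay_cst / lam ^+ 2 * expR (- (lam / 8 * s))).
  move=> s s0; apply: (H (Num.bound (d%:R * n%:R / a))) => //.
  have h : 0 <= d%:R * n%:R / a by rewrite divr_ge0 ?mulr_ge0// ltW.
  have := archi_boundP h; rewrite ltr_pdivrMr// => /ltW h2.
  by apply: le_trans h2 _; rewrite lerDr.
elim=> [s s0|k IH s s0 sk]; first by rewrite mul0r addr0; exact: base.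
pose A := decay_cst / lam ^+ 2 * expR (- (lam / 8 * (s + a))).
have A0 : 0 <= A by rewrite mulr_ge0//; exact/ltW/expR_gt0.
have a00 := a0.
apply: osc_depth_mono (@osc_depth_step s D0 A s0 A0 D00 HD _).
  have := numeric_decay s0; rewrite /A; lra.
move=> s' ss'.
have s'0 : 0 <= s' by lra.
have s'k : d%:R * n%:R <= s' + k%:R * a by move: sk; rewrite -natr1 mulrDl mul1r; lra.
apply: osc_depth_mono (IH s' s'0 s'k).
rewrite lerD2l; apply: ler_wpM2l => //.
by rewrite ler_expR lerN2 ler_pM2l// divr_gt0.
Qed.

(** The factor 5 solves [S <= 4 / 5 * S + ...], where [4 / 5] bounds [expR (- (1 / 4))], the
    discount at depth [a]; the two terms come from the decay and from the contraction. *)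
Definition osc_cst (d0 : nat) (k : R) : R := 5 * (9 * 25 / k + 8 / (k * ov_gain d0 k)).

Lemma cost0_le : cost a 0 <= (kap * lam ^+ 2)^-1.
Proof.
have hl1 := lam1; rewrite exit_costE//; last by rewrite lev0; have := a0; lra.
rewrite lev0 subr0 /a.
have -> : (lam^-1 + 1) / (2 * kap * lam) = (1 + lam) / 2 * (kap * lam ^+ 2)^-1.
  by field; rewrite !gt_eqF.
rewrite ler_piMl//; last by lra.
by rewrite invr_ge0 mulr_ge0 ?exprn_ge0 ?ltW.
Qed.

(** The least possible constant [S] is finite because [Phi] lies between 0 and [n]. Inserted in the
    decay at depth [a], then in the contraction, it satisfies an inequality from which [n] has
    disappeared. *)
Lemma osc_bound : osc (osc_cst d kap / lam ^+ 2).
Proof.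
have ga := ov_gain_gt0 d2 kap0 kap1; have hk := kap0.
pose A := [set r | exists eta1 eta2, [/\ admissible kap eta1, admissible kap eta2 &
  r = Phi eta1 - Phi eta2]].
have [w0 _] : [set: T] !=set0.
  apply/set0P/eqP => T0; have := probability_setT P; rewrite T0 measure0.
  by move=> /eqP; rewrite eq_sym onee_eq0.
have A0 : A 0 by exists (cf w0), (cf w0); split=> //; rewrite subrr.
have supA : has_sup A.
  split; first by exists 0.
  exists n%:R => _ [e1 [e2 [a1 a2 ->]]].
  have /andP[_ h1] := Phi_bounds a1; have /andP[h2 _] := Phi_bounds a2; lra.
pose S := sup A.
have HS : osc S.
  by move=> e1 e2 a1 a2; apply: ub_le_sup; [case: supA|exists e1, e2].
have S0 : 0 <= S by apply: ub_le_sup; [case: supA|].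
have least (D0 : R) : osc D0 -> S <= D0.
  move=> HD; apply: ge_sup; first by exists 0.
  by move=> _ [e1 [e2 [a1 a2 ->]]]; exact: HD.
suff SB : S <= osc_cst d kap / lam ^+ 2.
  by move=> e1 e2 a1 a2; apply: le_trans SB; exact: HS.
set p := (lam ^+ 2)^-1.
have P0 : 0 < p by rewrite invr_gt0 exprn_gt0.
have C0 : 0 < decay_cst by rewrite divr_gt0.
pose D1 := 4 / 5 * S + decay_cst * p.
have Hd s : a <= s -> osc_depth s D1.
  move=> as_; have s0 : 0 <= s by apply: le_trans as_; exact: ltW.
  apply: osc_depth_mono (osc_depth_decay S0 HS s0); apply: lerD.
    apply: ler_wpM2r => //; rewrite expRN -[leRHS]invrK lef_pV2 ?posrE ?expR_gt0 ?invr_gt0//.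
    apply: le_trans (expR_ge1Dx _); rewrite invf_div.
    have : lam / 4 * a <= lam / 4 * s by rewrite ler_pM2l// divr_gt0.
    have -> : lam / 4 * a = 1 / 4 by rewrite /a; field; rewrite gt_eqF.
    by lra.
  rewrite -[leRHS]mulr1 -/p; apply: ler_wpM2l; first by apply: mulr_ge0; exact: ltW.
  by rewrite -expR0 ler_expR oppr_le0 mulr_ge0// divr_ge0// ltW.
have D10 : 0 <= D1 by have := mulr_ge0 (ltW C0) (ltW P0); rewrite /D1; lra.
have q0 : 0 < 8 / (kap * ov_gain d kap) * p by rewrite mulr_gt0// divr_gt0// mulr_gt0.
rewrite /osc_cst -/p -/decay_cst.
have [DS|SD] := leP D1 S; last first.
  have : 0 < decay_cst * p by rewrite mulr_gt0.
  by move: SD; rewrite /D1; lra.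
have := least _ (osc_contraction D10 DS HS Hd).
have := cost0_le; rewrite invfM -/p => cl.
move=> h; have {}h : ov_gain d kap / 2 * (S - D1) <= 4 * (kap^-1 * p) by lra.
have {}h : S - D1 <= 8 / (kap * ov_gain d kap) * p.
  rewrite -(@ler_pM2l _ (ov_gain d kap / 2)); last by rewrite divr_gt0.
  apply: le_trans h _; rewrite le_eqVlt; apply/orP; left; apply/eqP.
  by field; rewrite !gt_eqF.
by move: h; rewrite /D1; lra.
Qed.

End contraction.

(* The potential gained between the times [m] and [m + n]. *)
Definition shifted_pot m (c : cfield) : L -> R := iter m (step c) (pot c n).

Lemma bmeas_shifted_pot m x : bmeas (fun w => shifted_pot m (cf w) x).
Proof.
elim: m x => [|m IH] x; first exact: bmeas_pot.
apply: bmeasD; first exact: IH.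
exact: (@bmeas_gen _ _ _ _ l lam cf mcf (fun w => shifted_pot m (cf w))).
Qed.

Section annealed_markov.
Variables (m0 M0 sb : R).
Hypotheses (sb0 : 0 < sb) (m00 : 0 <= m0 <= n%:R) (M00 : 0 <= M0).
Hypotheses (HM : forall eta, admissible kap eta -> m0 <= Phi eta <= M0).

(** Twice the exit cost of a gap [k] is [(kap * lam)^-1 * (1 + k)], and [k] is at most
    [(sb + k ^+ 2 / sb) / 2]. Squaring makes the error computable along the walk: each step adds at
    most 2 to the squared gap, 1 for the step itself and 1 for moving [r]. *)
Let err (k : R) (m : nat) : R := (kap * lam)^-1 * (1 + (sb + (k ^+ 2 + 2 * m%:R) / sb) / 2).

(** After a step to [y] the reference level is raised, if necessary, to keep a margin of 1 above the
    walk. *)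
Let nbr_term (p : T -> R) (r : R) m x y :
  (forall r g x, bmeas g -> (forall w, 0 <= g w) -> depends_below r g -> 1 <= r -> lev x <= r - 1 ->
    (m0 - err (r - lev x) m) * Ex g <= Ex (fun w => g w * shifted_pot m (cf w) x)
       <= (M0 + err (r - lev x) m) * Ex g) ->
  bmeas p -> (forall w, 0 <= p w) -> depends_below r p -> 1 <= r -> lev y <= r ->
  forall e, e = (kap * lam)^-1 * (1 + (sb + ((r - lev y) ^+ 2 + 1 + 2 * m%:R) / sb) / 2) ->
  (m0 - e) * Ex p <= Ex (fun w => p w * shifted_pot m (cf w) y) <= (M0 + e) * Ex p.
Proof.
move=> IH bp p0 dp r1 yr e eE.
pose r' := Num.max r (lev y + 1).
have rr' : r <= r' by rewrite le_max lexx.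
have /andP[lo up] : (m0 - err (r' - lev y) m) * Ex p <= Ex (fun w => p w * shifted_pot m (cf w) y)
       <= (M0 + err (r' - lev y) m) * Ex p.
  apply: IH => //; first exact: depends_mono dp.
    exact: le_trans rr'.
  by rewrite lerBrDr le_max lexx orbT.
have Ep : 0 <= Ex p by exact: Ex_ge0.
have ee : err (r' - lev y) m <= e.
  rewrite /err eE; apply: ler_wpM2l; first by rewrite invr_ge0 mulr_ge0 ?(ltW kap0) ?(ltW lam0).
  rewrite lerD2l ler_pM2r ?invr_gt0// lerD2l ler_pM2r ?invr_gt0// lerD2r.
  rewrite /r'; case: (leP r (lev y + 1)) => _.
    by rewrite addrAC subrr add0r expr1n lerDr sqr_ge0.
  by rewrite lerDl.
apply/andP; split.
  by apply: le_trans lo; apply: ler_wpM2r => //; lra.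
by apply: le_trans up _; apply: ler_wpM2r => //; lra.
Qed.

(* Under the weight [g], which depends on the environment below level [r] only, the
   walk at time [m] is made to reach a level where the environment is fresh; the
   expected delay is linear in the height still to be climbed, whose second moment
   grows at most linearly in [m], and [sb] balances the resulting square. *)
Lemma annealed_markov m r g x : bmeas g -> (forall w, 0 <= g w) -> depends_below r g ->
  1 <= r -> lev x <= r - 1 ->
  (m0 - err (r - lev x) m) * Ex g <= Ex (fun w => g w * shifted_pot m (cf w) x)
    <= (M0 + err (r - lev x) m) * Ex g.
Proof.
elim: m r g x => [|m IH] r g x bg g0 dg r1 xr.
  have /andP[m0p m0n] := m00.
  have r00 : 0 <= r by lra.
  have Eg : 0 <= Ex g by exact: Ex_ge0.
  have c : 2 * cost r x <= err (r - lev x) 0.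
    rewrite exit_costE//; last by lra.
    have -> : 2 * ((r + 1 - lev x) / (2 * kap * lam)) = (kap * lam)^-1 * (1 + (r - lev x)).
      by field; rewrite !gt_eqF.
    rewrite /err; apply: ler_wpM2l; first by rewrite invr_ge0 mulr_ge0 ?(ltW kap0) ?(ltW lam0).
    rewrite lerD2l mulr0 addr0 ler_pdivlMr// -subr_ge0.
    have -> : sb + (r - lev x) ^+ 2 / sb - (r - lev x) * 2 = (sb - (r - lev x)) ^+ 2 / sb.
      by field; rewrite gt_eqF.
    by rewrite divr_ge0 ?sqr_ge0// ltW.
  have up := run_up bg g0 dg r00 x rfield_id M00 (fun eta ae => proj2 (andP (HM ae))).
  have lo := run_lo bg g0 dg r00 x rfield_id m00 (fun eta ae => proj1 (andP (HM ae))).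
  apply/andP; split.
    by apply: le_trans lo; apply: ler_wpM2r => //; lra.
  by apply: le_trans up _; apply: ler_wpM2r => //; lra.
pose e y := (kap * lam)^-1 * (1 + (sb + ((r - lev y) ^+ 2 + 1 + 2 * m%:R) / sb) / 2).
(* The transition weights at [x] are absorbed into [g]. As [x] is below level [r], the products
   still depend on the environment below [r] only, and the induction hypothesis applies to them. *)
pose pz w := g w * (1 - 2 * \sum_i cf w x i).
pose pp i w := g w * (cf w x i * (1 + lam * l 0 i)).
pose pm i w := g w * (cf w x i * (1 - lam * l 0 i)).
have xr0 : lev x < r by lra.
have dcf w w' : (forall z, lev z < r -> cf w z = cf w' z) -> cf w x = cf w' x by exact.
have bs : bmeas (fun w => \sum_i cf w x i) by exact: bmeas_sum.
have bpz : bmeas pz.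
  by apply: bmeasM => //; apply: bmeasB; [exact: bmeas_cst|exact: bmeasZ].
have bpp i : bmeas (pp i) by apply: bmeasM => //; apply: bmeasM => //; exact: bmeas_cst.
have bpm i : bmeas (pm i) by apply: bmeasM => //; apply: bmeasM => //; exact: bmeas_cst.
have c0 w i : 0 <= cf w x i by have /andP[] := field_bounds kap0 x i (acf w).
have b0 i : 0 <= 1 + lam * l 0 i /\ 0 <= 1 - lam * l 0 i.
  by have := bias_le l1 lam0 lam1 i; rewrite ler_norml => /andP[? ?]; split; lra.
have pz0 w : 0 <= pz w by rewrite mulr_ge0//; have [_ h] := acf w; have := h x; lra.
have pp0 i w : 0 <= pp i w by rewrite !mulr_ge0//; have [] := b0 i.
have pm0 i w : 0 <= pm i w by rewrite !mulr_ge0//; have [] := b0 i.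
have dz : depends_below r pz by move=> w w' H; rewrite /pz (dg _ _ H) (dcf _ _ H).
have dp i : depends_below r (pp i) by move=> w w' H; rewrite /pp (dg _ _ H) (dcf _ _ H).
have dm i : depends_below r (pm i) by move=> w w' H; rewrite /pm (dg _ _ H) (dcf _ _ H).
have yb i : lev (x + evec i) <= r /\ lev (x - evec i) <= r.
  by have [h1 [h2 _]] := lev_nbr l1 x i; split; lra.
have bJ y : bmeas (fun w => shifted_pot m (cf w) y) by exact: bmeas_shifted_pot.
have expand (f : T -> L -> R) w : g w * step (cf w) (f w) x =
   pz w * f w x + \sum_i (pp i w * f w (x + evec i) + pm i w * f w (x - evec i)).
  rewrite stepE mulrDr /pz mulrA; congr (_ + _); rewrite mulr_sumr.
  by apply: eq_bigr => i _; rewrite /pp /pm; ring.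
have Eexpand (f : T -> L -> R) : (forall y, bmeas (fun w => f w y)) ->
   Ex (fun w => g w * step (cf w) (f w) x) = Ex (fun w => pz w * f w x) +
   \sum_i (Ex (fun w => pp i w * f w (x + evec i)) + Ex (fun w => pm i w * f w (x - evec i))).
  move=> bf; rewrite (_ : (fun w => g w * step (cf w) (f w) x) = (fun w => pz w * f w x +
     \sum_i (pp i w * f w (x + evec i) + pm i w * f w (x - evec i)))); last first.
    by apply/funext => w; exact: expand.
  rewrite ExD; [|exact: bmeasM|]; last first.
    by apply: bmeas_sum => i; apply: bmeasD; exact: bmeasM.
  rewrite Ex_sum; last by move=> i; apply: bmeasD; exact: bmeasM.
  by congr (_ + _); apply: eq_bigr => i _; rewrite ExD//; exact: bmeasM.
have Ecst (f : L -> R) (p : T -> R) y : bmeas p -> Ex (fun w => p w * f y) = f y * Ex p.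
  by move=> bp; rewrite -ExZ//; congr Ex; apply/funext => w; rewrite mulrC.
have NT p y (bp : bmeas p) (p0 : forall w, 0 <= p w) (dp' : depends_below r p) (yr : lev y <= r) :
   (m0 - e y) * Ex p <= Ex (fun w => p w * shifted_pot m (cf w) y) <= (M0 + e y) * Ex p.
  exact: (nbr_term x IH bp p0 dp' r1 yr erefl).
have ge w : gen (cf w) e x <= (kap * lam)^-1 * (2^-1 / sb).
  have -> : gen (cf w) e x = gen (cf w) (fun z => (kap * lam)^-1 * (2^-1 / sb) * (r - lev z) ^+ 2 +
     (kap * lam)^-1 * (1 + (sb + (1 + 2 * m%:R) / sb) / 2) * 1) x.
    by apply: eq_bigr => i _; rewrite /e; ring.
  rewrite (gen_lin _ _ _ _ _ _ (fun=> 1)) gen_cst mulr0 addr0 -[leRHS]mulr1; apply: ler_wpM2l.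
    apply: mulr_ge0; first by rewrite invr_ge0 mulr_ge0 ?(ltW kap0) ?(ltW lam0).
    by rewrite divr_ge0 ?invr_ge0 ?(ltW sb0).
  by apply: (gen_sqr_gap l1 lam0 kap0); [exact: acf|exact: ltW].
have eE : err (r - lev x) m.+1 = e x + (kap * lam)^-1 * (2^-1 / sb).
  by rewrite /err /e -natr1; field; rewrite !gt_eqF.
have bstep (f : L -> R) : bmeas (fun w => step (cf w) f x).
  apply: bmeasD; first exact: bmeas_cst.
  by apply: (@bmeas_gen _ _ _ _ l lam cf mcf (fun=> f)) => y; exact: bmeas_cst.
have up : Ex (fun w => g w * shifted_pot m.+1 (cf w) x) <=
    Ex (fun w => g w * step (cf w) (fun y => M0 + e y) x).
  rewrite (Eexpand (fun w => shifted_pot m (cf w)) bJ).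
  rewrite (Eexpand (fun _ y => M0 + e y)); last by move=> y; exact: bmeas_cst.
  apply: lerD.
    rewrite (Ecst (fun y => M0 + e y))//.
    by have /andP[] := NT _ x bpz pz0 dz (ltW xr0).
  apply: ler_sum => i _; have [y1 y2] := yb i.
  rewrite !(Ecst (fun y => M0 + e y))//; apply: lerD.
    by have /andP[] := NT _ _ (bpp i) (pp0 i) (dp i) y1.
  by have /andP[] := NT _ _ (bpm i) (pm0 i) (dm i) y2.
have lo : Ex (fun w => g w * step (cf w) (fun y => m0 - e y) x) <=
    Ex (fun w => g w * shifted_pot m.+1 (cf w) x).
  rewrite (Eexpand (fun w => shifted_pot m (cf w)) bJ).
  rewrite (Eexpand (fun _ y => m0 - e y)); last by move=> y; exact: bmeas_cst.
  apply: lerD.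
    rewrite (Ecst (fun y => m0 - e y))//.
    by have /andP[] := NT _ x bpz pz0 dz (ltW xr0).
  apply: ler_sum => i _; have [y1 y2] := yb i.
  rewrite !(Ecst (fun y => m0 - e y))//; apply: lerD.
    by have /andP[] := NT _ _ (bpp i) (pp0 i) (dp i) y1.
  by have /andP[] := NT _ _ (bpm i) (pm0 i) (dm i) y2.
apply/andP; split.
  apply: le_trans lo; rewrite -ExZ//; apply: Ex_le; [exact: bmeasZ|exact: bmeasM|move=> w].
  rewrite mulrC; apply: ler_wpM2l => //; rewrite eE /walk_step genB gen_cst.
  by have := ge w; lra.
apply: le_trans up _; rewrite -ExZ//; apply: Ex_le; [exact: bmeasM|exact: bmeasZ|move=> w].
rewrite [leRHS]mulrC; apply: ler_wpM2l => //; rewrite eE /walk_step.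
have -> : gen (cf w) (fun y => M0 + e y) x = gen (cf w) e x.
  by apply: eq_bigr => i _; ring.
by have := ge w; lra.
Qed.

End annealed_markov.
End horizon.

Definition mean_pot n : R := Ex (fun w => pot (cf w) n 0).

Lemma pot_addn m n c x : pot c (m + n) x = pot c m x + shifted_pot n m c x.
Proof.
elim: m x => [|m IH] x; first by rewrite add0n add0r.
have -> : pot c (m.+1 + n) x = 2 * c x j + step c (pot c (m + n)) x by [].
have -> : pot c (m + n) = fun z => pot c m z + shifted_pot n m c z by exact/funext.
rewrite /= /walk_step (_ : gen c (fun z => pot c m z + shifted_pot n m c z) x =
  gen c (fun z => 1 * pot c m z + 1 * shifted_pot n m c z) x); last first.
  by apply: eq_bigr => i _; ring.
by rewrite gen_lin /shifted_pot /=; ring.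
Qed.

(** Both [mean_pot n] and the mean gained between the times [m] and [m + n] lie in the range of
    [Phi], of length [D0], the latter up to the delay. The parameter [sb] is [sqrt m], which
    balances [sb] and [2 * m / sb]. *)
Lemma mean_pot_almost_additive m n : (2 <= d)%N -> kap <= 1 -> lam * ov_scale d kap <= 1 ->
  (0 < m)%N -> `|mean_pot (m + n) - mean_pot m - mean_pot n| <=
    osc_cst d kap / lam ^+ 2 + (kap * lam)^-1 * (1 + 2 * Num.sqrt m%:R).
Proof.
move=> d2 kap1 lamS mpos.
have HD := osc_bound n d2 kap1 lamS; set D0 := osc_cst d kap / _ in HD *.
have [m0 [/andP[m00 m0n] Hm]] := Phi_range HD.
have mr : 0 < m%:R :> R by rewrite ltr0n.
have sb0 : 0 < Num.sqrt (m%:R : R) by rewrite sqrtr_gt0.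
have D00 : 0 <= D0.
  by have := Hm _ (acf point); lra.
have bc1 : bmeas (fun _ : T => 1 : R) by exact: bmeas_cst.
have dc1 r : depends_below r (fun=> 1) by [].
have r10 : lev 0 <= 1 - 1 by rewrite lev0 subrr.
(* The environment below level 0 acts as a random [eta], so [mean_pot n] is an average of values of
   [Phi]. *)
have un : m0 <= mean_pot n <= m0 + D0.
  have up := @Ex_fresh_le n 0 (fun=> 1) bc1 (fun=> ler01) (dc1 0) cf 0 (m0 + D0) rfield_id.
  have lo := @Ex_fresh_ge n 0 (fun=> 1) bc1 (fun=> ler01) (dc1 0) cf 0 m0 rfield_id.
  rewrite lev0 in up lo; have {}up := up (lexx _) (lexx _) (fun e ae => proj2 (andP (Hm e ae))).
  have {}lo := lo (lexx _) (lexx _) (fun e ae => proj1 (andP (Hm e ae))).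
  move: up lo; rewrite Ex_cst !mulr1 /mean_pot => up lo.
  have E : (fun w => 1 * pot (cf w) n 0) = (fun w => pot (cf w) n 0).
    by apply/funext => w; rewrite mul1r.
  by rewrite E in up lo; rewrite lo up.
have := @annealed_markov n m0 (m0 + D0) (Num.sqrt m%:R) sb0 _ (addr_ge0 m00 D00) Hm m 1 (fun=> 1) 0
  bc1 (fun=> ler01) (dc1 1) (lexx _) r10.
rewrite m00 m0n Ex_cst !mulr1 lev0 subr0 => /(_ isT).
have -> : (fun w => 1 * shifted_pot n m (cf w) 0) = (fun w => shifted_pot n m (cf w) 0).
  by apply/funext => w; rewrite mul1r.
set e := _^-1 * _ => /andP[lo up].
have -> : mean_pot (m + n) = mean_pot m + Ex (fun w => shifted_pot n m (cf w) 0).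
  rewrite /mean_pot -ExD; [|exact: bmeas_pot|exact: bmeas_shifted_pot].
  by congr Ex; apply/funext => w; exact: pot_addn.
have ee : e <= (kap * lam)^-1 * (1 + 2 * Num.sqrt m%:R).
  rewrite /e; apply: ler_wpM2l; first by rewrite invr_ge0 mulr_ge0 ?(ltW kap0) ?(ltW lam0).
  have sq : Num.sqrt m%:R ^+ 2 = m%:R :> R by rewrite sqr_sqrtr// ltW.
  have h : (1 ^+ 2 + 2 * m%:R) / Num.sqrt m%:R <= 3 * Num.sqrt m%:R :> R.
    rewrite ler_pdivrMr// -mulrA -expr2 sq expr1n.
    have : 1 <= m%:R :> R by rewrite ler1n.
    by lra.
  by lra.
have /andP[u1 u2] := un.
by rewrite ler_norml; apply/andP; split; lra.
Qed.
End annealed.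

(** * From almost additivity to a rate *)

Section sqrt_rate.
Variables (R : realType) (u : nat -> R) (q A : R) (n0 : nat).
Hypothesis A0 : 0 <= A.
Hypothesis doubling : forall n, (n0 <= n)%N -> `|u (n + n)%N - u n - u n| <= A * Num.sqrt n%:R.
Hypothesis speed : u n / n%:R @[n --> \oo] --> q.

Let f n := `|u n - n%:R * q|.

Let sqrt_double n : Num.sqrt (n + n)%:R <= 3 / 2 * Num.sqrt n%:R :> R.
Proof.
rewrite -(@ler_pXn2r _ 2) ?nnegrE ?mulr_ge0 ?sqrtr_ge0// exprMn !sqr_sqrtr ?ler0n//.
by rewrite natrD; have : 0 <= n%:R :> R by []; lra.
Qed.

Let half_step n : (n0 <= n)%N -> f n <= 1 / 2 * f (n + n)%N + 1 / 2 * (A * Num.sqrt n%:R).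
Proof.
move=> nn; have := doubling nn; rewrite /f natrD.
have := ler_normB (u (n + n)%N - (n%:R + n%:R) * q) (u (n + n)%N - u n - u n).
have -> : u (n + n)%N - (n%:R + n%:R) * q - (u (n + n)%N - u n - u n) = 2 * (u n - n%:R * q) by ring.
by rewrite normrM [`|2|]ger0_norm//; lra.
Qed.

(** One doubling halves the error and multiplies the square root by at most [3 / 2]: a geometric
    series of first term [A / 2] and ratio [3 / 4], with sum [2 * A]. *)
Let iterate k : forall n, (n0 <= n)%N -> f n <= (1 / 2) ^+ k * f (2 ^ k * n)%N +
  2 * A * Num.sqrt n%:R * (1 - (3 / 4) ^+ k).
Proof.
elim: k => [|k IH] n nn; first by rewrite !expr0 expn0 mul1n mul1r subrr mulr0 addr0.
have n2 : (n0 <= n + n)%N by rewrite (leq_trans nn)// leq_addl.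
apply: (le_trans (half_step nn)).
have := IH _ n2; rewrite expnSr -mulnA mul2n addnn => h.
have k1 : 0 <= 1 - (3 / 4 : R) ^+ k by rewrite subr_ge0 exprn_ile1//; lra.
have := sqrt_double n; rewrite addnn => h2.
have s0 : 0 <= Num.sqrt n%:R :> R by rewrite sqrtr_ge0.
have A2 : 0 <= 2 * A * (1 - (3 / 4) ^+ k) by rewrite !mulr_ge0.
have h3 := ler_wpM2l A2 h2.
rewrite !exprS; move: h h3; set X := f (2 ^ k * n.*2)%N; set e := (3 / 4 : R) ^+ k.
set b := (1 / 2) ^+ k; set sn := Num.sqrt n%:R; set s2 := Num.sqrt _; set y := f _.
by move=> h h3; lra.
Qed.

(* Telescoping along [n], [2 n], [4 n], ... *)
Lemma sqrt_rate n : (n0 <= n)%N -> (0 < n)%N -> `|u n - n%:R * q| <= 2 * A * Num.sqrt n%:R.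
Proof.
move=> nn npos; have nr : 0 < n%:R :> R by rewrite ltr0n.
apply/ler_addgt0Pr => e e0.
have /cvgrPdist_le /(_ (e / n%:R)) := speed.
rewrite divr_gt0// => /(_ isT) [M _ HM].
have Mk : (M <= 2 ^ M * n)%N.
  by apply: leq_trans (leq_pmulr _ npos); exact/ltnW/ltn_expl.
have := HM _ Mk; rewrite /= => hM.
have kr : 0 < (2 ^ M * n)%:R :> R by rewrite ltr0n muln_gt0 expn_gt0.
apply: le_trans (iterate M nn) _.
have b : (1 / 2) ^+ M * f (2 ^ M * n)%N <= e.
  have -> : f (2 ^ M * n)%N = (2 ^ M * n)%:R * `|q - u (2 ^ M * n)%N / (2 ^ M * n)%:R|.
    rewrite -[X in X * _ ]ger0_norm ?(ltW kr)// -normrM mulrBr mulrCA divff ?gt_eqF// mulr1.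
    by rewrite distrC.
  have := ler_wpM2l (ltW kr) hM; rewrite natrM natrX => h.
  have p0 : 0 <= (1 / 2 : R) ^+ M by rewrite exprn_ge0//; lra.
  have := ler_wpM2l p0 h.
  have -> : (1 / 2) ^+ M * (2 ^+ M * n%:R * (e / n%:R)) = e.
    have -> : 2 ^+ M * n%:R * (e / n%:R) = 2 ^+ M * e by field; rewrite gt_eqF.
    have half : 1 / 2 * 2 = 1 :> R by lra.
    by rewrite mulrA -exprMn half expr1n mul1r.
  by [].
have c : 2 * A * Num.sqrt n%:R * (1 - (3 / 4) ^+ M) <= 2 * A * Num.sqrt n%:R.
  by rewrite ler_piMr ?mulr_ge0 ?sqrtr_ge0// gerBl exprn_ge0.
by lra.
Qed.
End sqrt_rate.

(** * The random environment *)

Section site_laws.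
Variables (R : realType) (d : nat).
Local Notation L := 'rV[int]_d.
Implicit Types (w : env R d) (x v : L) (i : 'I_d).

Definition unit_steps : seq L := [seq evec i | i <- index_enum 'I_d] ++ [seq - evec i | i <- index_enum 'I_d].

Lemma enorm_evec i : enorm (toR (evec i) : 'rV[R]_d) = 1.
Proof.
rewrite /enorm /dotp (bigD1 i)//= big1 => [|j ji]; rewrite !mxE eqxx /=.
  by rewrite eqxx mulr1 addr0 sqrtr1.
by rewrite (negPf ji) mulr0.
Qed.

Lemma enormN_evec i : enorm (toR (- evec i) : 'rV[R]_d) = 1.
Proof.
rewrite -(enorm_evec i) /enorm /dotp; congr Num.sqrt; apply: eq_bigr => j _.
by rewrite !mxE rmorphN mulrNN.
Qed.

Lemma stepset_evec i : stepset R (evec i).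
Proof. by rewrite /stepset/= enorm_evec. Qed.

Lemma stepsetN_evec i : stepset R (- evec i).
Proof. by rewrite /stepset/= enormN_evec. Qed.

Lemma evec_inj : injective (@evec d).
Proof. by move=> i j /rowP/(_ j); rewrite !evecE eqxx; case: (eqVneq i j). Qed.

Lemma uniq_steps : uniq (0 :: unit_steps).
Proof.
have nz i : evec i != 0 :> L.
  by apply/eqP => /rowP/(_ i); rewrite evecE eqxx mxE.
have np i k : evec i != - evec k :> L.
  apply/eqP => /rowP/(_ i); rewrite [RHS]mxE !evecE eqxx; case: eqP => _ /=; lia.
rewrite /= mem_cat negb_or -andbA; apply/and3P; split.
- by apply/mapP => -[i _ /esym/eqP]; rewrite (negPf (nz i)).
- by apply/mapP => -[i _ /esym/eqP]; rewrite oppr_eq0 (negPf (nz i)).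
rewrite cat_uniq !map_inj_uniq ?index_enum_uniq//; last 2 first.
- by move=> i k /oppr_inj/evec_inj.
- exact: evec_inj.
rewrite andbT/=; apply/hasPn => _ /mapP[i _ ->].
by apply/mapP => -[k _ /esym/eqP]; rewrite (negPf (np k i)).
Qed.

Lemma stepsetE : @stepset R d = [set` 0 :: unit_steps] :> set L.
Proof.
apply/seteqP; split=> v /=.
  case/stepsetP => [->|[i [->|->]]]; rewrite inE ?eqxx// mem_cat; apply/orP; right;
    apply/orP; [left|right]; apply/mapP; exists i => //; exact: mem_index_enum.
rewrite inE mem_cat => /predU1P[->|/orP[/mapP[i _ ->]|/mapP[i _ ->]]].
- exact: stepset0.
- exact: stepset_evec.
- exact: stepsetN_evec.
Qed.

Lemma sum_stepset (f : L -> R) : \sum_(v \in @stepset R d) f v =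
  f 0 + \sum_i (f (evec i) + f (- evec i)).
Proof.
rewrite stepsetE -fsbig_seq; last exact: uniq_steps.
by rewrite big_cons big_cat !big_map big_split.
Qed.

Lemma tr_sumE w x : tr w x 0 = 1 - \sum_i (tr w x (evec i) + tr w x (- evec i)).
Proof. by have := tr_sum w x; rewrite sum_stepset => <-; rewrite addrK. Qed.

Lemma tr_sum_le1 w x : \sum_i (tr w x (evec i) + tr w x (- evec i)) <= 1.
Proof. by have := tr_ge0 w x 0; rewrite tr_sumE subr_ge0. Qed.

Lemma tr_le1 w x v : tr w x v <= 1.
Proof.
have [/stepsetP Vv|/(tr_out w x)->//] := pselect (stepset R v).
have h0 i : 0 <= tr w x (evec i) + tr w x (- evec i) by rewrite addr_ge0 ?tr_ge0.
have h i : tr w x (evec i) + tr w x (- evec i) <= 1.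
  apply: le_trans (tr_sum_le1 w x); rewrite (bigD1 i)//= lerDl.
  by apply: sumr_ge0 => k _.
case: Vv => [->|[i [->|->]]].
- by rewrite tr_sumE lerBlDr lerDl; apply: sumr_ge0 => k _.
- by apply: le_trans (h i); rewrite lerDl tr_ge0.
- by apply: le_trans (h i); rewrite lerDr tr_ge0.
Qed.

Lemma measurable_tr x v : measurable_fun setT (fun w => tr w x v).
Proof.
move=> _ Y mY; apply: sub_sigma_algebra.
by exists (x, v) => //; exists Y.
Qed.

Lemma measurable_site_vector x : measurable_fun setT (@site_vector R d x).
Proof.
have := @measurability _ _ (env R d) (step_vector R d) setT (@site_vector R d x)
  (@vector_cylinders R d) erefl.
apply => //.
move=> _ [_ [e _ [Y mY <-]] <-].
rewrite !setTI; have := @measurable_tr x (\val e) measurableT Y mY.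
by rewrite setTI.
Qed.

Lemma measurable_to_env dT (T : measurableType dT) (f : T -> env R d) :
  (forall x v, measurable_fun setT (fun t => tr (f t) x v)) -> measurable_fun setT f.
Proof.
move=> mf; have := @measurability _ _ T (env R d) setT f (@env_cylinders R d) erefl.
apply => //.
move=> _ [_ [[x v] _ [Y mY <-]] <-]; rewrite !setTI.
by have := mf x v measurableT Y mY; rewrite setTI.
Qed.

Definition site_cylinder (s : seq L) (B : L -> set (step_vector R d)) : set (env R d) :=
  [set w | forall x, x \in s -> B x (site_vector x w)].

Definition site_cylinders : set (set (env R d)) := [set A | exists s B,
  [/\ uniq s, forall x, measurable (B x) & A = site_cylinder s B]].

Lemma measurable_site_cylinder s B : (forall x, measurable (B x)) ->
  measurable (site_cylinder s B).
Proof.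
move=> mB; elim: s => [|x s IH].
  by rewrite (_ : site_cylinder _ _ = setT)//; apply/seteqP; split.
rewrite (_ : site_cylinder _ _ = (site_vector x @^-1` B x) `&` site_cylinder s B).
  apply: measurableI => //; rewrite -[X in measurable X]setTI.
  exact: (@measurable_site_vector x measurableT (B x) (mB x)).
apply/seteqP; split=> w /= H.
  by split=> [|y ys]; apply: H; rewrite inE ?eqxx// ys orbT.
by move=> y; rewrite inE => /predU1P[->|]; [exact: H.1|exact: H.2].
Qed.

Lemma setI_closed_site_cylinders : setI_closed site_cylinders.
Proof.
move=> _ _ [s [B [us mB ->]]] [s' [B' [us' mB' ->]]].
exists (undup (s ++ s')).
exists (fun x => (if x \in s then B x else setT) `&` (if x \in s' then B' x else setT)).
split; first exact: undup_uniq.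
  by move=> x; apply: measurableI; case: ifP.
apply/seteqP; split=> w /=.
  by move=> [H H'] x _; split; case: ifP => // ?; [exact: H|exact: H'].
move=> H; split=> x xs.
  by have := H x; rewrite mem_undup mem_cat xs => /(_ isT)[].
by have := H x; rewrite mem_undup mem_cat xs orbT => /(_ isT)[].
Qed.

(** [site_vector] records the unit steps only; the probability of the zero step is recovered from
    the normalisation. *)
Lemma site_cylinders_generate :
  measurable = <<s site_cylinders >> :> set (set (env R d)).
Proof.
apply/seteqP; split; last first.
  apply: smallest_sub; first exact: sigma_algebra_measurable.
  by move=> _ [s [B [_ mB ->]]]; exact: measurable_site_cylinder.
apply: smallest_sub; first exact: smallest_sigma_algebra.
pose T := g_sigma_algebraType site_cylinders.
have munit x v : enorm (toR v : 'rV[R]_d) = 1 ->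
    measurable_fun setT (fun w : T => tr (w : env R d) x v).
  move=> v1 _ Y mY; apply: sub_sigma_algebra.
  pose e : unit_step R d := SigSub (mem_set (v1 : [set e : L | enorm (toR e : 'rV[R]_d) = 1] v)).
  exists [:: x], (fun=> (fun f : step_vector R d => f e) @^-1` Y); split=> //.
    move=> _; apply: sub_sigma_algebra; exists e => //; exists Y => //.
    by rewrite setTI.
  rewrite setTI; apply/seteqP; split=> w /=.
    by move=> H y; rewrite inE => /eqP->.
  by move=> /(_ x); rewrite inE eqxx; exact.
suff mtr x v : measurable_fun setT (fun w : T => tr (w : env R d) x v).
  move=> _ [[x v] _ [Y mY <-]].
  exact: (mtr x v measurableT Y mY).
have [/stepsetP Vv|Vv] := pselect (stepset R v); last first.
  rewrite (_ : (fun w => _) = fun=> 0); first exact: measurable_cst.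
  by apply/funext => w; exact: tr_out.
case: Vv => [->|[i [->|->]]].
- rewrite (_ : (fun w => _) = fun w : T =>
      1 - \sum_i (tr (w : env R d) x (evec i) + tr (w : env R d) x (- evec i))).
    apply: measurable_funB => //; apply: measurable_sum => i.
    by apply: measurable_funD; apply: munit; rewrite (enorm_evec, enormN_evec).
  by apply/funext => w; exact: tr_sumE.
- by apply: munit; exact: enorm_evec.
- by apply: munit; exact: enormN_evec.
Qed.

Lemma env_law_unique (m1 m2 : {measure set (env R d) -> \bar R}) :
  (m1 setT < +oo)%E ->
  (forall s B, uniq s -> (forall x, measurable (B x)) ->
     m1 (site_cylinder s B) = m2 (site_cylinder s B)) ->
  forall A, measurable A -> m1 A = m2 A.
Proof.
move=> fin eqm; apply: (@measure_unique _ _ _ site_cylinders (fun=> setT)) => //.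
- exact: site_cylinders_generate.
- exact: setI_closed_site_cylinders.
- move=> _; exists [::], (fun=> setT); split=> //.
  by apply/seteqP; split.
- by apply/seteqP; split=> // w _; exists 0%N.
- by move=> _ [s [B [us mB ->]]]; exact: eqm.
Qed.

End site_laws.

Lemma measurable_big_and dT (T : measurableType dT) (I : Type) (s : seq I) (f : I -> T -> bool) :
  (forall i, measurable_fun setT (f i)) ->
  measurable_fun setT (fun w => \big[andb/true]_(i <- s) f i w).
Proof.
move=> mf; elim: s => [|i s IH].
  by under eq_fun do rewrite big_nil; exact: measurable_cst.
by under eq_fun do rewrite big_cons; exact: measurable_and.
Qed.

Section site_field.
Variables (R : realType) (d : nat) (kap : R).
Local Notation L := 'rV[int]_d.
Implicit Types (w : env R d) (x : L) (i : 'I_d).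

Definition balanced_at w x := [forall i, (tr w x (evec i) == tr w x (- evec i)) &&
  (kap < tr w x (evec i))].

(* The weights of an environment, reset to the simple random walk at the sites
   violating balance or ellipticity, so that they are admissible surely. *)
Definition weights w x i : R :=
  if balanced_at w x then tr w x (evec i) else (2 * d%:R)^-1.

Lemma bmeas_weights x i : bmeas (fun w => weights w x i).
Proof.
split; last first.
  exists (1 + (2 * d%:R)^-1) => w; have d0 : 0 <= (2 * d%:R)^-1 :> R.
    by rewrite invr_ge0 mulr_ge0// ler0n.
  have := tr_le1 w x (evec i); have := tr_ge0 w x (evec i); rewrite /weights.
  by case: ifP => _ h1 h2; rewrite ger0_norm//; lra.
apply: measurable_fun_ifT; [|exact: measurable_tr|exact: measurable_cst].
have -> : balanced_at ^~ x = fun w => \big[andb/true]_(k : 'I_d)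
    ((tr w x (evec k) == tr w x (- evec k)) && (kap < tr w x (evec k))).
  by apply/funext => w; rewrite big_andE.
apply: measurable_big_and => k; apply: measurable_and.
  by apply: measurable_fun_eqr; exact: measurable_tr.
by apply: measurable_fun_ltr; [exact: measurable_cst|exact: measurable_tr].
Qed.

Lemma admissible_weights w : (0 < d)%N -> kap <= (2 * d%:R)^-1 -> admissible kap (weights w).
Proof.
move=> d0 kd; split=> x.
  move=> i; rewrite /weights; case: ifP => // /forallP/(_ i)/andP[_ /ltW]//.
rewrite /weights; case: (boolP (balanced_at w x)) => [/forallP h|_].
  have := tr_sum_le1 w x.
  have -> : \sum_i (tr w x (evec i) + tr w x (- evec i)) = 2 * \sum_i tr w x (evec i).
    rewrite mulr_sumr; apply: eq_bigr => i _; have /andP[/eqP <- _] := h i.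
    by ring.
  by lra.
rewrite sumr_const card_ord -[_ *+ d]mulr_natl invfM mulrCA mulfV ?mulr1 ?mul1r//.
by rewrite pnatr_eq0 -lt0n.
Qed.

Lemma eq_weights w w' x x' : tr w x = tr w' x' -> weights w x = weights w' x'.
Proof. by move=> e; rewrite /weights /balanced_at e. Qed.

End site_field.

(** * Invariance under translation and gluing *)

Section iid_invariance.
Variables (R : realType) (d : nat) (P : probability (env R d) R) (l : 'rV[R]_d).
Local Notation L := 'rV[int]_d.
Local Notation lev := (lev l).
Hypothesis iidP : iid_env P.
Implicit Types (w : env R d) (x y : L).

(* For iid environments, gluing two independent copies along a hyperplane gives
   again the same law; this is the renewal structure used above. *)
Definition glue y w' w : env R d := fun x => if lev y <= lev x then w x else w' x.

Definition translate y w : env R d := fun x => w (x + y).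

Lemma tr_glue y w' w x : tr (glue y w' w) x = if lev y <= lev x then tr w x else tr w' x.
Proof. by rewrite /tr /glue; case: ifP. Qed.

Lemma site_vector_glue y w' w x : site_vector x (glue y w' w) =
  if lev y <= lev x then site_vector x w else site_vector x w'.
Proof. by apply/funext => e; rewrite /site_vector tr_glue; case: ifP. Qed.

Lemma measurable_translate y : measurable_fun setT (translate y).
Proof. by apply: measurable_to_env => x v; exact: measurable_tr. Qed.

Lemma measurable_glue y : measurable_fun setT (fun p : env R d * env R d => glue y p.1 p.2).
Proof.
apply: measurable_to_env => x v.
rewrite (_ : (fun t => _) = fun t : env R d * env R d =>
    if lev y <= lev x then tr t.2 x v else tr t.1 x v); last first.
  by apply/funext => t; rewrite tr_glue; case: ifP.
case: (lev y <= lev x).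
  exact: (measurableT_comp (@measurable_tr R d x v) measurable_snd).
exact: (measurableT_comp (@measurable_tr R d x v) measurable_fst).
Qed.

Lemma P_site_cylinder s B : uniq s -> (forall x, measurable (B x)) ->
  P (site_cylinder s B) = (\prod_(x <- s) P [set w | B x (site_vector x w)])%E.
Proof. by move=> us mB; case: iidP => h _; exact: h. Qed.

Lemma translate_invariant y A : measurable A -> P (translate y @^-1` A) = P A.
Proof.
pose m := measure_function_pushforward__canonical__measure_function_Measure P
  (measurable_translate y).
apply: (@env_law_unique R d m P).
  by rewrite /m /= /pushforward preimage_setT probability_setT ltry.
move=> s B us mB; rewrite [RHS](P_site_cylinder us mB) /m/= /pushforward.
have -> : translate y @^-1` site_cylinder s B =
    site_cylinder [seq x + y | x <- s] (fun z => B (z - y)).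
  apply/seteqP; split=> w /= H.
    by move=> _ /mapP[x xs ->]; rewrite addrK; exact: (H x xs).
  by move=> x xs; have := H (x + y) (map_f _ xs); rewrite addrK.
rewrite P_site_cylinder//; last by rewrite map_inj_uniq//; exact: addIr.
rewrite big_map; apply: eq_bigr => x _; rewrite addrK.
by case: iidP => _ h; exact: h.
Qed.

(** The preimage of a site cylinder is the product of its parts below and above the hyperplane; by
    independence their probabilities multiply back to that of the cylinder. *)
Lemma glue_invariant y A : measurable A ->
  (P \x P)%E ((fun p : env R d * env R d => glue y p.1 p.2) @^-1` A) = P A.
Proof.
pose m := measure_function_pushforward__canonical__measure_function_Measure
  (P \x P)%E (measurable_glue y).
apply: (@env_law_unique R d m P).
  rewrite /m /= /pushforward preimage_setT -setXTT product_measure1E//.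
  change (P setT * P setT < +oo)%E.
  by rewrite probability_setT mule1 ltry.
move=> s B us mB; rewrite [RHS](P_site_cylinder us mB) /m/= /pushforward.
pose top x := lev y <= lev x.
have -> : (fun p => glue y p.1 p.2) @^-1` site_cylinder s B =
    site_cylinder [seq x <- s | ~~ top x] B `*` site_cylinder [seq x <- s | top x] B.
  apply/seteqP; split=> -[w' w] /=.
    move=> H; split=> x; rewrite mem_filter => /andP[tx xs]; have := H x xs;
      by rewrite site_vector_glue -/(top x) ?(negbTE tx) ?tx.
  move=> [H' H] x xs; have := H x; have := H' x; rewrite !mem_filter xs !andbT.
  by rewrite site_vector_glue -/(top x); case: (top x) => /= h1 h2; [exact: h2|exact: h1].
rewrite product_measure1E; try exact: measurable_site_cylinder.
rewrite [X in (X * _)%E](P_site_cylinder (filter_uniq _ us) mB).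
rewrite [X in (_ * X)%E](P_site_cylinder (filter_uniq _ us) mB) !big_filter.
by rewrite [RHS](bigID top)/= muleC.
Qed.

Lemma Ex_translate y (F : env R d -> R) : bmeas F -> Ex P (fun w => F (translate y w)) = Ex P F.
Proof.
move=> bF; have mF := measurable_translate y.
rewrite /Ex /Rintegral; congr fine.
have := integral_pushforward mF (mu := P) (D := setT) (f := EFin \o F).
rewrite preimage_setT => <-//.
- apply: eq_measure_integral => A mA _; exact: translate_invariant.
- by apply/measurable_EFinP; case: bF.
- apply: (@bmeas_integrable _ _ _ P (F \o translate y)); case: bF => mf [M HM].
  by split; [exact: (measurableT_comp mf mF)|exists M => w; exact: HM].
Qed.

Lemma bmeas_glue y (F : env R d -> R) : bmeas F -> bmeas (fun p : env R d * env R d => F (glue y p.1 p.2)).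
Proof.
move=> [mf [M HM]]; split; last by exists M => p; exact: HM.
exact: (measurableT_comp mf (measurable_glue y)).
Qed.

(** [glue_invariant] turns [Ex P F] into a double integral, and Fubini integrates first over the
    fresh half, the part behind being frozen. *)
Lemma resample_half_space y (F G : env R d -> R) : bmeas F -> bmeas G ->
  (forall w', Ex P (fun w => F (glue y w' w)) <= G w') -> Ex P F <= Ex P G.
Proof.
move=> bF bG FG; have mg := measurable_glue y; have bH := bmeas_glue y bF.
pose H (p : env R d * env R d) : \bar R := (F (glue y p.1 p.2))%:E.
have iH : (P \x P)%E.-integrable setT H.
  have finPP : ((P \x P)%E [set: env R d * env R d] < +oo)%E.
    rewrite -setXTT product_measure1E//.
    change (P setT * P setT < +oo)%E.
    by rewrite probability_setT mule1 ltry.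
  case: bH => mH [M HM]; apply: measurable_bounded_integrable => //.
  exists M; split; first exact: num_real.
  by move=> x Mx w _; apply: le_trans (HM w) (ltW Mx).
have bsec w' : P.-integrable setT (fun w => H (w', w)).
  apply: (@bmeas_integrable _ _ _ P (fun w => F (glue y w' w))).
  case: bF => mf [M HM]; split; last by exists M => w; exact: HM.
  exact: (measurableT_comp mf (measurableT_comp mg (pair1_measurable w'))).
have EF : (\int[P]_w (F w)%:E = \int[P]_w' (Ex P (fun w => F (glue y w' w)))%:E)%E.
  have e1 : (\int[P]_w (F w)%:E = \int[(P \x P)%E]_p H p)%E.
    have := integral_pushforward mg (mu := (P \x P)%E) (D := setT) (f := EFin \o F).
    rewrite preimage_setT => <-//.
      apply: eq_measure_integral => A mA _; apply/esym; exact: glue_invariant.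
    by apply/measurable_EFinP; case: bF.
  rewrite e1 -(integral12_prod_meas1 iH); apply: eq_integral => w' _.
  rewrite /fubini_F /Ex /Rintegral fineK//; apply: integrable_fin_num => //.
  exact: bsec.
rewrite {1}/Ex {1}/Rintegral EF; apply: le_Rintegral => //.
- have := integrable_fubini_F iH; apply: eq_integrable => // w' _.
  rewrite /fubini_F /= /Ex /Rintegral fineK//; apply: integrable_fin_num => //.
  exact: bsec.
- exact: bmeas_integrable.
Qed.

End iid_invariance.

Section expectation.
Context dT (T : measurableType dT) (R : realType) (P : probability T R).
Implicit Types (F G : T -> R).

Lemma Ex_indic (A : set T) : measurable A -> Ex P (\1_A : T -> R) = fine (P A).
Proof. by move=> mA; rewrite /Ex /Rintegral integral_indic// setIT. Qed.

Lemma Ex_mul_null F G : bmeas F -> bmeas G -> (forall w, 0 <= F w) -> Ex P F = 0 ->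
  Ex P (fun w => F w * G w) = 0.
Proof.
move=> bF bG F0 EF; have [_ [M HM]] := bG; apply/eqP; rewrite eq_le; apply/andP; split.
  rewrite -[leRHS](mulr0 M) -EF -ExZ//; apply: Ex_le; [exact: bmeasM|exact: bmeasZ|].
  move=> w; rewrite mulrC; apply: ler_wpM2r => //.
  by have := HM w; rewrite ler_norml => /andP[].
rewrite -[leLHS](mulr0 (- M)) -EF -ExZ//; apply: Ex_le; [exact: bmeasZ|exact: bmeasM|].
move=> w; rewrite [leRHS]mulrC; apply: ler_wpM2r => //.
by have := HM w; rewrite ler_norml => /andP[].
Qed.

Lemma Ex_ae_eq F G : measurable_fun setT F -> measurable_fun setT G ->
  {ae P, forall w, F w = G w} -> Ex P F = Ex P G.
Proof.
move=> mF mG FG; rewrite /Ex /Rintegral; congr fine; apply: ae_eq_integral => //.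
- exact/measurable_EFinP.
- exact/measurable_EFinP.
- by apply: filterS FG => w FG _; rewrite FG.
Qed.

Lemma Ex_cvg (F_ : nat -> T -> R) (a M : R) : (forall n, bmeas (F_ n)) ->
  (forall n w, `|F_ n w| <= M) ->
  {ae P, forall w, F_ n w @[n --> \oo] --> a} -> Ex P (F_ n) @[n --> \oo] --> a.
Proof.
move=> bF HM ae.
have [] := @dominated_convergence _ _ _ P _ measurableT (fun n w => (F_ n w)%:E)
  (fun=> a%:E) (fun=> M%:E).
- by move=> n; apply/measurable_EFinP; case: (bF n).
- exact: measurable_cst.
- by apply: filterS ae => w h _; apply: cvg_EFin => //; near=> n.
- by apply: (@bmeas_integrable _ _ _ P (fun=> M)); exact: bmeas_cst.
- by apply: aeW => w n _; rewrite lee_fin.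
move=> _ _; rewrite integral_cst// [X in (_ * X)%E]probability_setT mule1 => h.
exact: fine_cvg h.
Unshelve. all: by end_near. Qed.

End expectation.

(** * Quenched laws *)

Section quenched.
Variables (R : realType) (d : nat).
Local Notation L := 'rV[int]_d.
Implicit Types (w : env R d) (x y v : L) (f : L -> R).

Definition walk_op w f x : R := \sum_(v <- 0 :: unit_steps d) tr w x v * f (x + v).

Lemma tr_sum_steps w x : \sum_(v <- 0 :: unit_steps d) tr w x v = 1.
Proof. by rewrite -(tr_sum w x) stepsetE -fsbig_seq//; exact: uniq_steps. Qed.

Lemma measurable_position k (A : set L) : measurable [set X : traj d | A (X k)].
Proof.
rewrite (_ : [set X : traj d | A (X k)] =
    \bigcup_y (if y \in A then [set X : traj d | X k = y] else set0)); last first.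
  apply/seteqP; split=> X /= => [AX|[y _]].
    by exists (X k) => //; rewrite mem_set.
  by case: ifPn => // /set_mem Ay ->.
apply: countable_bigcupT_measurable => [|y]; first exact: countableP.
case: ifP => // _; apply: sub_sigma_algebra; by exists k, y.
Qed.

Lemma bmeas_position k f M : (forall x, `|f x| <= M) -> bmeas (fun X : traj d => f (X k)).
Proof.
move=> fM; split; last by exists M.
by move=> _ Y mY; rewrite setTI; exact: (@measurable_position k (f @^-1` Y)).
Qed.

Definition visits (t : seq L) (X : traj d) : R :=
  \prod_(0 <= k < size t) (X k == nth 0 t k)%:R.

Lemma visits_rcons t y X : visits (rcons t y) X = visits t X * (X (size t) == y)%:R.
Proof.
rewrite /visits size_rcons big_nat_recr//= nth_rcons ltnn eqxx; congr (_ * _).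
by apply: eq_big_nat => k /andP[_ kt]; rewrite nth_rcons kt.
Qed.

Lemma visits_ge0 t X : 0 <= visits t X.
Proof. by apply: prodr_ge0 => k _; rewrite ler0n. Qed.

Lemma bmeas_visits t : bmeas (visits t).
Proof.
elim/last_ind: t => [|t y IH].
  by rewrite (_ : visits [::] = fun=> 1); [exact: bmeas_cst|apply/funext => X; rewrite /visits big_nil].
rewrite (_ : visits _ = fun X => visits t X * (X (size t) == y)%:R); last first.
  by apply/funext => X; rewrite visits_rcons.
apply: bmeasM => //; apply: (@bmeas_position (size t) (fun x => (x == y)%:R) 1) => x.
by case: eqP; rewrite ?normr0 ?normr1.
Qed.

Lemma visitsE t : visits t = \1_[set X : traj d | forall k, (k < size t)%N -> X k = nth 0 t k].
Proof.
apply/funext => X; elim/last_ind: t => [|t y IH].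
  by rewrite /visits big_nil indicE mem_set.
rewrite visits_rcons IH !indicE -natrM mulnb; congr (_%:R); congr nat_of_bool.
apply/andP/idP => [[/set_mem/= h /eqP hy]|/set_mem/= h].
  apply/mem_set => k; rewrite size_rcons ltnS nth_rcons leq_eqVlt => /predU1P[->|kt].
    by rewrite ltnn eqxx.
  by rewrite kt; exact: h.
split; [apply/mem_set => k kt|apply/eqP].
  by have := h k; rewrite size_rcons nth_rcons kt; apply; exact: ltnW.
by have := h (size t); rewrite size_rcons nth_rcons ltnn eqxx; apply.
Qed.

Section law.
Variables (w : env R d) (x0 : L).
Local Notation mu := (quenched_law w x0).

Lemma Ex_visits_step t x v : v \in 0 :: unit_steps d ->
  Ex mu (visits (rcons (rcons t x) (x + v))) = Ex mu (visits (rcons t x)) * tr w x v.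
Proof.
move=> vS; have Vv : stepset R v by rewrite stepsetE.
have mhist n (p : nat -> L) : measurable [set X : traj d | forall k, (k <= n)%N -> X k = p k].
  rewrite (_ : mkset _ = \bigcap_(k in [set k | (k <= n)%N]) [set X : traj d | X k = p k]).
    by apply: bigcap_measurable; [exists 0%N|move=> k _; exact: (@measurable_position k [set p k])].
  by apply/seteqP; split=> X h k kn; exact: h.
have [_ /(_ (size t) (nth 0 (rcons t x)) v Vv)] := quenched_lawP w x0.
rewrite nth_rcons ltnn eqxx => /(congr1 fine).
rewrite fineM ?fin_num_measure// => e.
have e1 : [set X : traj d | forall k, (k < size (rcons t x))%N -> X k = nth 0 (rcons t x) k] =
    [set X | forall k, (k <= size t)%N -> X k = nth 0 (rcons t x) k].
  by apply/seteqP; split=> X /= h k kt; apply: h; move: kt; rewrite size_rcons ltnS.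
have e2 : [set X : traj d | forall k, (k < size (rcons (rcons t x) (x + v)%R))%N ->
      X k = nth 0 (rcons (rcons t x) (x + v)) k] =
    [set X | (forall k, (k <= size t)%N -> X k = nth 0 (rcons t x) k) /\
      X (size t).+1 = x + v].
  apply/seteqP; split=> X /= h.
    split=> [k kt|]; last first.
      by have := h (size t).+1; rewrite !size_rcons nth_rcons size_rcons ltnn eqxx; exact.
    have kt' : (k < (size t).+1)%N by rewrite ltnS.
    have := h k; rewrite !size_rcons nth_rcons size_rcons kt'; apply.
    exact: leqW.
  case: h => h h1 k; rewrite !size_rcons ltnS nth_rcons size_rcons leq_eqVlt.
  case/predU1P => [->|kt]; first by rewrite ltnn eqxx.
  by rewrite kt; exact: h.
rewrite !visitsE e1 e2 !Ex_indic//.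
rewrite (_ : mkset _ = [set X : traj d | forall k, (k <= size t)%N -> X k = nth 0 (rcons t x) k]
    `&` [set X : traj d | X (size t).+1 = x + v]); last by apply/seteqP; split.
by apply: measurableI => //; exact: (@measurable_position _ [set x + v]).
Qed.

(** The Markov property given a history that ends at [x]. *)
Lemma Ex_visits_fut t x f M m : (forall y, `|f y| <= M) ->
  Ex mu (fun X => visits (rcons t x) X * f (X (size t + m)%N)) =
  Ex mu (visits (rcons t x)) * iter m (walk_op w) f x.
Proof.
move=> fM; have bpos k : bmeas (fun X : traj d => f (X k)) := bmeas_position k fM.
elim: m t x => [|m IH] t x.
  have -> : (fun X => visits (rcons t x) X * f (X (size t + 0)%N)) =
      fun X => f x * visits (rcons t x) X.
    apply/funext => X; rewrite visits_rcons addn0.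
    by case: eqP => [->|_]; rewrite ?mulr1 ?mulr0 ?mul0r ?mulr0 // mulrC.
  by rewrite ExZ 1?mulrC//; exact: bmeas_visits.
pose S := 0 :: unit_steps d.
pose h := visits (rcons t x).
(* [rest] is carried by the paths whose next step is outside the step set. [is_markov_law] says
   nothing about them, but the allowed steps already exhaust the mass, so [rest] has mean 0. *)
pose rest X := h X - \sum_(v <- S) visits (rcons (rcons t x) (x + v)) X.
have restE X : rest X = h X * (X (size t).+1 - x \notin S)%:R.
  rewrite /rest; under eq_bigr do rewrite visits_rcons size_rcons -/h.
  rewrite -mulr_sumr -[X in X - _]mulr1 -mulrBr; congr (_ * _).
  have shiftE v : (X (size t).+1 == x + v) = (X (size t).+1 - x == v).
    by rewrite subr_eq addrC.
  under eq_bigr do rewrite shiftE.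
  set a := X _ - x; have [aS|aS] := boolP (a \in S).
    rewrite (bigD1_seq a)//=; last exact: uniq_steps.
    rewrite eqxx big1 ?addr0 ?subrr// => v /negPf va.
    by rewrite eq_sym va.
  rewrite big_seq big1 ?subr0// => v vS; case: eqP => // av.
  by rewrite av vS in aS.
have bvis v : bmeas (visits (rcons (rcons t x) (x + v))) by exact: bmeas_visits.
have bsum : bmeas (fun X => \sum_(v <- S) visits (rcons (rcons t x) (x + v)) X).
  exact: bmeas_sum.
have brest : bmeas rest by apply: bmeasB => //; exact: bmeas_visits.
have rest0 X : 0 <= rest X by rewrite restE mulr_ge0 ?ler0n ?visits_ge0.
have Erest : Ex mu rest = 0.
  rewrite /rest ExB//; last exact: bmeas_visits.
  rewrite Ex_sum// (eq_big_seq (fun v => Ex mu h * tr w x v)); last first.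
    by move=> v vS; exact: Ex_visits_step.
  by rewrite -mulr_sumr tr_sum_steps mulr1 subrr.
pose g (X : traj d) := f (X (size t + m.+1)%N).
have bg : bmeas g by exact: bpos.
have -> : (fun X => h X * g X) = fun X =>
    \sum_(v <- S) visits (rcons (rcons t x) (x + v)) X * g X + rest X * g X.
  by apply/funext => X; rewrite -mulr_suml -mulrDl /rest addrC subrK.
rewrite ExD; [|by apply: bmeas_sum => v; exact: bmeasM|exact: bmeasM].
rewrite Ex_mul_null// addr0 Ex_sum; last by move=> v; exact: bmeasM.
rewrite /= {2}/walk_op mulr_sumr; apply: eq_big_seq => v vS.
have := IH (rcons t x) (x + v); rewrite size_rcons addSnnS -/g => ->.
by rewrite Ex_visits_step// mulrA.
Qed.

Lemma quenched_Ex f M n : (forall y, `|f y| <= M) ->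
  Ex mu (fun X => f (X n)) = iter n (walk_op w) f x0.
Proof.
move=> fM; have bg : bmeas (fun X : traj d => f (X n)) := bmeas_position n fM.
have e1 : Ex mu (visits [:: x0]) = 1.
  rewrite visitsE Ex_indic; last first.
    rewrite (_ : mkset _ = [set X : traj d | X 0%N = x0]); last first.
      by apply/seteqP; split=> X /= => [/(_ 0%N isT)//|h [|]].
    exact: (@measurable_position 0 [set x0]).
  rewrite (_ : mkset _ = [set X : traj d | X 0%N = x0]); last first.
    by apply/seteqP; split=> X /= => [/(_ 0%N isT)//|h [|]].
  by have [-> _] := quenched_lawP w x0.
have := Ex_visits_fut [::] x0 n fM; rewrite e1 mul1r => <-.
have v01 X : visits [:: x0] X <= 1.
  rewrite visitsE indicE; by case: (_ \in _).
have bv : bmeas (visits [:: x0]) by exact: bmeas_visits.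
(* The walk starts at [x0] only almost surely; the paths starting elsewhere are discarded as a null
   set. *)
apply/eqP; rewrite -subr_eq0 -ExB//; last exact: bmeasM.
rewrite (_ : (fun X => _) = fun X => (1 - visits [:: x0] X) * f (X n)); last first.
  by apply/funext => X; rewrite mulrBl mul1r.
rewrite Ex_mul_null//; first by apply: bmeasB => //; exact: bmeas_cst.
  by move=> X; rewrite subr_ge0.
by rewrite ExB ?Ex_cst ?e1 ?subrr//; exact: bmeas_cst.
Qed.

End law.
End quenched.

Lemma measurable_forall dT (T : measurableType dT) (I : countType) (A : I -> set T) :
  (forall i, measurable (A i)) -> measurable [set w | forall i, A i w].
Proof.
move=> mA; rewrite (_ : mkset _ = ~` (\bigcup_i ~` A i)); last first.
  apply/seteqP; split=> w /= h; first by case=> i _; apply.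
  by move=> i; apply: contrapT => nA; apply: h; exists i.
apply: measurableC; apply: countable_bigcupT_measurable => [|i]; first exact: countableP.
exact: measurableC.
Qed.

(** * Measurability of the quenched law in the environment *)

Section quenched_kernel.
Variables (R : realType) (d : nat).
Local Notation L := 'rV[int]_d.
Implicit Types (w : env R d) (x y v : L) (f : L -> R).

Lemma measurable_walk_op (F : env R d -> L -> R) x : (forall y, measurable_fun setT (F^~ y)) ->
  measurable_fun setT (fun w => walk_op w (F w) x).
Proof.
move=> mF; apply: measurable_sum => v; apply: measurable_funM => //.
exact: measurable_tr.
Qed.

Lemma measurable_iter_walk_op f n x : measurable_fun setT (fun w => iter n (walk_op w) f x).
Proof.
elim: n x => [|n IH] x; first exact: measurable_cst.
exact: (@measurable_walk_op (fun w => iter n (walk_op w) f)).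
Qed.

Lemma Ex_visits_measurable x0 t :
  measurable_fun setT (fun w => Ex (quenched_law w x0) (visits R t)).
Proof.
have fb y z : `|(z == y)%:R : R| <= 1 by case: eqP; rewrite ?normr0 ?normr1.
elim/last_ind: t => [|t y].
  rewrite (_ : (fun w => _) = fun=> 1); first exact: measurable_cst.
  apply/funext => w; rewrite -[RHS](Ex_cst (quenched_law w x0)); congr Ex.
  by apply/funext => X; rewrite /visits big_nil.
case/lastP: t => [|t x] IH.
  rewrite (_ : (fun w => _) = fun=> (x0 == y)%:R); first exact: measurable_cst.
  apply/funext => w; have := quenched_Ex w x0 0 (fb y) => /= <-.
  by congr Ex; apply/funext => X; rewrite /visits big_nat1.
rewrite (_ : (fun w => _) = fun w => Ex (quenched_law w x0) (visits R (rcons t x)) *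
    iter 1 (walk_op w) (fun z => (z == y)%:R) x).
  by apply: measurable_funM => //; exact: measurable_iter_walk_op.
apply/funext => w; rewrite -(Ex_visits_fut w x0 t x 1 (fb y)).
by congr Ex; apply/funext => X; rewrite visits_rcons size_rcons addn1.
Qed.

Definition history (t : seq L) : set (traj d) :=
  [set X | forall k, (k < size t)%N -> X k = nth 0 t k].

Lemma measurable_history t : measurable (history t).
Proof.
apply: (@measurable_forall _ (traj d) nat
  (fun k => [set X | (k < size t)%N -> X k = nth 0 t k])) => k.
case: (ltnP k (size t)) => kt; last first.
  by rewrite (_ : mkset _ = setT)//; apply/seteqP; split.
rewrite (_ : mkset _ = [set X : traj d | X k = nth 0 t k]).
  exact: (@measurable_position d k [set nth 0 t k]).
by apply/seteqP; split=> X /=; [apply|].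
Qed.

(** The empty set is added because two incompatible histories have an empty intersection. *)
Definition histories : set (set (traj d)) := [set A | A = set0 \/ exists t, A = history t].

Lemma setI_closed_histories : setI_closed histories.
Proof.
have hI t s : (size t <= size s)%N -> histories (history t `&` history s).
  move=> ts; have [e|e] := pselect (forall k, (k < size t)%N -> nth 0 t k = nth 0 s k).
    right; exists s; apply/seteqP; split=> X /= => [[]//|h]; split=> // k kt.
    by rewrite e// h// (leq_trans kt).
  left; apply/seteqP; split=> // X [h1 h2]; apply: e => k kt.
  by rewrite -h1// -h2// (leq_trans kt).
move=> A B [->|[t ->]]; first by rewrite set0I; left.
move=> [->|[s ->]]; first by rewrite setI0; left.
case: (leqP (size t) (size s)) => [|/ltnW] h; first exact: hI.
by rewrite setIC; exact: hI.
Qed.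

Lemma histories_generate : measurable = <<s histories >> :> set (set (traj d)).
Proof.
apply/seteqP; split; last first.
  apply: smallest_sub; first exact: sigma_algebra_measurable.
  by move=> _ [->|[t ->]]; [exact: measurable0|exact: measurable_history].
apply: smallest_sub; first exact: smallest_sigma_algebra.
move=> _ [n [x ->]].
pose T := g_sigma_algebraType histories.
suff : measurable ([set X : traj d | X n = x] : set T) by [].
rewrite (_ : mkset _ = \bigcup_t
    (if (size t == n.+1) && (nth 0 t n == x) then history t else set0)); last first.
  apply/seteqP; split=> X /= => [Xn|[t _]].
    exists (mkseq X n.+1) => //; rewrite size_mkseq eqxx nth_mkseq// Xn eqxx/=.
    by move=> k; rewrite size_mkseq => kn; rewrite nth_mkseq.
  by case: ifP => // /andP[/eqP tn /eqP <-] h; rewrite h// tn.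
apply: countable_bigcupT_measurable => [|t]; first exact: countableP.
by case: ifP => _; apply: sub_sigma_algebra; [right; exists t|left].
Qed.

(** [quenched_law] is obtained by choice, separately for each environment. Its values on histories
    are nevertheless built from finitely many transition probabilities, and a Dynkin argument
    extends measurability to all events. *)
Lemma measurable_quenched_law x0 U : measurable U ->
  measurable_fun setT (fun w => quenched_law w x0 U).
Proof.
move=> mU; apply: (@dynkin_induction _ (traj d) histories
  (fun U => measurable_fun setT (fun w => quenched_law w x0 U))).
- exact: histories_generate.
- exact: setI_closed_histories.
- rewrite (_ : (fun w => _) = fun=> 1%E); first exact: measurable_cst.
  by apply/funext => w; exact: probability_setT.
- move=> _ [->|[t ->]].
    rewrite (_ : (fun w => _) = fun=> 0%E); first exact: measurable_cst.
    by apply/funext => w; exact: measure0.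
  rewrite (_ : (fun w => _) = fun w => (Ex (quenched_law w x0) (visits R t))%:E).
    by apply/measurable_EFinP; exact: Ex_visits_measurable.
  apply/funext => w; rewrite visitsE Ex_indic ?fineK//; last exact: measurable_history.
  by apply: fin_num_measure; exact: measurable_history.
- move=> S mS hS; rewrite (_ : (fun w => _) = fun w => (1 - quenched_law w x0 S)%E).
    by apply: emeasurable_funB => //; exact: measurable_cst.
  by apply/funext => w; rewrite probability_setC.
- move=> F mF tF hF.
  rewrite (_ : (fun w => _) = fun w => (\sum_(0 <= k <oo) quenched_law w x0 (F k))%E).
    by apply: ge0_emeasurable_sum => // k w _; exact: measure_ge0.
  by apply/funext => w; rewrite measure_bigcup//; apply: eq_eseriesl => k; rewrite in_setT.
by rewrite -histories_generate.
Qed.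

End quenched_kernel.

Section perturbed.
Variables (R : realType) (d : nat) (l : 'rV[R]_d) (lam : R).
Local Notation L := 'rV[int]_d.
Implicit Types (w : env R d) (x y v : L) (f : L -> R).
Hypotheses (l1 : enorm l = 1) (lam01 : 0 < lam < 1).

Lemma lev_steps_le1 v : stepset R v -> `|lev l v| <= 1.
Proof.
case/stepsetP => [->|[i [->|->]]].
- by rewrite lev0 normr0.
- by rewrite [delta_mx _ _]/(evec i) lev_evec; exact: dir_le1.
- by rewrite [delta_mx _ _]/(evec i) levN lev_evec normrN; exact: dir_le1.
Qed.

(** For [lam < 1] positivity and support are automatic, so normalisation alone decides whether
    [perturb] tilts the site. The condition is an explicit measurable equation, as
    [measurable_perturb] requires. *)
Lemma perturb_site_law w x : is_site_law (fun e => (1 + lam * dotp l (toR e)) * tr w x e) <->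
  \sum_i l 0 i * (tr w x (evec i) - tr w x (- evec i)) = 0.
Proof.
have sumE : \sum_(v \in @stepset R d) (1 + lam * dotp l (toR v)) * tr w x v =
    1 + lam * \sum_i l 0 i * (tr w x (evec i) - tr w x (- evec i)).
  rewrite sum_stepset -/(lev l 0) lev0 mulr0 addr0 mul1r tr_sumE -addrA; congr (_ + _).
  rewrite -sumrN -big_split/= mulr_sumr; apply: eq_bigr => i _.
  rewrite -/(lev l (evec i)) -/(lev l (- evec i)) levN lev_evec.
  by ring.
have /andP[lam0 lam1] := lam01.
split=> [[_ _]|s0].
  rewrite sumE => /eqP; rewrite -subr_eq0 addrC addKr mulf_eq0 (gt_eqF lam0)/=.
  by move/eqP.
split=> [v|v /(tr_out w x)->|]; last by rewrite sumE s0 mulr0 addr0.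
- have [Vv|/(tr_out w x)->] := pselect (stepset R v); last by rewrite mulr0.
  rewrite mulr_ge0 ?tr_ge0//; have := lev_steps_le1 Vv; rewrite ler_norml => /andP[h _].
  by rewrite -/(lev l v); nra.
- by rewrite mulr0.
Qed.

Lemma measurable_perturb : measurable_fun setT (@perturb R d l lam).
Proof.
apply: measurable_to_env => x v.
rewrite (_ : (fun w => _) = fun w =>
  if \sum_i l 0 i * (tr w x (evec i) - tr w x (- evec i)) == 0
  then (1 + lam * dotp l (toR v)) * tr w x v else tr w x v); last first.
  apply/funext => w; rewrite /perturb {1}/tr; case: eqP => [/perturb_site_law h|h].
    by rewrite insubdK//; exact: mem_set.
  rewrite /insubd insubN//; apply/negP => /set_mem/perturb_site_law.
  exact: h.
apply: measurable_fun_ifT; last exact: measurable_tr.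
  apply: measurable_fun_eqr; last exact: measurable_cst.
  apply: measurable_sum => i; apply: measurable_funM; first exact: measurable_cst.
  by apply: measurable_funB; exact: measurable_tr.
by apply: measurable_funM; [exact: measurable_cst|exact: measurable_tr].
Qed.

Lemma walk_op_perturb w kap f x : (forall x, balanced_at kap w x) ->
  walk_op (perturb l lam w) f x = walk_step l lam (weights kap w) f x.
Proof.
move=> bal.
have tb y i : tr w y (evec i) = tr w y (- evec i).
  by have /forallP/(_ i)/andP[/eqP] := bal y.
have pE y e : tr (perturb l lam w) y e = (1 + lam * lev l e) * tr w y e.
  by apply: perturbE => // i; exact: tb.
have wE y i : weights kap w y i = tr w y (evec i) by rewrite /weights bal.
rewrite /walk_op /unit_steps big_cons big_cat/= !big_map -big_split/= stepE addr0 !pE lev0.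
rewrite tr_sumE mulr0 addr0 mul1r mulr_sumr; congr (_ * _ + _).
  congr (1 - _); apply: eq_bigr => i _; rewrite wE -tb; ring.
apply: eq_bigr => i _; rewrite !pE levN lev_evec -tb wE; ring.
Qed.

(** The generator of coordinate [i] is [2 * lam * l 0 i * c x i], the local drift that [pot]
    accumulates. *)
Lemma iter_step_coord c i n x :
  iter n (walk_step l lam c) (fun y => (y 0 i)%:~R) x = (x 0 i)%:~R + lam * l 0 i * pot l lam i c n x.
Proof.
elim: n x => [|n IH] x; first by rewrite mulr0 addr0.
rewrite iterS (_ : iter n _ _ = fun y => (y 0 i)%:~R + lam * l 0 i * pot l lam i c n y); last first.
  exact/funext.
rewrite {1}/walk_step (_ : gen _ _ _ _ _ = gen l lam c (fun y =>
    1 * (y 0 i)%:~R + (lam * l 0 i) * pot l lam i c n y) x); last first.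
  by congr gen; apply/funext => y; rewrite mul1r.
rewrite gen_lin (_ : gen l lam c (fun y => (y 0 i)%:~R) x = 2 * lam * (l 0 i) * c x i).
  by rewrite /= /walk_step; ring.
rewrite /gen (bigD1 i)//= big1 ?addr0.
  by rewrite coord_add coord_sub eqxx rmorphD rmorphB/=; ring.
move=> k ki; rewrite coord_add coord_sub (negPf ki) ?addr0 ?subr0; ring.
Qed.

End perturbed.

(** * Mean position under a quenched law *)

Section mean_position.
Variables (R : realType) (d : nat) (u : env R d).
Local Notation L := 'rV[int]_d.
Local Notation mu := (quenched_law u 0).
Implicit Types (x y v : L) (f g : L -> R).

Definition mean_pos n i : R := iter n (walk_op u) (fun y => (y 0 i)%:~R) 0.

Lemma walk_op_local f g n x : (forall y, y \in box x n -> f y = g y) ->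
  iter n (walk_op u) f x = iter n (walk_op u) g x.
Proof.
elim: n x => [|n IH] x fg; first by apply: fg; exact: box_refl.
rewrite !iterS /walk_op; apply: eq_big_seq => v; rewrite inE mem_cat => vS; congr (_ * _).
apply: IH => y yb; apply: fg.
case/predU1P: vS yb => [->|/orP[/mapP[i _ ->]|/mapP[i _ ->]]] yb.
- by rewrite addr0 in yb; exact: box_le yb.
- by apply: (@box_nbr_le _ _ _ _ i); rewrite yb.
- by apply: (@box_nbr_le _ _ _ _ i); rewrite yb orbT.
Qed.

Lemma iter_walk_op0 n x : iter n (walk_op u) (fun=> 0) x = 0.
Proof.
elim: n x => [//|n IH] x; rewrite iterS /walk_op big1// => v _.
by rewrite IH mulr0.
Qed.

Lemma walk_range n : {ae mu, forall X : traj d, X n \in box 0 n}.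
Proof.
have mA := @measurable_position d n [set y | y \notin box 0 n].
exists [set X : traj d | X n \notin box 0 n]; split => //.
have fb y : `|(y \notin box 0 n)%:R : R| <= 1 by case: (_ \notin _); rewrite ?normr0 ?normr1.
have := quenched_Ex u 0 n fb; rewrite (@walk_op_local _ (fun=> 0)); last first.
  by move=> y ->.
rewrite iter_walk_op0 (_ : (fun X => _) = \1_[set X : traj d | X n \notin box 0 n]); last first.
  apply/funext => X; rewrite indicE; congr (_%:R); congr nat_of_bool.
  by apply/idP/idP => [h|/set_mem//]; exact: mem_set.
rewrite Ex_indic// => h; rewrite -[LHS]fineK ?h//; exact: fin_num_measure.
by move=> X /= /negP.
Qed.

(** Coordinates are unbounded, whereas [quenched_Ex] is for bounded functions. At time [n] the walk
    is almost surely in [box 0 n], where truncation at [n] or more changes nothing. *)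
Definition clip (N : nat) (r : R) : R := Num.max (- N%:R) (Num.min N%:R r).

Lemma clip_bound N r : `|clip N r| <= N%:R.
Proof.
have N0 : 0 <= N%:R :> R by rewrite ler0n.
by rewrite ler_norml /clip /Num.max /Num.min; case: ifP; case: ifP; lra.
Qed.

Lemma clip_id N r : `|r| <= N%:R -> clip N r = r.
Proof.
by rewrite ler_norml /clip => /andP[h1 h2]; rewrite (min_idPr h2) (max_idPr h1).
Qed.

Lemma clip_box m N y i : (m <= N)%N -> y \in box 0 m -> clip N (y 0 i)%:~R = (y 0 i)%:~R.
Proof.
move=> mN; rewrite mem_box => /forallP/(_ i); rewrite mxE subr0 => h.
apply: clip_id; rewrite -intr_norm -[N%:R]/(N%:Z%:~R) ler_int (le_trans h)//.
Qed.

Lemma bmeas_clip N m i : bmeas (fun X : traj d => clip N (X m 0 i)%:~R).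
Proof.
apply: (@bmeas_position R d m (fun y => clip N (y 0 i)%:~R) N%:R) => y.
exact: clip_bound.
Qed.

Lemma Ex_clip m N i : (m <= N)%N -> Ex mu (fun X => clip N (X m 0 i)%:~R) = mean_pos m i.
Proof.
move=> mN; rewrite (@quenched_Ex R d u 0 (fun y => clip N (y 0 i)%:~R) N%:R).
  by apply: walk_op_local => y; exact: clip_box.
by move=> y; exact: clip_bound.
Qed.

Lemma measurable_pos m i : measurable_fun setT (fun X : traj d => (X m 0 i)%:~R : R).
Proof.
by move=> _ Y mY; rewrite setTI; exact: (@measurable_position d m ((fun y => (y 0 i)%:~R) @^-1` Y)).
Qed.

Lemma walk_mean (a s : R) i : let n := Num.truncn s in
  Ex mu (fun X => a * walk_at X s 0 i) =
  a * (mean_pos n i + (s - n%:R) * (mean_pos n.+1 i - mean_pos n i)).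
Proof.
move=> n; have bc m := bmeas_clip n.+1 m i.
rewrite -(Ex_clip i (leqnSn n)) -(Ex_clip i (leqnn n.+1)).
rewrite -ExB// -ExZ; last exact: bmeasB.
rewrite -ExD//; last exact: bmeasZ (bmeasB (bc _) (bc _)).
have bW := bmeasZ a (bmeasD (bc n) (bmeasZ (s - n%:R) (bmeasB (bc n.+1) (bc n)))).
rewrite -ExZ//; last exact: bmeasD (bc n) (bmeasZ (s - n%:R) (bmeasB (bc n.+1) (bc n))).
have mW : measurable_fun setT (fun X : traj d => a * walk_at X s 0 i).
  rewrite (_ : (fun X => _) = fun X : traj d => a * ((X n 0 i)%:~R +
      (s - n%:R) * ((X n.+1 0 i)%:~R - (X n 0 i)%:~R))).
    apply: measurable_funM => //; apply: measurable_funD; first exact: measurable_pos.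
    by apply: measurable_funM => //; apply: measurable_funB; exact: measurable_pos.
  by apply/funext => X; rewrite /walk_at !mxE.
apply: Ex_ae_eq => //.
  have [] : bmeas (fun X : traj d => a * (clip n.+1 (X n 0 i)%:~R + (s - n%:R) *
      (clip n.+1 (X n.+1 0 i)%:~R - clip n.+1 (X n 0 i)%:~R))).
    exact: bW.
  by [].
apply: filterS2 (walk_range n) (walk_range n.+1) => X h1 h2.
by rewrite /walk_at !mxE (clip_box _ _ h1)// (clip_box _ _ h2).
Qed.

Lemma quenched_speed i (a : R) :
  {ae mu, forall X : traj d, (X n 0 i)%:~R / n%:R @[n --> \oo] --> a} ->
  mean_pos n i / n%:R @[n --> \oo] --> a.
Proof.
move=> ae.
have -> : (fun n => mean_pos n i / n%:R) =
    fun n => Ex mu (fun X => n%:R^-1 * clip n (X n 0 i)%:~R).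
  by apply/funext => n; rewrite ExZ ?Ex_clip// 1?mulrC//; exact: bmeas_clip.
apply: (@Ex_cvg _ _ _ _ _ _ 1).
- by move=> n; apply: bmeasZ; exact: bmeas_clip.
- move=> n X; rewrite normrM ger0_norm ?invr_ge0//.
  have := clip_bound n (X n 0 i)%:~R; case: n => [|n] h; first by rewrite invr0 mul0r.
  by rewrite mulrC ler_pdivrMr ?mul1r// ltr0n.
have /ae_foralln : forall n, {ae mu, forall X : traj d, X n \in box 0 n} by exact: walk_range.
apply: filterS2 ae => X h hb; apply: cvg_trans h; apply: near_eq_cvg.
by apply: nearW => n; rewrite (clip_box _ (leqnn n) (hb n)) mulrC.
Qed.

End mean_position.

Section annealed_speed.
Variables (R : realType) (d : nat) (P : probability (env R d) R) (l : 'rV[R]_d) (lam : R).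
Local Notation L := 'rV[int]_d.
Hypotheses (l1 : enorm l = 1) (lam01 : 0 < lam < 1).

Definition perturbed_kernel (w : env R d) : {measure set (traj d) -> \bar R} :=
  quenched_law (perturb l lam w) 0.

Let mk U : measurable U -> measurable_fun setT (perturbed_kernel ^~ U).
Proof.
move=> mU; exact: (measurableT_comp (measurable_quenched_law 0 mU) (measurable_perturb l1 lam01)).
Qed.

HB.instance Definition _ := isKernel.Build _ _ _ _ R perturbed_kernel mk.

Let pk w : perturbed_kernel w setT = 1%E.
Proof. exact: probability_setT. Qed.

HB.instance Definition _ := Kernel_isProbability.Build _ _ _ _ R perturbed_kernel pk.

(** [annealed_law] integrates the quenched mass of sections, so a null set has null sections for
    almost every environment. *)
Lemma annealed_ae (S : set (env R d * traj d)) : {ae annealed_law P l lam, forall z, S z} ->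
  {ae P, forall w, {ae quenched_law (perturb l lam w) 0, forall X, S (w, X)}}.
Proof.
move=> [N [mN N0 SN]].
have mf : measurable_fun setT (fun w => perturbed_kernel w (xsection N w)).
  by apply: (@measurable_fun_xsection_finite_kernel _ _ _ _ _ perturbed_kernel N); rewrite inE.
have : (\int[P]_w `|perturbed_kernel w (xsection N w)| = 0)%E.
  rewrite -[RHS]N0; apply: eq_integral => w _.
  by rewrite gee0_abs//; exact: measure_ge0.
move/(ae_eq_integral_abs _ measurableT mf).
apply: filterS => w /(_ Logic.I) h.
exists (xsection N w); split => //; first exact: measurable_xsection.
by move=> X /= nS; rewrite /xsection/= inE; exact: (SN (w, X)).
Qed.

Lemma annealed_speed v i : is_speed P l lam v ->
  {ae P, forall w, mean_pos (perturb l lam w) n i / n%:R @[n --> \oo] --> v 0 i}.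
Proof.
move=> /annealed_ae; apply: filterS => w h; apply: quenched_speed.
apply: filterS h => X /= h.
have h1 : (n%:R^-1 *: walk_at X n%:R : 'rV[R]_d) @[n --> \oo] --> v.
  apply: (@cvg_comp _ _ _ (fun n : nat => n%:R : R) (fun t => t^-1 *: walk_at X t) _ _ _ _ h).
  exact: cvgr_idn.
have h2 := @cvg_comp _ _ _ _ (fun M : 'rV[R]_d => M 0 i) _ _ _ h1
  (@coord_continuous R 1 d 0 i v).
apply: cvg_trans h2; apply: near_eq_cvg; apply: nearW => n /=.
by rewrite !mxE natrK subrr mul0r addr0 mulrC.
Qed.

End annealed_speed.

Section random_environment_bounds.
Variables (R : realType) (d : nat) (P : probability (env R d) R).
Local Notation L := 'rV[int]_d.

Lemma prob1_ae (A : set (env R d)) : measurable A -> P A = 1%E -> {ae P, forall w, A w}.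
Proof.
move=> mA PA; exists (~` A); split; [exact: measurableC| |by []].
by rewrite probability_setC// PA subee.
Qed.

Lemma balanced_at_ae : (0 < d)%N -> balanced_env P -> uniformly_elliptic_env P ->
  exists kap : R, [/\ 0 < kap, kap <= 1, kap <= (2 * d%:R)^-1 &
    {ae P, forall w, forall x, balanced_at kap w x}].
Proof.
move=> d0 bal [kappa kappa0 ell].
have d1 : 1 <= d%:R :> R by rewrite ler1n.
have di : 0 < (2 * d%:R)^-1 :> R by rewrite invr_gt0; lra.
(* The second bound makes the simple random walk, the default value of [weights], admissible. *)
exists (Num.min kappa (2 * d%:R)^-1); split.
- by rewrite lt_min kappa0.
- by rewrite ge_min; apply/orP; right; rewrite invf_le1; lra.
- by rewrite ge_min lexx orbT.
have meq i x : measurable [set w : env R d | tr w x (delta_mx 0 i) = tr w x (- delta_mx 0 i)].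
  have mf : measurable_fun setT (fun w : env R d => tr w x (delta_mx 0 i) - tr w x (- delta_mx 0 i)).
    by apply: measurable_funB; exact: measurable_tr.
  have := mf measurableT [set 0] (measurable_set1 _); rewrite setTI.
  rewrite (_ : _ @^-1` _ = [set w : env R d | tr w x (delta_mx 0 i) = tr w x (- delta_mx 0 i)])//.
  apply/seteqP; split=> w /= h; first by apply/eqP; rewrite -subr_eq0 h.
  by rewrite h subrr.
have hb : {ae P, forall w, forall (i : 'I_d) x, tr w x (delta_mx 0 i) = tr w x (- delta_mx 0 i)}.
  apply: (prob1_ae _ bal); apply: measurable_forall => i.
  exact: (@measurable_forall _ (env R d) L (fun x => [set w | tr w x (delta_mx 0 i) = tr w x (- delta_mx 0 i)])).
have he : {ae P, forall w, forall e : L, enorm (toR e : 'rV[R]_d) = 1 -> forall x : L, kappa < tr w x e}.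
  apply: (prob1_ae _ ell); apply: (@measurable_forall _ (env R d) L
    (fun e => [set w | enorm (toR e : 'rV[R]_d) = 1 -> forall x : L, kappa < tr w x e])) => e.
  have [e1|e1] := pselect (enorm (toR e : 'rV[R]_d) = 1); last first.
    by rewrite (_ : mkset _ = setT)//; apply/seteqP; split=> w //= _ /e1.
  rewrite (_ : mkset _ = [set w : env R d | forall x, kappa < tr w x e]); last first.
    by apply/seteqP; split=> w /=; [apply|].
  apply: (@measurable_forall _ (env R d) L (fun x => [set w | kappa < tr w x e])) => x.
  rewrite -[X in measurable X]setTI.
  have := @measurable_tr R d x e measurableT `]kappa, +oo[%classic (measurable_itv _).
  rewrite !setTI (_ : _ @^-1` _ = [set w : env R d | kappa < tr w x e])//.
  by apply/seteqP; split=> w /=; rewrite in_itv/= andbT.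
apply: filterS2 hb he => w hb he x; apply/forallP => i; apply/andP; split.
  by apply/eqP; exact: hb.
by rewrite gt_min he//; exact: enorm_evec.
Qed.

End random_environment_bounds.

(** * The rate of convergence *)

Section rate.
Variables (R : realType) (d : nat) (P : probability (env R d) R) (l : 'rV[R]_d) (kap lam : R).
Hypotheses (d2 : (2 <= d)%N) (iidP : iid_env P) (l1 : enorm l = 1) (lam01 : 0 < lam < 1).
Hypotheses (kap0 : 0 < kap) (kap1 : kap <= 1) (kapd : kap <= (2 * d%:R)^-1).
Hypotheses (lamS : lam * ov_scale d kap <= 1).
Hypothesis good : {ae P, forall w, forall x, balanced_at kap w x}.
Variable i : 'I_d.
Implicit Types (w : env R d).
Local Notation u := (mean_pot P l lam i (weights kap)).

Let lam0 : 0 < lam. Proof. by case/andP: lam01. Qed.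
Let lamH : lam <= 1 / 2. Proof. exact: lam_le_half lamS. Qed.

Let adm w : admissible kap (weights kap w).
Proof. by apply: admissible_weights => //; exact: ltnW. Qed.

Lemma mean_pos_perturb w n : (forall x, balanced_at kap w x) ->
  mean_pos (perturb l lam w) n i = lam * l 0 i * pot l lam i (weights kap w) n 0.
Proof.
move=> bal; rewrite /mean_pos (_ : walk_op _ = walk_step l lam (weights kap w)).
  by rewrite iter_step_coord mxE add0r.
by apply/funext => f; apply/funext => x; exact: walk_op_perturb.
Qed.

Lemma measurable_mean_pos n : measurable_fun setT (fun w => mean_pos (perturb l lam w) n i).
Proof.
exact: (measurableT_comp (@measurable_iter_walk_op R d _ n 0) (measurable_perturb l1 lam01)).
Qed.

Let bpot n : bmeas (fun w => pot l lam i (weights kap w) n 0).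
Proof. by apply: bmeas_pot => x k; exact: bmeas_weights. Qed.

Lemma annealed_walk (a s : R) : let n := Num.truncn s in
  vexpect P (fun w => vexpect (quenched_law (perturb l lam w) 0) (fun X =>
    a *: walk_at X s)) 0 i =
  a * (lam * l 0 i * (u n + (s - n%:R) * (u n.+1 - u n))).
Proof.
move=> n.
have -> : vexpect P (fun w => vexpect (quenched_law (perturb l lam w) 0) (fun X =>
    a *: walk_at X s)) 0 i = Ex P (fun w => Ex (quenched_law (perturb l lam w) 0)
      (fun X => a * walk_at X s 0 i)).
  rewrite mxE; congr Ex; apply/funext => w; rewrite mxE; congr Ex.
  by apply/funext => X; rewrite mxE.
rewrite (_ : (fun w => Ex _ _) = fun w => a * (mean_pos (perturb l lam w) n i +
    (s - n%:R) * (mean_pos (perturb l lam w) n.+1 i - mean_pos (perturb l lam w) n i))); last first.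
  by apply/funext => w; exact: walk_mean.
pose b := lam * l 0 i; pose p m (w : env R d) := pot l lam i (weights kap w) m 0.
have bp m : bmeas (p m) by exact: bpot.
have b0 := bmeasZ (s - n%:R) (bmeasB (bp n.+1) (bp n)).
have b1 := bmeasD (bp n) b0; have b2 := bmeasZ b b1; have bW := bmeasZ a b2.
rewrite (@Ex_ae_eq _ _ _ _ _
  (fun w => a * (b * (p n w + (s - n%:R) * (p n.+1 w - p n w))))); first last.
- apply: filterS good => w bal; rewrite !mean_pos_perturb// -/(p n w) -/(p n.+1 w) /b.
  by ring.
- by case: bW.
- have h m := measurable_mean_pos m.
  apply: measurable_funM => //; apply: measurable_funD => //.
  by apply: measurable_funM => //; exact: measurable_funB.
rewrite (ExZ P a b2) (ExZ P b b1) (ExD P (bp n) b0) (ExZ P _ (bmeasB (bp n.+1) (bp n))).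
by rewrite (ExB P (bp n.+1) (bp n)).
Qed.

Lemma mean_pot_speed v : is_speed P l lam v ->
  lam * l 0 i * (u n / n%:R) @[n --> \oo] --> v 0 i.
Proof.
move=> /annealed_speed - /(_ l1 lam01 i) h.
pose p m (w : env R d) := pot l lam i (weights kap w) m 0.
have -> : (fun n => lam * l 0 i * (u n / n%:R)) =
    fun n => Ex P (fun w => (lam * l 0 i / n%:R) * p n w).
  apply/funext => n; rewrite ExZ; last exact: bpot.
  by rewrite (_ : Ex P _ = u n)//; ring.
apply: (@Ex_cvg _ _ _ _ _ _ 1).
- by move=> n; apply: bmeasZ; exact: bpot.
- move=> n w; have /andP[p0 pn] := pot_bounds i l1 lam0 lamH kap0 n 0 (adm w).
  rewrite mulrAC -mulrA normrM; have := bias_le l1 lam0 lamH i.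
  have : `|p n w / n%:R| <= 1.
    rewrite ger0_norm ?divr_ge0// /p; case: n p0 pn => [|n] p0 pn.
      by rewrite invr0 mulr0.
    by rewrite ler_pdivrMr ?mul1r// ltr0n.
  have := normr_ge0 (p n w / n%:R); have := normr_ge0 (lam * l 0 i).
  by nra.
apply: filterS2 good h => w bal; apply: cvg_trans; apply: near_eq_cvg.
apply: nearW => n; rewrite /= mean_pos_perturb// /p; ring.
Qed.

(** When [1 <= 2 * lam * sqrt n], the error [osc_cst / lam ^+ 2] is at most
    [2 * osc_cst * sqrt n / lam]; the [3] comes from [1 + 2 * sqrt n <= 3 * sqrt n]. *)
Definition rate_cst : R := 2 * osc_cst d kap + 3 / kap.

Lemma osc_cst_ge0 : 0 <= osc_cst d kap.
Proof.
have g0 := ov_gain_gt0 d2 kap0 kap1; have k0 := kap0; rewrite /osc_cst.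
have h1 : 0 <= 9 * 25 / kap by rewrite divr_ge0 ?(ltW k0)// mulr_ge0.
have h2 : 0 <= 8 / (kap * ov_gain d kap) by rewrite divr_ge0// mulr_ge0 ?(ltW k0) ?(ltW g0).
by lra.
Qed.

Lemma rate_cst_ge0 : 0 <= rate_cst.
Proof.
have k0 := kap0; have h := osc_cst_ge0.
have h1 : 0 <= 3 / kap by rewrite divr_ge0 ?(ltW k0).
by rewrite /rate_cst; lra.
Qed.

Lemma mean_pot_doubling n : 1 <= 2 * lam ^+ 2 * n%:R -> 
  `|u (n + n)%N - u n - u n| <= rate_cst / lam * Num.sqrt n%:R.
Proof.
move=> hn; have hl := lam0; have hk := kap0.
have n0 : (0 < n)%N by case: n hn => //; rewrite mulr0 ler10.
have n1 : 1 <= n%:R :> R by rewrite ler1n.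
set S := Num.sqrt n%:R.
have S1 : 1 <= S by rewrite -sqrtr1 ler_sqrt// ltW.
have SS : S ^+ 2 = n%:R by rewrite sqr_sqrtr.
have lS : 1 <= 2 * (lam * S).
  have : 1 <= (2 * (lam * S)) ^+ 2 by rewrite !exprMn SS; nra.
  have : 0 <= 2 * (lam * S) by rewrite !mulr_ge0//; lra.
  by move=> h0 h1; rewrite -(@ler_pXn2r _ 2)// ?nnegrE// expr1n.
have o0 := osc_cst_ge0.
apply: le_trans (mean_pot_almost_additive i l1 lam0 lamH kap0
  (fun x k => bmeas_weights kap x k) adm _ (resample_half_space (l := l) iidP) _
  (Ex_translate iidP) n d2 kap1 lamS n0) _.
- by move=> y w' w x; case: ifP => h; apply: eq_weights; rewrite tr_glue h.
- by [].
have -> : rate_cst / lam * S = osc_cst d kap / lam ^+ 2 * (2 * (lam * S)) + (kap * lam)^-1 * (3 * S).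
  by rewrite /rate_cst; field; rewrite !gt_eqF.
apply: lerD.
  by rewrite ler_peMr// divr_ge0// exprn_ge0// ltW.
by rewrite ler_wpM2l ?invr_ge0 ?mulr_ge0 ?(ltW kap0) ?(ltW lam0)//; rewrite -/S; lra.
Qed.

Lemma mean_pot_rate v (s : R) : is_speed P l lam v -> lam^-2 <= s -> l 0 i != 0 ->
  `|u (Num.truncn s) + (s - (Num.truncn s)%:R) * (u (Num.truncn s).+1 - u (Num.truncn s))
    - s * (v 0 i / (lam * l 0 i))| <= 4 * (rate_cst / lam) * Num.sqrt s.
Proof.
move=> hv hs li; set n := Num.truncn s; set q := v 0 i / (lam * l 0 i); have hl := lam0; have hl2 := lamH.
have b0 : lam * l 0 i != 0 by rewrite mulf_neq0// gt_eqF.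
have lam2 : 0 < lam ^+ 2 by rewrite exprn_gt0.
have lam21 : lam ^+ 2 <= 1 by rewrite expr_le1 ?ltW//; lra.
have L1 : 1 <= lam^-2 by rewrite -exprVn exprVn invf_ge1.
have A0 : 0 <= rate_cst / lam by rewrite divr_ge0 ?rate_cst_ge0// ltW.
have s0 : 0 <= s by lra.
(* The integer part of [s] may fall short of [lam^-2] by less than 1; the factor 2 makes up for
   it. *)
have big m : lam^-2 <= m%:R + 1 -> (0 < m)%N -> 1 <= 2 * lam ^+ 2 * m%:R.
  move=> h m0; have m1 : 1 <= m%:R :> R by rewrite ler1n.
  have : lam ^+ 2 * lam^-2 <= lam ^+ 2 * (m%:R + 1) by rewrite ler_wpM2l// ltW.
  by rewrite mulfV ?gt_eqF//; nra.
have n0 : (0 < n)%N by rewrite truncn_gt0; lra.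
have nS : s < n%:R + 1 by rewrite natr1; exact: truncnS_gt.
have ns : n%:R <= s by rewrite -truncn_ge_nat.
have q_lim : u m / m%:R @[m --> \oo] --> q.
  rewrite /q [v 0 i / _]mulrC; have h := mean_pot_speed hv.
  have -> : (fun m => u m / m%:R) =
      fun m => (lam * l 0 i)^-1 * (lam * l 0 i * (u m / m%:R)).
    by apply/funext => m; rewrite mulKf.
  exact: cvgMl_tmp h.
have rate m : (n <= m)%N -> `|u m - m%:R * q| <= 2 * (rate_cst / lam) * Num.sqrt m%:R.
  move=> nm; apply: (@sqrt_rate _ u q _ n A0 _ q_lim m nm); last exact: leq_trans nm.
  move=> k nk; apply: mean_pot_doubling; apply: big; last exact: leq_trans nk.
  have hk : n%:R <= k%:R :> R by rewrite ler_nat.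
  by lra.
have r1 := rate n (leqnn n); have r2 := rate n.+1 (leqnSn n).
set th := s - n%:R; have th0 : 0 <= th by rewrite /th; lra.
have th1 : th <= 1 by rewrite /th; lra.
have sq m : (m <= n.+1)%N -> Num.sqrt m%:R <= 2 * Num.sqrt s.
  move=> mn; have n1 : 1 <= n%:R :> R by rewrite ler1n.
  have -> : 2 = Num.sqrt (2 ^+ 2) :> R by rewrite sqrtr_sqr ger0_norm.
  rewrite -sqrtrM ?exprn_ge0// ler_sqrt ?mulr_ge0 ?exprn_ge0//.
  have : m%:R <= n%:R + 1 :> R by rewrite natr1 ler_nat.
  by lra.
have -> : u n + th * (u n.+1 - u n) - s * q =
    (1 - th) * (u n - n%:R * q) + th * (u n.+1 - n.+1%:R * q).
  by rewrite -natr1 /th; ring.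
apply: le_trans (ler_normD _ _) _; rewrite !normrM (ger0_norm th0) ger0_norm ?subr_ge0//.
have bnd m : (m <= n.+1)%N -> 2 * (rate_cst / lam) * Num.sqrt m%:R <= 4 * (rate_cst / lam) * Num.sqrt s.
  move=> mn; have := sq m mn; have : 0 <= Num.sqrt s by exact: sqrtr_ge0.
  have hm : 0 <= Num.sqrt (m%:R : R) by exact: sqrtr_ge0.
  by nra.
have e1 := le_trans r1 (bnd n (leqnSn n)); have e2 := le_trans r2 (bnd n.+1 (leqnn _)).
set B := 4 * _ * _ in e1 e2 *.
have f1 : (1 - th) * `|u n - n%:R * q| <= (1 - th) * B by rewrite ler_wpM2l// subr_ge0.
have f2 : th * `|u n.+1 - n.+1%:R * q| <= th * B by rewrite ler_wpM2l.
by lra.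
Qed.

End rate.

Lemma enorm_le (R : realType) (d : nat) (x : 'rV[R]_d) (B : R) : 0 <= B ->
  (forall i, `|x 0 i| <= B) -> enorm x <= d%:R * B.
Proof.
move=> B0 xB; case: d x xB => [|d] x xB.
  by rewrite /enorm /dotp big_ord0 sqrtr0 mul0r.
have dB : 0 <= d.+1%:R * B by rewrite mulr_ge0.
rewrite -(ger0_norm dB) -sqrtr_sqr /enorm ler_sqrt ?sqr_ge0//.
apply: (@le_trans _ _ (\sum_(i < d.+1) B ^+ 2)).
  apply: ler_sum => i _; rewrite -expr2 -real_normK ?num_real//.
  by rewrite ler_pXn2r ?nnegrE.
rewrite sumr_const card_ord -[_ *+ _]mulr_natl exprMn ler_wpM2r ?sqr_ge0//.
by rewrite expr2 ler_peMr ?ler0n// ler1n.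
Qed.

Theorem theorem1p8 (R : realType) (d : nat) (hd : (2 <= d)%N)
    (P : probability (env R d) R) (l : 'rV[R]_d) :
  iid_env P -> balanced_env P -> uniformly_elliptic_env P ->
  enorm l = 1 ->
  exists (C lam0 : R), 0 < lam0 /\
    forall lam : R, 0 < lam < 1 -> lam < lam0 ->
    forall v : 'rV[R]_d, is_speed P l lam v ->
    forall t : R, 1 <= t ->
      enorm (vexpect P (fun w =>
               vexpect (quenched_law (perturb l lam w) 0) (fun X =>
                 (t / lam)^-1 *: walk_at X (t / lam ^+ 2)))
             - lam^-1 *: v)
        <= C / t `^ (5^-1).
Proof.
move=> iidP balP ellP l1.
have [kap [kap0 kap1 kapd good]] := balanced_at_ae (ltnW hd) balP ellP.
have sc := ov_scale_ge2 hd kap0 kap1.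
have r0 := rate_cst_ge0 hd kap0 kap1.
set rc := rate_cst d kap in r0.
exists (d%:R * (4 * rc)), (ov_scale d kap)^-1; split; first by rewrite invr_gt0; lra.
move=> lam lam01 lamlt v hv t t1; have /andP[lam0 lam1] := lam01.
have lamS : lam * ov_scale d kap <= 1.
  by rewrite -ler_pdivlMr ?mul1r ?ltW//; lra.
set s := t / lam ^+ 2; set T := Num.sqrt t.
have T0 : 0 < T by rewrite sqrtr_gt0; lra.
have TT : t = T ^+ 2 by rewrite sqr_sqrtr//; lra.
have sS : Num.sqrt s = T / lam.
  rewrite /s TT -expr_div_n sqrtr_sqr ger0_norm// divr_ge0// ltW//.
have hs : lam^-2 <= s by rewrite /s ler_peMl// invr_ge0 exprn_ge0// ltW.
have comp i : `|(vexpect P (fun w => vexpect (quenched_law (perturb l lam w) 0) (fun X =>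
    (t / lam)^-1 *: walk_at X s)) - lam^-1 *: v) 0 i| <= 4 * rc / T.
  rewrite mxE (annealed_walk l1 lam01 good) !mxE.
  (* In a coordinate direction orthogonal to [l] the quotient by [lam * l 0 i] has no meaning, but
     there the speed and the mean displacement both vanish. *)
  have [li|li] := eqVneq (l 0 i) 0.
    have -> : v 0 i = 0.
      apply: (cvg_unique _ (mean_pot_speed hd l1 lam01 kap0 kap1 kapd lamS good hv)) => //.
      rewrite li mulr0 (_ : (fun n => _) = fun=> 0); first exact: cvg_cst.
      by apply/funext => n; rewrite mul0r.
    rewrite li mulr0.
    by rewrite mul0r !mulr0 subr0 normr0 divr_ge0 ?mulr_ge0// ltW.
  have := mean_pot_rate hd iidP l1 lam01 kap0 kap1 kapd lamS good hv hs li.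
  set X := (X in `|X - _| <= _) => h.
  have -> : (t / lam)^-1 * (lam * l 0 i * X) - lam^-1 * v 0 i =
      l 0 i / s * (X - s * (v 0 i / (lam * l 0 i))).
    have tN0 : t != 0 by rewrite gt_eqF//; lra.
    by rewrite /s; field; rewrite li tN0 (gt_eqF lam0).
  rewrite normrM; apply: le_trans (ler_wpM2l (normr_ge0 _) h) _.
  have s0 : 0 < s by rewrite divr_gt0 ?exprn_gt0//; lra.
  have -> : `|l 0 i / s| * (4 * (rate_cst d kap / lam) * Num.sqrt s) = `|l 0 i| * (4 * rc / T).
    rewrite normrM normfV (gtr0_norm s0) sS /s TT /rc; field.
    by rewrite !gt_eqF.
  by rewrite ler_piMl ?dir_le1// divr_ge0 ?mulr_ge0// ltW.
apply: le_trans (enorm_le _ comp) _; first by rewrite divr_ge0 ?mulr_ge0// ltW.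
rewrite !mulrA ler_wpM2l ?mulr_ge0//.
rewrite lef_pV2 ?posrE ?powR_gt0//; last lra.
rewrite /T -powR12_sqrt; last lra.
by apply: ler_powR => //; rewrite lef_pV2 ?posrE// ler_nat.
Qed.
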